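(* Let the environment $\omega=\{\omega_x\}_{x\in\mathbb Z}$ be i.i.d. under $P$ with $P(\omega_0=1)<1$ and $\kappa>2$. Let $\overline F_{n,\omega}(x)=P_\omega\left(\frac{T_n-E_\omega[T_n]}{\sqrt{\operatorname{Var}_\omega(T_n)}}\le x\right)$, $x\in\mathbb R$, be the normalized quenched distribution of $T_n$. (1) If $\kappa>3$, then there exists a (deterministic) constant $C\in(0,\infty)$ such that $$\limsup_{n\to\infty}\sqrt n\,\left\|\overline F_{n,\omega}-\Phi\right\|_\infty\le C,\qquad P\text{-a.s.}$$ (2) If $\kappa\in(2,3]$, then for any $\varepsilon>0$, $$\lim_{n\to\infty}n^{\frac32-\frac3\kappa-\varepsilon}\left\|\overline F_{n,\omega}-\Phi\right\|_\infty=0,\qquad P\text{-a.s.}$$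
   Context: One-dimensional nearest-neighbor random walk in a random environment (RWRE). An environment is a random sequence $\omega=\{\omega_x\}_{x\in\mathbb Z}\in[0,1]^{\mathbb Z}$ with law $P$ (expectation $E$). Given $\omega$ and $x\in\mathbb Z$, $P_\omega^x$ (the quenched law) is the law of the Markov chain $\{X_n\}_{n\ge0}$ on $\mathbb Z$ with $P_\omega^x(X_0=x)=1$ and $P_\omega^x(X_{n+1}=y+1\mid X_n=y)=1-P_\omega^x(X_{n+1}=y-1\mid X_n=y)=\omega_y$. Write $P_\omega=P_\omega^0$, with expectation $E_\omega$ and variance $\operatorname{Var}_\omega(Z)=E_\omega[Z^2]-E_\omega[Z]^2$. Let $\rho_x=\frac{1-\omega_x}{\omega_x}$ and $\kappa=\sup\{p>0: E[\rho_0^p]<1\}\in(0,\infty]$ (when this set is nonempty); for i.i.d. environments, the condition $\kappa>2$ is equivalent to $E[\rho_0^{2+\delta}]<1$ for some $\delta>0$. Hitting times: $T_n=\inf\{k\ge0:X_k=n\}$. $\Phi$ is the standard normal c.d.f. and $\|F\|_\infty=\sup_{x\in\mathbb R}|F(x)|$. The normalization by $\sqrt{\operatorname{Var}_\omega(T_n)}$ is well defined ($\operatorname{Var}_\omega(T_n)\in(0,\infty)$) for all sufficiently large $n$, for $P$-a.e. $\omega$. *)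

(* Defs.v *)
From HB Require Import structures.
From mathcomp Require Export all_boot all_order all_algebra.
From mathcomp Require Export all_classical all_reals all_analysis.

Set Implicit Arguments.
Unset Strict Implicit.
Unset Printing Implicit Defensive.

Import Order.TTheory GRing.Theory Num.Theory.
Import numFieldNormedType.Exports.

Local Open Scope classical_set_scope.
Local Open Scope ring_scope.

(* Mutual independence is required through all finite subfamilies. *)
Definition iid_env (R : realType) (d : measure_display)
    (Omega : measurableType d) (P : probability Omega R)
    (omega : int -> {RV P >-> R}) : Prop :=
  (forall (s : seq int) (B : int -> set R), uniq s ->
     (forall i, measurable (B i)) ->
     P (\bigcap_(i in [set` s]) (omega i @^-1` B i)) =
     (\big[*%E/1%E]_(i <- s) P (omega i @^-1` B i))%E) /\
  (forall (i : int) (B : set R), measurable B ->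
     P (omega i @^-1` B) = P (omega 0 @^-1` B)).

(* The ratio (1 - a) / a is infinite at a = 0, where real division would
   return 0. *)
Definition rho (R : realType) (a : R) : \bar R :=
  if a == 0 then +oo%E else ((1 - a) / a)%:E.

(* The supremum is -oo when no p > 0 is admissible. *)
Definition kappa (R : realType) (d : measure_display)
    (Omega : measurableType d) (P : probability Omega R)
    (omega : int -> {RV P >-> R}) : \bar R :=
  ereal_sup [set p%:E | p in
    [set p : R | 0 < p /\ (\int[P]_o (rho (omega 0%Z o) `^ p) < 1)%E]].

Definition cond_prob (R : realType) (d : measure_display)
    (S : measurableType d) (Q : probability S R) (A B : set S) : R :=
  fine (Q (A `&` B)) / fine (Q B).

(* Under Q, the process X is the Markov chain on the integers started at x
   that steps from y to y + 1 with probability w y and to y - 1 otherwise,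
   i.e. Q is a realization of the quenched law P_w^x.  Conditional
   probabilities are constrained only where the conditioning event has
   positive probability. *)
Record quenched_walk (R : realType) (d : measure_display)
    (S : measurableType d) (X : nat -> S -> int) (w : int -> R) (x : int)
    (Q : probability S R) : Prop := QuenchedWalk {
  qw_measurable : forall (n : nat) (z : int),
    measurable [set s | X n s = z];
  qw_start : Q [set s | X 0%N s = x] = 1%E;
  qw_markov : forall (n : nat) (path : nat -> int) (z : int),
    (0 < Q [set s | forall k, (k <= n)%N -> X k s = path k])%E ->
    cond_prob Q [set s | X n.+1 s = z]
                [set s | forall k, (k <= n)%N -> X k s = path k] =
    cond_prob Q [set s | X n.+1 s = z] [set s | X n s = path n];
  qw_right : forall (n : nat) (y : int),
    (0 < Q [set s | X n s = y])%E ->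
    cond_prob Q [set s | X n.+1 s = y + 1] [set s | X n s = y] = w y;
  qw_left : forall (n : nat) (y : int),
    (0 < Q [set s | X n s = y])%E ->
    1 - cond_prob Q [set s | X n.+1 s = y - 1] [set s | X n s = y] = w y }.

(* Equal to +oo when the level z is never reached. *)
Definition hitting_time (R : realType) (S : Type) (X : nat -> S -> int)
    (z : int) (s : S) : \bar R :=
  ereal_inf [set (k%:R : R)%:E | k in [set k : nat | X k s = z]].

Definition mean (R : realType) (d : measure_display) (S : measurableType d)
    (Q : probability S R) (Z : S -> \bar R) : \bar R :=
  (\int[Q]_s Z s)%E.

Definition var (R : realType) (d : measure_display) (S : measurableType d)
    (Q : probability S R) (Z : S -> \bar R) : \bar R :=
  (mean Q (fun s => Z s ^+ 2) - mean Q Z ^+ 2)%E.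

(* Meaningful when [var Q Z] is finite and positive; a sample point where Z
   is +oo then contributes to no value of the distribution function. *)
Definition normalized_cdf (R : realType) (d : measure_display)
    (S : measurableType d) (Q : probability S R) (Z : S -> \bar R)
    (x : R) : R :=
  fine (Q [set s |
    ((Z s - mean Q Z) * ((Num.sqrt (fine (var Q Z)))^-1)%:E <= x%:E)%E]).

Definition Phi (R : realType) (x : R) : R :=
  fine (normal_prob (0 : R) 1 `]-oo, x]).

Definition sup_norm (R : realType) (F : R -> R) : \bar R :=
  ereal_sup [set `|F x|%:E | x in [set: R]].

(* Main.v *)
(* The hitting time [T_n] is, under the quenched law, a sum of [n] independent
   crossing times of consecutive sites, so Stein's method gives a Berry-Esseen
   bound with numerator [\sum_(x < n) M_x], [M_x] bounding the quenched third
   moment at [x], and denominator the 3/2 power of the variance, itself at least a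
   quarter of [\sum_(x < n) omega_x (1 - omega_x)], which grows linearly almost
   surely.
   A walk at [x] that steps left must cross [x - 1] and then [x] again; this
   bounds the truncated crossing moments at [x] by [rho_x] times those at
   [x - 1] plus lower-order terms.  Hence [M_x] has a moment of order [p / 3] as
   soon as [E rho^p < 1].  If [p > 3], a von Bahr-Esseen bound along dyadic [n]
   makes [\sum_(x < n) M_x] of order [n]; if [p <= 3], subadditivity of
   [t |-> t^(p/3)] makes it of order [n^b] for every [b > 3 / p].  All estimates
   are made for moments truncated at a level [K], uniformly in [K], so that no
   finiteness has to be known beforehand. *)
From HB Require Import structures.
Require Import Defs.
From mathcomp Require Import ring lra zify.
From mathcomp Require Import measurable_realfun.
Import Order.TTheory GRing.Theory Num.Theory.
Import numFieldNormedType.Exports.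

Set Implicit Arguments.
Unset Strict Implicit.
Unset Printing Implicit Defensive.

Local Open Scope classical_set_scope.
Local Open Scope ring_scope.

(** * Stein's method and the Berry-Esseen bound *)

(** Crossing times take infinitely many values and may a priori be infinite, so Stein's method is
    run on finite product spaces, where expectations are finite sums; each crossing law is cut at a
    level and the cut is then removed by a limit. Independence of the crossings enters only as a
    convolution identity for first-passage probabilities, and the walk itself serves only to
    identify these. In the environment the obstacle is that the third-moment recursion contains
    products of first and second moments. With [m1], [m2], [m3] the moments at a site, the
    quantities [(1 + m1)^3], [m2^(3/2)] and [m3] are treated together: all have degree three, so the
    single exponent [p / 3] serves for each, and each is driven by the previous ones through a
    coefficient that depends on the current site alone and is independent of the past. The supremum
    [kappa] need not be attained, so [p] is only an admissible exponent at most [kappa]; it is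
    lowered to 6 when larger, since the von Bahr-Esseen inequality needs [p / 3 <= 2]. Almost sure
    finiteness of the crossings is a separate consequence of [E rho < 1]. *)

Section normal_cdf.
Variable R : realType.
Implicit Types x y z : R.

Notation gpdf := (normal_pdf (0 : R) 1).

Lemma gpdfE x : gpdf x = normal_peak 1 * expR (- (x ^+ 2 / 2)).
Proof.
rewrite normal_pdfE ?oner_eq0// /normal_fun subr0 expr1n.
by rewrite mulNr.
Qed.

Lemma gpdf_gt0 x : 0 < gpdf x.
Proof. by rewrite gpdfE mulr_gt0 ?expR_gt0 ?normal_peak_gt0 ?oner_eq0. Qed.

Lemma is_derive_mul (f g : R -> R) x df dg d :
  is_derive x 1 f df -> is_derive x 1 g dg ->
  f x * dg + g x * df = d -> is_derive x 1 (fun y => f y * g y) d.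
Proof. by move=> hf hg <-; exact: is_deriveM. Qed.

Lemma is_derive_sqr_half x : is_derive x 1 (fun y : R => y ^+ 2 / 2) x.
Proof.
have h := @is_derive_mul id id x 1 1 _ (is_derive_id x 1) (is_derive_id x 1) erefl.
rewrite (_ : (fun y => _) = fun y : R => (y * y) * 2^-1).
  apply: (@is_derive_mul (fun y => y * y) (fun=> 2^-1) x _ 0 _ h).
  by rewrite /=; lra.
by apply/funext => y; rewrite expr2.
Qed.

Lemma is_derive_gpdf x : is_derive x 1 gpdf (- x * gpdf x).
Proof.
have h := is_deriveN (is_derive_sqr_half x).
have h2 := @is_derive1_comp R expR (- (fun y : R => y ^+ 2 / 2)) x _ _ (is_derive_expR _) h.
rewrite (_ : gpdf = fun y => normal_peak 1 * expR (- (y ^+ 2 / 2))); last first.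
  by apply/funext => y; exact: gpdfE.
apply: (@is_derive_mul (fun=> _) _ _ 0 _ _ _ h2).
rewrite /=. rewrite (_ : (- (fun y : R => y ^+ 2 / 2)) x = - (x ^+ 2 / 2)) //.
by ring.
Qed.

Lemma is_derive_Phi x : is_derive x 1 (@Phi R) (gpdf x).
Proof.
have [] := @continuous_FTC1 R gpdf -oo%O x (x + 1).
- by rewrite ltrDl.
- apply: integrableS (integrable_normal_pdf (0:R) (1:R)) => //.
- by rewrite ltNyr.
- by apply: continuous_normal_pdf; rewrite oner_eq0.
move=> h1 h2; split; first exact: h1.
by rewrite -derive1E; exact: h2.
Qed.

Let idR : measurableTypeR R -> R := idfun.

#[local] HB.instance Definition _ :=
  @isMeasurableFun.Build _ _ _ _ idR (@measurable_id _ _ setT).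

Lemma PhiE x : (Phi x)%:E = cdf (idR : {RV (normal_prob (0:R) 1) >-> R}) x.
Proof. by rewrite /Phi fineK// fin_num_measure. Qed.

Lemma Phi_ge0 x : 0 <= Phi x.
Proof. by rewrite -lee_fin PhiE cdf_ge0. Qed.

Lemma Phi_le1 x : Phi x <= 1.
Proof. by rewrite -lee_fin PhiE cdf_le1. Qed.

Lemma Phi_ndecr x y : x <= y -> Phi x <= Phi y.
Proof. by move=> xy; rewrite -lee_fin !PhiE cdf_nondecreasing. Qed.

Lemma Phi_continuous : continuous (@Phi R).
Proof.
move=> x; have [d _] := is_derive_Phi x.
by apply/differentiable_continuous/derivable1_diffP.
Qed.

Lemma Phi_cvgy : (Phi x : R) @[x --> +oo] --> (1 : R).
Proof.
have := @cvg_cdfy1 _ _ _ _ (idR : {RV (normal_prob (0:R) 1) >-> R}).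
rewrite (_ : cdf _ = fun x => (Phi x)%:E); last first.
  by apply/funext => x; rewrite PhiE.
by move/fine_cvg.
Qed.

Lemma Phi_cvgNy : (Phi x : R) @[x --> -oo] --> (0 : R).
Proof.
have := @cvg_cdfNy0 _ _ _ _ (idR : {RV (normal_prob (0:R) 1) >-> R}).
rewrite (_ : cdf _ = fun x => (Phi x)%:E); last first.
  by apply/funext => x; rewrite PhiE.
by move/fine_cvg.
Qed.

(** The function [gpdf y / y + G y] has derivative [- gpdf y / y ^+ 2], so it decreases, and its
    lower limit at infinity is nonnegative. Keeping [G] abstract covers both tails: [Phi y - 1] on
    the right, and [- Phi (- y)] on the left by symmetry. *)
Lemma mills_ratio_le (G : R -> R) :
  (forall x, 0 < x -> is_derive x 1 G (gpdf x)) ->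
  (forall e, 0 < e -> exists y0, forall y, y0 <= y -> - e <= G y) ->
  forall x, 0 < x -> - G x <= gpdf x / x.
Proof.
move=> dG limG x x0.
pose h y := gpdf y * y^-1 + G y.
have dh y : 0 < y -> is_derive y 1 h (- (gpdf y / y ^+ 2)).
  move=> y0; have ny0 : y != 0 by rewrite gt_eqF.
  apply: is_derive_eq.
    apply: is_deriveD; last exact: dG.
    apply: is_derive_mul (is_derive_gpdf y) _ erefl.
    by exact: is_deriveV.
  rewrite /GRing.scale /=; field.
  by rewrite ny0.
have hx y : x <= y -> h y <= h x.
  move=> xy; apply: (@ler0_derive1_nincry R h (x/2)) => //; last first.
    by lra.
  - apply: derivable_within_continuous => z; rewrite in_itv/= andbT => xz.
    have z0 : 0 < z by lra.
    by have [] := dh z z0.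
  - move=> z; rewrite in_itv/= andbT => xz.
    have z0 : 0 < z by lra.
    have [_] := dh z z0; rewrite derive1E => ->.
    by rewrite oppr_le0 divr_ge0 ?sqr_ge0// ltW// gpdf_gt0.
  - move=> z; rewrite in_itv/= andbT => xz.
    have z0 : 0 < z by lra.
    by have [] := dh z z0.
rewrite -subr_ge0 opprK; apply/ler_addgt0Pl => e e0.
have [y0 hy0] := limG _ e0.
pose y := Num.max x y0.
have := hx y; rewrite le_max lexx => /(_ isT) hh.
have := hy0 y; rewrite le_max lexx orbT => /(_ isT) hG.
have y_gt0 : 0 < y by rewrite lt_max x0.
have : 0 <= gpdf y * y^-1 by rewrite divr_ge0 ?ltW// gpdf_gt0.
by rewrite /h in hh *; lra.
Qed.

Lemma mills_right x : 0 < x -> 1 - Phi x <= gpdf x / x.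
Proof.
move=> x0; rewrite -opprB; apply: (@mills_ratio_le (fun y => Phi y - 1)) => //.
- move=> y _; apply: is_derive_eq; first exact: is_deriveB (is_derive_Phi y) _.
  by rewrite subr0.
- move=> e e0.
  have /cvgrPdist_le/(_ e e0) [y0 [_ hy]] := Phi_cvgy.
  exists (y0 + 1) => y yy.
  have /= := hy y; have -> : y0 < y by lra.
  move=> /(_ isT); rewrite ger0_norm ?subr_ge0 ?Phi_le1//; lra.
Qed.

Lemma mills_left x : x < 0 -> Phi x <= gpdf x / - x.
Proof.
move=> x0.
have -> : gpdf x = gpdf (- x) by rewrite !gpdfE sqrrN.
rewrite -[X in X <= _](opprK (Phi x)) -[in X in X <= _](opprK x).
apply: (@mills_ratio_le (fun y => - Phi (- y))); last by lra.
- move=> y _; apply: is_derive_eq.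
    apply: is_deriveN.
    exact: (@is_derive1_comp R (@Phi R) (-%R) y _ _ (is_derive_Phi _)).
  rewrite mulrN1 opprK.
  by rewrite !gpdfE sqrrN.
- move=> e e0.
  have /cvgrPdist_le/(_ e e0) [y0 [_ hy]] := Phi_cvgNy.
  exists (1 - y0) => y yy.
  have /= := hy (- y); have -> : - y < y0 by lra.
  by move=> /(_ isT); rewrite add0r normrN ger0_norm ?Phi_ge0// lerN2.
Qed.

End normal_cdf.

(** * The Stein equation of a half-line and the regularity of its solution *)

Section stein_equation.
Variable R : realType.
Implicit Types w x y z : R.

Notation gpdf := (normal_pdf (0 : R) 1).

(** The bounded solution [f] of Stein's equation [f' w - w * f w = (w <= z) - Phi z]; the minimum
    and the maximum merge the formulas on the two sides of [z]. *)
Definition stein_sol z w : R :=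
  (gpdf w)^-1 * (Phi (Num.min w z) * (1 - Phi (Num.max w z))).

(* The value of the derivative away from [z]. *)
Definition stein_der z w : R := w * stein_sol z w + (w <= z)%R%:R - Phi z.

(** A uniform bound on the solution: where [|w| >= 1] it follows from [|w * f w| <= 1], and on
    [[-1, 1]] the inverse density is at most [expR (1/2) / normal_peak 1]. *)
Definition stein_cst : R := Num.max 1 (expR (1/2) / normal_peak 1).

Lemma stein_cst_ge1 : 1 <= stein_cst.
Proof. by rewrite le_max lexx. Qed.

Lemma stein_sol_ge0 z w : 0 <= stein_sol z w.
Proof.
rewrite mulr_ge0 ?mulr_ge0 ?Phi_ge0 ?subr_ge0 ?Phi_le1//.
by rewrite invr_ge0 ltW// gpdf_gt0.
Qed.

(** Of the two probabilities in the solution, the one on the side of the sign of [w] is bounded by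
    Mills' ratio at [w], which cancels both [w] and the inverse density; the other is at most
    one. *)
Lemma norm_mul_stein_sol z w : `|w * stein_sol z w| <= 1.
Proof.
have g0 := gpdf_gt0 w.
rewrite normrM (ger0_norm (stein_sol_ge0 z w)) /stein_sol.
have [P1 P2 P3 P4] : [/\ 0 <= Phi (Num.min w z), Phi (Num.min w z) <= 1,
    0 <= 1 - Phi (Num.max w z) & 1 - Phi (Num.max w z) <= 1].
  by split; rewrite ?subr_ge0 ?Phi_ge0 ?Phi_le1// lerBlDr lerDl Phi_ge0.
have [w0|w0|->] := ltgtP w 0; last by rewrite normr0 mul0r.
- rewrite ltr0_norm// mulrCA mulrC ler_pdivrMr// mul1r.
  have := mills_left w0; rewrite ler_pdivlMr ?oppr_gt0// mulrC => h.
  apply: le_trans h; apply: ler_wpM2l; first by rewrite oppr_ge0 ltW.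
  apply: (@le_trans _ _ (Phi (Num.min w z) * 1)); first by rewrite ler_wpM2l.
  by rewrite mulr1 Phi_ndecr// ge_min lexx.
- rewrite gtr0_norm// mulrCA mulrC ler_pdivrMr// mul1r.
  have := mills_right w0; rewrite ler_pdivlMr// mulrC => h.
  apply: le_trans h; apply: ler_wpM2l; first exact: ltW.
  apply: (@le_trans _ _ (1 * (1 - Phi (Num.max w z)))); first by rewrite ler_wpM2r.
  by rewrite mul1r lerB// Phi_ndecr// le_max lexx.
Qed.

Lemma norm_stein_sol z w : `|stein_sol z w| <= stein_cst.
Proof.
have [w1|w1] := leP 1 `|w|.
  apply: le_trans stein_cst_ge1.
  apply: le_trans (norm_mul_stein_sol z w).
  by rewrite [leRHS]normrM ler_peMl.
rewrite le_max; apply/orP; right.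
rewrite ger0_norm ?stein_sol_ge0// /stein_sol.
have p0 : (0 : R) < normal_peak 1 by rewrite normal_peak_gt0 ?oner_eq0.
apply: (@le_trans _ _ ((gpdf w)^-1 * 1)).
  apply: ler_wpM2l; first by rewrite invr_ge0 (ltW (gpdf_gt0 _)).
  by rewrite mulr_ile1 ?Phi_ge0 ?Phi_le1 ?subr_ge0 ?Phi_le1// lerBlDr lerDl Phi_ge0.
have p1 : (0 : R) < (normal_peak 1)^-1 by rewrite invr_gt0.
rewrite mulr1 gpdfE invfM mulrC (ler_pM2r p1).
rewrite expRN invrK ler_expR ler_pM2r ?invr_gt0//.
by rewrite -real_normK ?num_real// exprn_ile1// ltW.
Qed.

Lemma norm_stein_der z w : `|stein_der z w| <= 2.
Proof.
rewrite /stein_der -addrA; apply: le_trans (ler_normD _ _) _.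
have := norm_mul_stein_sol z w.
suff : `|(w <= z)%R%:R - Phi z| <= 1 by lra.
by case: (w <= z)%R; rewrite ?sub0r ?normrN ger0_norm ?Phi_ge0 ?subr_ge0
  ?Phi_le1// lerBlDr lerDl Phi_ge0.
Qed.

Lemma is_derive_gpdfV w : is_derive w 1 (fun y => (gpdf y)^-1) (w * (gpdf w)^-1).
Proof.
have g0 : gpdf w != 0 by rewrite gt_eqF// gpdf_gt0.
have dg := is_derive_gpdf w.
have := @is_deriveV R gpdf w _ 1 g0 dg.
move/is_derive_eq; apply.
rewrite /GRing.scale /=; field.
exact: g0.
Qed.

Lemma is_derive_stein_sol z w : w != z ->
  is_derive w 1 (stein_sol z) (stein_der z w).
Proof.
have g0 : gpdf w != 0 by rewrite gt_eqF// gpdf_gt0.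
have dg := is_derive_gpdfV w.
have dP := is_derive_Phi w.
case: (ltgtP w z) => // wz _.
- have h : is_derive w 1 (fun y => (gpdf y)^-1 * (Phi y * (1 - Phi z))) (stein_der z w).
    have h1 : is_derive w 1 (fun y => Phi y * (1 - Phi z)) (gpdf w * (1 - Phi z)).
      apply: (@is_derive_mul R (@Phi R) (fun=> 1 - Phi z) w (gpdf w) 0 _ dP) => //.
      by rewrite mulr0 add0r mulrC.
    apply: (@is_derive_mul R (fun y => (gpdf y)^-1) _ w _ _ _ dg h1).
    rewrite /stein_der /stein_sol (min_l (ltW wz)) (max_r (ltW wz)) (ltW wz) /=.
    by field.
  apply: near_eq_is_derive h.
  near=> y.
  rewrite /stein_sol; have yz : y < z by near: y; exact: lt_nbhsl.
  by rewrite (min_l (ltW yz)) (max_r (ltW yz)).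
- have h : is_derive w 1 (fun y => (gpdf y)^-1 * (Phi z * (1 - Phi y))) (stein_der z w).
    have h1 : is_derive w 1 (fun y => Phi z * (1 - Phi y)) (- (gpdf w * Phi z)).
      have h2 : is_derive w 1 (fun y => 1 - Phi y) (- gpdf w).
        rewrite -[- gpdf w]sub0r.
        by apply: (@is_deriveB R R R (fun=> 1 : R) (@Phi R) w 1 0 _ _ dP).
      apply: (@is_derive_mul R (fun=> Phi z) _ w 0 _ _ _ h2) => //.
      by rewrite mulr0 addr0 mulrN mulrC.
    apply: (@is_derive_mul R (fun y => (gpdf y)^-1) _ w _ _ _ dg h1).
    rewrite /stein_der /stein_sol (min_r (ltW wz)) (max_l (ltW wz)) leNgt wz /=.
    by field.
  apply: near_eq_is_derive h.
  near=> y.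
  rewrite /stein_sol; have yz : z < y by near: y; exact: lt_nbhsr.
  by rewrite (min_r (ltW yz)) (max_l (ltW yz)).
Unshelve. all: by end_near. Qed.

Lemma continuous_stein_sol z : continuous (stein_sol z).
Proof.
move=> w.
have cV : {for w, continuous (fun y => (gpdf y)^-1)}.
  have [d _] := is_derive_gpdfV w.
  by apply/differentiable_continuous/derivable1_diffP.
apply: cvgM; first exact: cV.
have cmin : {for w, continuous (fun y => Num.min y z)}.
  by apply: (@continuous_min R R idfun (fun=> z)); [exact: cvg_id|exact: cvg_cst].
have cmax : {for w, continuous (fun y => Num.max y z)}.
  by apply: (@continuous_max R R idfun (fun=> z)); [exact: cvg_id|exact: cvg_cst].
apply: cvgM.
  by apply: (continuous_comp cmin); exact: Phi_continuous.
apply: cvgB; first exact: cvg_cst.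
by apply: (continuous_comp cmax); exact: Phi_continuous.
Qed.

(** The mean value inequality survives one point without derivative: an interval containing [z] is
    split there, and the two increments add up by continuity. *)
Lemma increment_le_off_point (f g : R -> R) z L B :
  continuous f -> (forall w, w != z -> is_derive w 1 f (g w)) ->
  forall a b, a <= b ->
  (forall v, a < v < b -> v != z -> `|g v - L| <= B) ->
  `|f b - f a - (b - a) * L| <= (b - a) * B.
Proof.
move=> cf df.
have base a b : a <= b -> ~~ (a < z < b) ->
    (forall v, a < v < b -> v != z -> `|g v - L| <= B) ->
    `|f b - f a - (b - a) * L| <= (b - a) * B.
  rewrite le_eqVlt => /predU1P[-> _ _|ab nz hB].
    by rewrite !subrr !mul0r subrr normr0.
  have [|c] := @MVT R f g a b ab _ (continuous_subspaceT cf).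
    move=> x; rewrite in_itv/= => xab; apply: df.
    by apply: contraNneq nz => <-.
  rewrite in_itv /= => cab ->.
  have ba0 : 0 <= b - a by rewrite subr_ge0 ltW.
  rewrite mulrC -mulrBr normrM (ger0_norm ba0).
  apply: ler_wpM2l; [by [] | apply: hB => //].
  by apply: contraNneq nz => <-.
move=> a b ab hB; have [/andP[az zb]|] := boolP (a < z < b); last by move=> h; exact: base.
have h1 := base a z (ltW az); have h2 := base z b (ltW zb).
rewrite (_ : f b - f a - _ = (f z - f a - (z - a) * L) + (f b - f z - (b - z) * L)); last by ring.
rewrite (_ : (b - a) * B = (z - a) * B + (b - z) * B); last by ring.
apply: le_trans (ler_normD _ _) _; apply: lerD.
- apply: h1; first by rewrite ltxx andbF.
  by move=> v /andP[v1 v2]; apply: hB; rewrite v1 (lt_trans v2).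
- apply: h2; first by rewrite ltxx.
  by move=> v /andP[v1 v2]; apply: hB; rewrite v2 (lt_trans az).
Qed.

Lemma increment_le_off_point_norm (f g : R -> R) z L B :
  continuous f -> (forall w, w != z -> is_derive w 1 f (g w)) ->
  forall w u, (forall v, `|v - w| <= `|u - w| -> `|v - w| + `|u - v| <= `|u - w| ->
     v != z -> `|g v - L| <= B) ->
  `|f u - f w - (u - w) * L| <= `|u - w| * B.
Proof.
move=> cf df w u hB; have [wu|uw] := leP w u.
  rewrite ger0_norm ?subr_ge0// in hB *.
  apply: (increment_le_off_point cf df wu) => v /andP[wv vu] vz.
  by apply: hB => //; rewrite !ger0_norm ?subr_ge0 ?(ltW wv) ?(ltW vu)//; lra.
rewrite -normrN (_ : - (f u - f w - (u - w) * L) = f w - f u - (w - u) * L); last by ring.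
rewrite ltr0_norm ?subr_lt0// opprB in hB *.
apply: (increment_le_off_point cf df (ltW uw)) => v /andP[wv vu] vz.
by apply: hB => //; rewrite !ler0_norm ?subr_le0 ?(ltW wv) ?(ltW vu)//; lra.
Qed.

Lemma stein_sol_lipschitz z w u :
  `|stein_sol z u - stein_sol z w| <= 2 * `|u - w|.
Proof.
have := @increment_le_off_point_norm (stein_sol z) (stein_der z) z 0 2
  (@continuous_stein_sol z) (@is_derive_stein_sol z) w u.
rewrite mulr0 subr0 mulrC; apply => v _ _ _; rewrite subr0; exact: norm_stein_der.
Qed.

Lemma mul_stein_sol_increment z w u :
  `|u * stein_sol z u - w * stein_sol z w| <= (stein_cst + 2 * `|w|) * `|u - w|.
Proof.
rewrite (_ : _ - _ = (u - w) * stein_sol z u + w * (stein_sol z u - stein_sol z w));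
  last by ring.
apply: le_trans (ler_normD _ _) _; rewrite (normrM (u - w)) (normrM w) mulrDl; apply: lerD.
  by rewrite mulrC ler_wpM2r// norm_stein_sol.
by rewrite -mulrA mulrCA ler_wpM2l// stein_sol_lipschitz.
Qed.

(** The derivative jumps by one at [z], and the jump is seen only if [z] separates [w] from [u],
    which forces [|w - z| <= |u - w|]. This indicator is what makes a concentration inequality
    necessary. *)
Lemma stein_der_increment z w u :
  `|stein_der z u - stein_der z w| <=
    (stein_cst + 2 * `|w|) * `|u - w| + (`|w - z| <= `|u - w|)%R%:R.
Proof.
rewrite (_ : _ - _ = (u * stein_sol z u - w * stein_sol z w)
   + ((u <= z)%R%:R - (w <= z)%R%:R)); last by rewrite /stein_der; ring.
apply: le_trans (ler_normD _ _) _; apply: lerD (mul_stein_sol_increment _ _ _) _.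
case: (leP u z) => uz; case: (leP w z) => wz; rewrite ?subrr ?normr0 ?ler0n//.
- have -> : (`|w - z| <= `|u - w|)%R.
    by rewrite gtr0_norm ?subr_gt0// ltr0_norm; lra.
  by rewrite subr0 normr1.
- have -> : (`|w - z| <= `|u - w|)%R.
    by rewrite ler0_norm ?subr_le0// gtr0_norm; lra.
  by rewrite sub0r normrN1.
Qed.

Lemma stein_sol_taylor z w u :
  `|stein_sol z u - stein_sol z w - (u - w) * stein_der z w| <=
    `|u - w| * ((stein_cst + 2 * `|w|) * `|u - w| + (`|w - z| <= `|u - w|)%R%:R).
Proof.
apply: (@increment_le_off_point_norm (stein_sol z) (stein_der z) z _ _
  (@continuous_stein_sol z) (@is_derive_stein_sol z)) => v vu _ vz.
apply: le_trans (stein_der_increment z w v) _.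
apply: lerD; first by rewrite ler_wpM2l// addr_ge0 ?mulr_ge0// (le_trans _ stein_cst_ge1).
rewrite ler_nat; case: (leP `|w - z| `|v - w|) => //= h.
by rewrite (le_trans h vu).
Qed.

End stein_equation.

(** * Expectation under a finite product law *)

Section product_expectation.
Variables (R : realType) (I T : finType) (p : I -> T -> R).
Hypothesis p_ge0 : forall i t, 0 <= p i t.
Hypothesis p_sum1 : forall i, \sum_t p i t = 1.
Implicit Types (f : {ffun I -> T}) (i j : I) (t : T).
Implicit Types (g h : {ffun I -> T} -> R).

Definition upd f i t : {ffun I -> T} := [ffun j => if j == i then t else f j].

(** Expectation over independent coordinates with laws [p i], where [f] is the sample point;
    [cexp i] is the expectation under the single law [p i]. *)
Definition pexp g : R := \sum_(f : {ffun I -> T}) (\prod_i p i (f i)) * g f.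

Definition cexp i (u : T -> R) : R := \sum_t p i t * u t.

Lemma pexp_cst c : pexp (fun=> c) = c.
Proof.
by rewrite /pexp -mulr_suml -(bigA_distr_bigA p) big1 ?mul1r.
Qed.

Lemma pexp_le g h : (forall f, g f <= h f) -> pexp g <= pexp h.
Proof.
by move=> gh; apply: ler_sum => f _; apply: ler_wpM2l => //; exact: prodr_ge0.
Qed.

Lemma pexpD g h : pexp (fun f => g f + h f) = pexp g + pexp h.
Proof. by rewrite -big_split; apply: eq_bigr => f _; rewrite mulrDr. Qed.

Lemma pexpN g : pexp (fun f => - g f) = - pexp g.
Proof. by rewrite -sumrN; apply: eq_bigr => f _; rewrite mulrN. Qed.

Lemma pexpB g h : pexp (fun f => g f - h f) = pexp g - pexp h.
Proof. by rewrite pexpD pexpN. Qed.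

Lemma pexpZ c g : pexp (fun f => c * g f) = c * pexp g.
Proof. by rewrite mulr_sumr; apply: eq_bigr => f _; rewrite mulrCA. Qed.

Lemma pexp_sum (J : finType) (P : pred J) (g : J -> {ffun I -> T} -> R) :
  pexp (fun f => \sum_(j | P j) g j f) = \sum_(j | P j) pexp (g j).
Proof.
rewrite /pexp exchange_big; apply: eq_bigr => f _.
by rewrite mulr_sumr.
Qed.

Lemma eq_pexp g h : g =1 h -> pexp g = pexp h.
Proof. by move=> gh; apply: eq_bigr => f _; rewrite gh. Qed.

Lemma pexp_ge0 g : (forall f, 0 <= g f) -> 0 <= pexp g.
Proof. by move=> g0; rewrite -(pexp_cst 0); exact: pexp_le. Qed.

Lemma pexp_norm g : `|pexp g| <= pexp (fun f => `|g f|).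
Proof.
rewrite ler_norml -pexpN; apply/andP; split; apply: pexp_le => f.
  by rewrite lerNl ler_normr lexx orbT.
exact: ler_norm.
Qed.

Lemma cexp_ge0 i u : (forall t, 0 <= u t) -> 0 <= cexp i u.
Proof. by move=> u0; apply: sumr_ge0 => t _; rewrite mulr_ge0. Qed.

Lemma cexp_le i u v : (forall t, u t <= v t) -> cexp i u <= cexp i v.
Proof. by move=> uv; apply: ler_sum => t _; apply: ler_wpM2l. Qed.

Lemma cexpD i u v : cexp i (fun t => u t + v t) = cexp i u + cexp i v.
Proof. by rewrite -big_split; apply: eq_bigr => t _; rewrite mulrDr. Qed.

Lemma cexpZ i c u : cexp i (fun t => c * u t) = c * cexp i u.
Proof. by rewrite mulr_sumr; apply: eq_bigr => t _; rewrite mulrCA. Qed.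

Lemma cexp_cst i c : cexp i (fun=> c) = c.
Proof. by rewrite /cexp -mulr_suml p_sum1 mul1r. Qed.

Lemma upd_same f i t : upd f i t i = t.
Proof. by rewrite ffunE eqxx. Qed.

Lemma upd_upd f i t : upd (upd f i t) i (f i) = f.
Proof. by apply/ffunP => j; rewrite !ffunE; case: eqP => [->|]. Qed.

Lemma prod_upd f i t :
  (\prod_j p j (f j)) * p i t = (\prod_j p j (upd f i t j)) * p i (f i).
Proof.
rewrite (bigD1 i)//= [in RHS](bigD1 i)//= upd_same.
have -> : \prod_(j | j != i) p j (upd f i t j) = \prod_(j | j != i) p j (f j).
  by apply: eq_bigr => j ji; rewrite ffunE (negPf ji).
by ring.
Qed.

(* The weight of (f, t) is invariant under the involution exchanging [f i]
   and [t]. *)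
Lemma pexp_resample g i : pexp g = pexp (fun f => cexp i (fun t => g (upd f i t))).
Proof.
have -> : pexp g = \sum_(ft : {ffun I -> T} * T)
    (\prod_j p j (ft.1 j)) * p i ft.2 * g ft.1.
  rewrite -(pair_big predT predT
    (fun f t => (\prod_j p j (f j)) * p i t * g f))/=.
  apply: eq_bigr => f _; rewrite -mulr_suml -mulr_sumr p_sum1 mulr1 //.
rewrite (reindex_inj (h := fun ft => (upd ft.1 i ft.2, ft.1 i))); last first.
  apply: (can_inj (g := fun ft => (upd ft.1 i ft.2, ft.1 i))) => -[f t] /=.
  by rewrite upd_upd upd_same.
rewrite -(pair_big predT predT (fun f t =>
  (\prod_j p j (upd f i t j)) * p i (f i) * g (upd f i t)))/=.
apply: eq_bigr => f _; rewrite /cexp mulr_sumr; apply: eq_bigr => t _.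
by rewrite -prod_upd mulrA.
Qed.

(** Conditioning on coordinate [i]: the hypothesis says that [G t] ignores this coordinate of its
    second argument, so resampling it leaves only the first argument to be averaged. *)
Lemma pexp_disintegrate i (G : T -> {ffun I -> T} -> R) :
  (forall f t s, G t (upd f i s) = G t f) ->
  pexp (fun f => G (f i) f) = cexp i (fun t => pexp (G t)).
Proof.
move=> hG; rewrite (pexp_resample _ i).
rewrite (eq_pexp (h := fun f => \sum_t p i t * G t f)); last first.
  by move=> f; apply: eq_bigr => t _; rewrite upd_same hG.
by rewrite pexp_sum; apply: eq_bigr => t _; rewrite pexpZ.
Qed.

Lemma pexp_indep i (u : T -> R) g : (forall f s, g (upd f i s) = g f) ->
  pexp (fun f => u (f i) * g f) = cexp i u * pexp g.
Proof.
move=> hg; rewrite (pexp_disintegrate (G := fun t f => u t * g f)); last first.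
  by move=> f t s; rewrite hg.
by rewrite mulr_suml; apply: eq_bigr => t _; rewrite pexpZ mulrA.
Qed.

Lemma pexp_coord i (u : T -> R) : pexp (fun f => u (f i)) = cexp i u.
Proof.
rewrite -[RHS]mulr1 -[X in _ * X](pexp_cst 1) -pexp_indep//.
by apply: eq_pexp => f; rewrite mulr1.
Qed.

Lemma pexp_sqr_sum (P : pred I) (u : I -> T -> R) :
  (forall i, cexp i (u i) = 0) ->
  pexp (fun f => (\sum_(i | P i) u i (f i)) ^+ 2) =
  \sum_(i | P i) cexp i (fun t => u i t ^+ 2).
Proof.
move=> u0.
rewrite (eq_pexp (h := fun f => \sum_(i | P i) \sum_(j | P j) u i (f i) * u j (f j))).
  rewrite pexp_sum; apply: eq_bigr => i Pi; rewrite pexp_sum (bigD1 i)//= big1 ?addr0.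
    by rewrite -pexp_coord; apply: eq_pexp => f; rewrite expr2.
  move=> j /andP[Pj ji]; rewrite (@pexp_indep i (u i) (fun f => u j (f j))) ?u0 ?mul0r//.
  by move=> f s; rewrite ffunE (negPf ji).
move=> f; rewrite expr2 mulr_suml; apply: eq_bigr => i _.
by rewrite mulr_sumr.
Qed.

End product_expectation.

Section real_inequalities.
Variable R : realType.
Implicit Types a b d h m w x y : R.

Definition clamp h x : R := Num.max (- h) (Num.min h x).

Lemma norm_clamp h x : 0 <= h -> `|clamp h x| <= h.
Proof.
move=> h0; rewrite /clamp ler_norml le_max lexx /= ge_max ge_min lexx /=.
by rewrite andbT; lra.
Qed.

Lemma clamp_ndecr h x y : x <= y -> clamp h x <= clamp h y.
Proof.
move=> xy; rewrite /clamp ge_max le_max lexx /= le_max; apply/orP; right.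
by rewrite le_min ge_min lexx /= ge_min xy orbT.
Qed.

Lemma clamp_id h x : - h <= x <= h -> clamp h x = x.
Proof. by move=> /andP[h1 h2]; rewrite /clamp (min_r h2) (max_r h1). Qed.

(** The identity centred at the midpoint of [[a, b]] and frozen at distance [d] outside the
    interval, so that its absolute value is at most half the length plus [d]. *)
Definition ramp a b d v : R := clamp ((b - a) / 2 + d) (v - (a + b) / 2).

Lemma ramp_ndecr a b d u v : u <= v -> ramp a b d u <= ramp a b d v.
Proof. by move=> uv; apply: clamp_ndecr; rewrite lerD2r. Qed.

Lemma ramp_id a b d v : a - d <= v <= b + d -> ramp a b d v = v - (a + b) / 2.
Proof. by move=> /andP[v1 v2]; rewrite /ramp clamp_id//; apply/andP; split; lra. Qed.

(* Inside the window the clamp has slope one up to distance [d] from [a, b]. *)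
Lemma ramp_increment a b d w x : a <= b -> 0 <= d ->
  (a <= w <= b)%R%:R * (`|x| * Num.min d `|x|) <=
  x * (ramp a b d w - ramp a b d (w - x)).
Proof.
move=> ab d0; set F := ramp a b d.
have Fnd u v : u <= v -> F u <= F v by exact: ramp_ndecr.
have [/andP[aw wb]|_] := boolP (a <= w <= b); last first.
  rewrite mul0r; have [x0|x0] := leP 0 x.
    by rewrite mulr_ge0// subr_ge0 Fnd//; lra.
  by rewrite mulr_le0 ?(ltW x0)// subr_le0 Fnd//; lra.
rewrite mul1r.
have Fid v : a - d <= v <= b + d -> F v = v - (a + b) / 2.
  exact: ramp_id.
have Fw : F w = w - (a + b) / 2 by apply: Fid; apply/andP; split; lra.
have [x0|x0] := leP 0 x.
  rewrite ger0_norm//; apply: ler_wpM2l => //; rewrite Fw.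
  have [dx|xd] := leP d x.
    have := Fnd (w - x) (w - d); rewrite (Fid (w - d)); last by apply/andP; split; lra.
    by move=> /(_ ltac:(lra)); lra.
  by rewrite Fid; [lra|apply/andP; split; lra].
rewrite ltr0_norm// mulNr -mulrN.
apply: ler_wnM2l; first exact: ltW.
rewrite Fw; have [dx|xd] := leP d (- x).
  have := Fnd (w + d) (w - x); rewrite (Fid (w + d)); last by apply/andP; split; lra.
  by move=> /(_ ltac:(lra)); lra.
by rewrite Fid; [lra|apply/andP; split; lra].
Qed.

(** For [x >= d] the difference of the two sides is [x * (x - 2 * d) ^+ 2 / (4 * d)]. A second
    moment truncated at [d] thus loses at most a third moment over [4 * d]. *)
Lemma mul_min_ge d x : 0 < d -> 0 <= x ->
  x ^+ 2 - x ^+ 3 / (4 * d) <= x * Num.min d x.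
Proof.
move=> d0 x0; have [dx|xd] := leP d x; last first.
  by rewrite -expr2 lerBlDr lerDl divr_ge0 ?exprn_ge0//; lra.
rewrite -subr_ge0.
have -> : x * d - (x ^+ 2 - x ^+ 3 / (4 * d)) = x * (x - 2 * d) ^+ 2 / (4 * d).
  by field; rewrite gt_eqF.
apply: divr_ge0; last by lra.
by rewrite mulr_ge0 ?sqr_ge0.
Qed.

Lemma norm_le_half_sqr x : `|x| <= (1 + x ^+ 2) / 2.
Proof.
by have := sqr_ge0 (`|x| - 1); rewrite -[x ^+ 2]real_normK ?num_real//; lra.
Qed.

Lemma sqrM_le_cube a b : 0 <= a -> 0 <= b -> a ^+ 2 * b <= a ^+ 3 + b ^+ 3.
Proof.
move=> a0 b0; have [ab|ba] := leP a b.
  have : a ^+ 2 * b <= b ^+ 2 * b by rewrite ler_wpM2r// lerXn2r.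
  have : 0 <= a ^+ 3 by rewrite exprn_ge0.
  by rewrite -exprSr; lra.
have : a ^+ 2 * b <= a ^+ 2 * a by rewrite ler_wpM2l ?sqr_ge0 ?ltW.
have : 0 <= b ^+ 3 by rewrite exprn_ge0.
by rewrite -exprSr; lra.
Qed.

End real_inequalities.

(** * Concentration and the Berry-Esseen bound on a finite product space *)

Section berry_esseen_product.
Variables (R : realType) (I T : finType) (p xi : I -> T -> R).
Hypothesis p_ge0 : forall i t, 0 <= p i t.
Hypothesis p_sum1 : forall i, \sum_t p i t = 1.
Hypothesis xi_centered : forall i, cexp p i (xi i) = 0.
Implicit Types (f : {ffun I -> T}) (i j : I) (t : T).

Notation E := (pexp p).
Notation e := (cexp p).
Notation s := (fun i => e i (fun t => xi i t ^+ 2)).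
Notation b := (fun i => e i (fun t => `|xi i t| ^+ 3)).
Hypothesis s_sum1 : \sum_i s i = 1.
Let gam := \sum_i b i.

Let W f := \sum_i xi i (f i).
Let Wi i f := \sum_(j | j != i) xi j (f j).

Let s_ge0 i : 0 <= s i.
Proof. by apply: cexp_ge0 => // t; exact: sqr_ge0. Qed.

Let b_ge0 i : 0 <= b i.
Proof. by apply: cexp_ge0 => // t; exact: exprn_ge0. Qed.

Let gam_ge0 : 0 <= gam.
Proof. by apply: sumr_ge0 => i _; exact: b_ge0. Qed.

Let WE f i : W f = Wi i f + xi i (f i).
Proof. by rewrite /W (bigD1 i)//= addrC. Qed.

Let Wi_upd i f t : Wi i (upd f i t) = Wi i f.
Proof. by apply: eq_bigr => j ji; rewrite ffunE (negPf ji). Qed.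

Let s_partial i : \sum_(j | j != i) s j = 1 - s i.
Proof. by rewrite -s_sum1 [in RHS](bigD1 i)//= addrAC subrr add0r. Qed.

Let b_le_gam i : b i <= gam.
Proof.
by rewrite /gam (bigD1 i)//= lerDl; apply: sumr_ge0 => j _; exact: b_ge0.
Qed.

Let s_le i : s i <= 1/4 + 2 * b i.
Proof.
rewrite -(cexp_cst p_sum1 i (1/4)) -cexpZ -cexpD; apply: cexp_le => // t.
rewrite -[xi i t ^+ 2]real_normK ?num_real//.
move: `|xi i t| (normr_ge0 (xi i t)) => x x0.
have [x1|x1] := leP x (1/2).
  have : x ^+ 2 <= (1/2) ^+ 2 by rewrite lerXn2r// nnegrE; lra.
  have : 0 <= x ^+ 3 by rewrite exprn_ge0.
  by lra.
have : 0 <= x ^+ 2 * (2 * x - 1) by rewrite mulr_ge0 ?sqr_ge0//; lra.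
by rewrite mulrBr mulrCA -exprSr; lra.
Qed.

Let Wi_abs i : E (fun f => `|Wi i f|) <= 1.
Proof.
apply: (@le_trans _ _ (E (fun f => 2^-1 * (1 + Wi i f ^+ 2)))).
  by apply: pexp_le => // f; rewrite mulrC norm_le_half_sqr.
rewrite pexpZ pexpD pexp_cst// pexp_sqr_sum// s_partial.
by have := s_ge0 i; lra.
Qed.

(* Stein's identity for the clamped identity [ramp] bounds the probability that
   the leave-one-out sum falls in a window. *)
Lemma concentration i a c : a <= c ->
  E (fun f => (a <= Wi i f <= c)%R%:R) <= 2 * (c - a) + 16 * gam.
Proof.
move=> ac.
set PA := E _.
have PA1 : PA <= 1.
  rewrite -(pexp_cst p_sum1 1); apply: pexp_le => // f.
  by rewrite lern1 leq_b1.
have PA0 : 0 <= PA by apply: pexp_ge0 => // f; rewrite ler0n.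
(* If [gam >= 1/16] the claimed bound exceeds one and holds trivially. *)
have [g16|g16] := leP (1/16) gam; first by lra.
(* With margin [d = gam] the losses [b j / (4 * d)] of [mul_min_ge] sum to at most 1/4. *)
have [d dE] : exists d, d = gam by exists gam.
have d0 : 0 <= d by rewrite dE.
(* Vanishing third moments would make every variance vanish, whereas the variances sum to one. *)
have gam_gt0 : 0 < gam.
  rewrite lt_neqAle gam_ge0 andbT; apply/negP => /eqP g0.
  have b0 j : b j = 0.
    by apply/eqP; rewrite eq_le b_ge0 andbT g0 b_le_gam.
  have : \sum_j s j = 0.
    apply: big1 => j _; apply: big1 => t _.
    have /eqP := b0 j; rewrite psumr_eq0; last first.
      by move=> u _; rewrite mulr_ge0 ?exprn_ge0.
    move=> /allP/(_ t); rewrite mem_index_enum => /(_ isT)/implyP/(_ isT).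
    rewrite mulf_eq0 => /orP[/eqP->|]; first by rewrite mul0r.
    by rewrite expf_eq0/= normr_eq0 => /eqP ->; rewrite expr0n mulr0.
  by rewrite s_sum1 => /eqP; rewrite oner_eq0.
have d_gt0 : 0 < d by rewrite dE.
pose h := (c - a) / 2 + d.
have h0 : 0 <= h by rewrite /h; lra.
pose F := ramp a c d.
pose eta j t := `|xi j t| * Num.min d `|xi j t|.
pose A f : R := (a <= Wi i f <= c)%R%:R.
pose m := \sum_(j | j != i) e j (eta j).
have eta_ge0 j t : 0 <= eta j t by rewrite mulr_ge0 ?le_min ?d0/=.
have step1 : E (fun f => Wi i f * F (Wi i f)) <= h.
  rewrite -[leRHS]mulr1; apply: (@le_trans _ _ (h * E (fun f => `|Wi i f|))).
    rewrite -pexpZ; apply: pexp_le => // f.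
    apply: le_trans (ler_norm _) _; rewrite normrM mulrC ler_wpM2r//.
    exact: norm_clamp.
  by rewrite ler_wpM2l.
(* Since [xi j] is centred and independent of [Wi i f - xi j (f j)], the value of [F] at the latter
   may be subtracted at no cost; each product [xi j] times an increment of [F] is then bounded below
   by [ramp_increment]. *)
have step2 : E (fun f => A f * \sum_(j | j != i) eta j (f j)) <=
             E (fun f => Wi i f * F (Wi i f)).
  have -> : E (fun f => Wi i f * F (Wi i f)) = E (fun f =>
      \sum_(j | j != i) xi j (f j) * (F (Wi i f) - F (Wi i f - xi j (f j)))).
    rewrite (eq_pexp _ (h := fun f => \sum_(j | j != i) xi j (f j) * F (Wi i f))).
      rewrite !pexp_sum; apply: eq_bigr => j ji.
      rewrite (eq_pexp _ (h := fun f => xi j (f j) * (F (Wi i f) - F (Wi i f - xi j (f j)))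
         + xi j (f j) * F (Wi i f - xi j (f j)))); last first.
        by move=> f; rewrite -mulrDr subrK.
      rewrite pexpD (@pexp_indep _ _ _ p p_sum1 j (xi j)
        (fun f => F (Wi i f - xi j (f j)))).
        by rewrite xi_centered mul0r addr0.
      move=> f t; congr (F _).
      rewrite /Wi (bigD1 j)//= [in RHS](bigD1 j)//= upd_same.
      rewrite addrAC subrr add0r addrAC subrr add0r.
      by apply: eq_bigr => k /andP[_ kj]; rewrite ffunE (negPf kj).
    by move=> f; rewrite mulr_suml.
  apply: pexp_le => // f; rewrite mulr_sumr; apply: ler_sum => j ji.
  exact: ramp_increment.
(* The random sum of the [eta j] is replaced by its mean [m]. The deviation [|y - m|] is at most
   [d / 2 + (y - m) ^+ 2 / (2 * d)], and the variance is at most [d ^+ 2] because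
   [eta j <= d * |xi j|]; together this costs [d]. *)
have step3 : PA * m - d <= E (fun f => A f * \sum_(j | j != i) eta j (f j)).
  have -> : PA * m = E (fun f => m * A f) by rewrite pexpZ mulrC.
  have -> : d = E (fun f => d) by rewrite pexp_cst.
  suff : E (fun f => m * A f - A f * \sum_(j | j != i) eta j (f j)) <= E (fun=> d).
    by rewrite pexpB; lra.
  apply: (@le_trans _ _ (E (fun f => d / 2 + (2 * d)^-1 *
      (\sum_(j | j != i) (eta j (f j) - e j (eta j))) ^+ 2))).
    apply: pexp_le => // f; rewrite sumrB -/m.
    move: (\sum_(j | _) _) => y.
    have hA : m * A f - A f * y <= `|y - m|.
      rewrite (_ : _ - _ = A f * (m - y)); last by ring.
      rewrite /A; case: (a <= _ <= c)%R; rewrite ?mul1r ?mul0r//.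
      by rewrite distrC ler_norm.
    apply: (le_trans hA).
    have := norm_le_half_sqr ((y - m) / d).
    rewrite normrM normrV ?unitfE ?gt_eqF// (gtr0_norm d_gt0).
    rewrite ler_pdivrMr// => /le_trans; apply.
    rewrite le_eqVlt; apply/orP; left; apply/eqP.
    by field; rewrite gt_eqF.
  have hvar : E (fun f => (\sum_(j | j != i) (eta j (f j) - e j (eta j))) ^+ 2) =
      \sum_(j | j != i) e j (fun t => (eta j t - e j (eta j)) ^+ 2).
    apply: (@pexp_sqr_sum _ _ _ _ p_sum1 _ (fun j t => eta j t - e j (eta j))) => j.
    by rewrite cexpD (cexp_cst p_sum1) subrr.
  rewrite pexpD [X in _ + X <= _]pexpZ hvar !pexp_cst//.
  have : \sum_(j | j != i) e j (fun t => (eta j t - e j (eta j)) ^+ 2) <= d ^+ 2.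
    apply: (@le_trans _ _ (\sum_(j | j != i) d ^+ 2 * s j)).
      apply: ler_sum => j _.
      apply: (@le_trans _ _ (e j (fun t => eta j t ^+ 2))).
        have -> : e j (fun t => (eta j t - e j (eta j)) ^+ 2) =
            e j (fun t => eta j t ^+ 2) - e j (eta j) ^+ 2.
          rewrite /cexp -/(e j (eta j)).
          under eq_bigr do rewrite sqrrB mulrDr mulrBr.
          rewrite big_split sumrB /= -mulr_suml p_sum1 mul1r.
          have -> : \sum_t p j t * (eta j t * e j (eta j) *+ 2) =
             e j (eta j) ^+ 2 *+ 2.
            rewrite expr2 -mulrnAr {2}/cexp mulr_suml; apply: eq_bigr => t _.
            by rewrite -mulrnAr mulrA.
          by rewrite mulr2n opprD addrA addrNK.
        by rewrite lerBlDr lerDl sqr_ge0.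
      rewrite -cexpZ; apply: cexp_le => // t.
      rewrite /eta exprMn real_normK ?num_real// mulrC ler_wpM2r ?sqr_ge0//.
      by rewrite lerXn2r ?nnegrE ?le_min ?d0//= ge_min lexx.
    by rewrite -mulr_sumr s_partial ler_piMr ?sqr_ge0// lerBlDr lerDl.
  move=> hv.
  apply: (@le_trans _ _ (d / 2 + (2 * d)^-1 * d ^+ 2)).
    by rewrite lerD2l ler_wpM2l// invr_ge0 mulr_ge0.
  by rewrite le_eqVlt; apply/orP; left; apply/eqP; field; rewrite gt_eqF.
(* The variances other than that of [i] sum to [1 - s i], with [s i <= 1/4 + 2 / 16], and truncation
   costs 1/4. *)
have step4 : 3/8 <= m.
  have : \sum_(j | j != i) (s j - b j / (4 * d)) <= m.
    apply: ler_sum => j _.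
    rewrite (_ : s j - b j / (4 * d) =
      e j (fun t => `|xi j t| ^+ 2 + (- (4 * d)^-1) * `|xi j t| ^+ 3)).
      apply: cexp_le => // t; rewrite mulNr mulrC [in X in X <= _]mulrC.
      by rewrite [_ * `|xi j t| ^+ 3]mulrC; exact: mul_min_ge.
    rewrite cexpD cexpZ mulNr mulrC; congr (_ - _).
    by apply: eq_bigr => t _; rewrite real_normK ?num_real.
  rewrite sumrB s_partial -mulr_suml.
  have : (\sum_(j | j != i) b j) / (4 * d) <= 1/4.
    rewrite ler_pdivrMr ?mulr_gt0// mulrA (_ : 1 / 4 * 4 = 1) ?mul1r; last by field.
    by rewrite dE /gam [leRHS](bigD1 i)//= lerDr.
  have := s_le i; have := b_le_gam i; lra.
have : PA * (3/8) <= PA * m by rewrite ler_wpM2l.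
rewrite /h in step1; lra.
Qed.

(** Stein's equation rewrites the left-hand side as the expectation of [g (W f) - W f * F (W f)].
    Each [xi i * F (W f)] is expanded around the leave-one-out sum [Wi i f], which is independent of
    [xi i]: the zeroth-order term vanishes, the first-order term yields [s i] times the mean of
    [g (Wi i f)], and what remains is controlled by [q i]. *)
Lemma berry_esseen_product z :
  `|E (fun f => (W f <= z)%R%:R) - Phi z| <= (3 * stein_cst R + 50) * gam.
Proof.
set K := stein_cst R; have K1 : 1 <= K := stein_cst_ge1 R.
pose F := stein_sol z; pose g := stein_der z.
pose q i f : R := (K + 2 * `|Wi i f|) * `|xi i (f i)|
  + (`|Wi i f - z| <= `|xi i (f i)|)%R%:R.
pose r i f : R := F (W f) - F (Wi i f) - xi i (f i) * g (Wi i f).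
have dW i f : W f - Wi i f = xi i (f i) by rewrite (WE f i) addrAC subrr add0r.
have hg i f : `|g (W f) - g (Wi i f)| <= q i f.
  by have := stein_der_increment z (Wi i f) (W f); rewrite dW.
have hr i f : `|xi i (f i) * r i f| <= xi i (f i) ^+ 2 * q i f.
  have := stein_sol_taylor z (Wi i f) (W f).
  rewrite dW => h.
  by rewrite normrM -[_ ^+ 2]real_normK ?num_real// expr2 -mulrA ler_wpM2l.
have eqE : E (fun f => (W f <= z)%R%:R) - Phi z =
   \sum_i s i * E (fun f => g (W f) - g (Wi i f)) - \sum_i E (fun f => xi i (f i) * r i f).
  have -> : E (fun f => (W f <= z)%R%:R) - Phi z = E (fun f => g (W f) - W f * F (W f)).
    rewrite -[X in _ - X](pexp_cst p_sum1) -pexpB; apply: eq_pexp => f.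
    by rewrite /g /stein_der -/F; ring.
  have hs : \sum_i s i * E (fun f => g (W f) - g (Wi i f)) =
      E (fun f => g (W f)) - \sum_i s i * E (fun f => g (Wi i f)).
    under eq_bigr do rewrite pexpB mulrBr.
    by rewrite sumrB -mulr_suml s_sum1 mul1r.
  rewrite hs pexpB -addrA -opprD; congr (_ - _).
  rewrite -big_split /= (eq_pexp _ (h := fun f => \sum_i xi i (f i) * F (W f))); last first.
    by move=> f; rewrite mulr_suml.
  rewrite pexp_sum; apply: eq_bigr => i _.
  rewrite -pexp_indep//; last by move=> f t; rewrite Wi_upd.
  have -> : E (fun f => xi i (f i) * F (W f)) = E (fun f =>
     xi i (f i) ^+ 2 * g (Wi i f) + xi i (f i) * r i f + xi i (f i) * F (Wi i f)).
    by apply: eq_pexp => f; rewrite /r; ring.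
  rewrite !pexpD [X in _ + X](@pexp_indep _ _ _ p p_sum1 i (xi i)
        (fun f => F (Wi i f))).
    by rewrite xi_centered mul0r addr0.
  by move=> f t; rewrite Wi_upd.
(* Given coordinate [i], the indicator in [q i] places [Wi i f] in a window of length
   [2 * |xi i t|], so [concentration] gives [4 * |xi i t| + 16 * gam]; the other [K + 2] comes from
   the first absolute moment of [Wi i f] being at most one. *)
have hind i (u : T -> R) : (forall t, 0 <= u t) ->
   E (fun f => u (f i) * q i f) <=
   e i (fun t => u t * ((K + 6) * `|xi i t| + 16 * gam)).
  move=> u0.
  rewrite (@pexp_disintegrate _ _ _ p p_sum1 i (fun t f => u t *
    ((K + 2 * `|Wi i f|) * `|xi i t| + (`|Wi i f - z| <= `|xi i t|)%R%:R))); last first.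
    by move=> f t s'; rewrite Wi_upd.
  apply: cexp_le => // t; rewrite pexpZ; apply: ler_wpM2l => //.
  rewrite pexpD (eq_pexp _ (h := fun f => `|xi i t| * (K + 2 * `|Wi i f|))); last first.
    by move=> f; rewrite mulrC.
  rewrite pexpZ pexpD pexpZ pexp_cst//.
  have h1 := Wi_abs i.
  have h2 : E (fun f => (`|Wi i f - z| <= `|xi i t|)%R%:R) <= 4 * `|xi i t| + 16 * gam.
    rewrite (eq_pexp _ (h := fun f => (z - `|xi i t| <= Wi i f <= z + `|xi i t|)%R%:R)); last first.
      move=> f; rewrite ler_norml lerBrDr lerBlDr.
      by rewrite (addrC _ z) (addrC _ z).
    apply: le_trans (concentration i _) _; first by have := normr_ge0 (xi i t); lra.
    by lra.
  have : `|xi i t| * (K + 2 * E (fun f => `|Wi i f|)) <= `|xi i t| * (K + 2).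
    by rewrite ler_wpM2l//; lra.
  lra.
(* The product is a double average of [x ^+ 2 * |y|] over two copies, and this is at most
   [|x| ^+ 3 + |y| ^+ 3]. *)
have hsb i : s i * e i (fun t => `|xi i t|) <= 2 * b i.
  have -> : s i * e i (fun t => `|xi i t|) =
      e i (fun t => e i (fun u => xi i t ^+ 2 * `|xi i u|)).
    by rewrite mulrC -cexpZ; apply: eq_bigr => t _; rewrite cexpZ [in RHS](mulrC (xi i t ^+ 2)).
  apply: (@le_trans _ _ (e i (fun t => e i (fun u => `|xi i t| ^+ 3 + `|xi i u| ^+ 3)))).
    apply: cexp_le => // t; apply: cexp_le => // u.
    by rewrite -[xi i t ^+ 2]real_normK ?num_real//; exact: sqrM_le_cube.
  under [X in X <= _]eq_bigr do rewrite cexpD (cexp_cst p_sum1).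
  by rewrite -/(e i _) cexpD (cexp_cst p_sum1) mulr_natl mulr2n.
have hA i : `|s i * E (fun f => g (W f) - g (Wi i f))| <= 2 * (K + 6) * b i + 16 * gam * s i.
  rewrite normrM (ger0_norm (s_ge0 i)).
  apply: (@le_trans _ _ (s i * e i (fun t => 1 * ((K + 6) * `|xi i t| + 16 * gam)))).
    apply: ler_wpM2l => //; apply: le_trans (pexp_norm _ _) _ => //.
    apply: le_trans (hind i (fun=> 1) _) => //.
    by apply: pexp_le => // f; rewrite mul1r.
  rewrite cexpZ mul1r cexpD cexpZ (cexp_cst p_sum1) mulrDr [s i * (16 * gam)]mulrC lerD2r.
  have K6 : 0 <= K + 6 by lra.
  by have := ler_wpM2l K6 (hsb i); lra.
have hB i : `|E (fun f => xi i (f i) * r i f)| <= (K + 6) * b i + 16 * gam * s i.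
  apply: le_trans (pexp_norm _ _) _ => //.
  apply: (@le_trans _ _ (E (fun f => xi i (f i) ^+ 2 * q i f))); first exact: pexp_le.
  apply: le_trans (hind i (fun t => xi i t ^+ 2) _) _; first by move=> t; exact: sqr_ge0.
  rewrite -!cexpZ -cexpD le_eqVlt; apply/orP; left; apply/eqP.
  apply: eq_bigr => t _; congr (_ * _).
  by rewrite -[xi i t ^+ 2]real_normK ?num_real//; ring.
rewrite eqE; apply: le_trans (ler_normB _ _) _.
have h1 := ler_norm_sum (index_enum I) (fun i => s i * E (fun f => g (W f) - g (Wi i f))) predT.
have h2 := ler_norm_sum (index_enum I) (fun i => E (fun f => xi i (f i) * r i f)) predT.
apply: (le_trans (lerD h1 h2)).
(* The two groups of terms add up to [(3 * K + 50) * gam]. *)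
apply: (@le_trans _ _ ((2 * (K + 6) * gam + 16 * gam) + ((K + 6) * gam + 16 * gam))); last by lra.
have hsum c : \sum_i (c * b i + 16 * gam * s i) = c * gam + 16 * gam.
  by rewrite big_split /= -!mulr_sumr s_sum1 mulr1.
by apply: lerD; rewrite -hsum; apply: ler_sum => i _.
Qed.

End berry_esseen_product.

Lemma cvg_sumr (R : realType) (I : Type) (r : seq I) (P : pred I)
    (f : I -> nat -> R) (l : I -> R) :
  (forall i, P i -> f i @ \oo --> l i) ->
  (fun K => \sum_(i <- r | P i) f i K) @ \oo --> \sum_(i <- r | P i) l i.
Proof. by move=> fl; apply: cvg_big => //; exact: add_continuous. Qed.

(* The truncation of an N-valued random variable at level [K] puts the missing
   mass at [K], so that the laws below [K] are unchanged. *)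
Section truncation.
Variables (R : realType) (p : nat -> R).
Hypothesis p_ge0 : forall k, 0 <= p k.
Hypothesis p_sum1 : (fun K => \sum_(k < K) p k) @ \oo --> (1 : R).

Lemma partial_sum_le1 K : \sum_(k < K) p k <= 1.
Proof.
have /cvg_lim <- // := p_sum1.
apply: (@nondecreasing_cvgn_le _ (fun K => \sum_(k < K) p k)).
  by apply/nondecreasing_seqP => n; rewrite big_ord_recr lerDl.
by apply/cvg_ex; exists 1; exact: p_sum1.
Qed.

Definition trunc_pmf K (t : 'I_K.+1) : R :=
  if (t < K)%N then p t else 1 - \sum_(k < K) p k.

Lemma trunc_pmf_ge0 K t : 0 <= @trunc_pmf K t.
Proof. by rewrite /trunc_pmf; case: ifP => // _; rewrite subr_ge0 partial_sum_le1. Qed.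

Lemma trunc_sum K (u : nat -> R) :
  \sum_(t < K.+1) @trunc_pmf K t * u t =
  \sum_(k < K) p k * u k + (1 - \sum_(k < K) p k) * u K.
Proof.
rewrite big_ord_recr /= /trunc_pmf ltnn; congr (_ + _).
by apply: eq_bigr => k _ /=; rewrite ltn_ord.
Qed.

Lemma trunc_pmf_sum1 K : \sum_t @trunc_pmf K t = 1.
Proof.
transitivity (\sum_(t < K.+1) @trunc_pmf K t * 1); first by under [RHS]eq_bigr do rewrite mulr1.
rewrite (trunc_sum K (fun=> 1)) mulr1; under eq_bigr do rewrite mulr1.
by rewrite addrC subrK.
Qed.

Definition trunc_moment r K : R := \sum_(t < K.+1) @trunc_pmf K t * t%:R ^+ r.

Lemma trunc_moment_ge r K : \sum_(k < K) k%:R ^+ r * p k <= trunc_moment r K.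
Proof.
rewrite /trunc_moment (trunc_sum K (fun t => t%:R ^+ r)).
rewrite (eq_bigr (fun k : 'I_K => p k * k%:R ^+ r)) => [|k _]; last by rewrite mulrC.
by rewrite lerDl mulr_ge0 ?subr_ge0 ?partial_sum_le1 ?exprn_ge0.
Qed.

(** Mass beyond [K] is moved down to [K], which can only lower a moment. The moved mass is reached
    as a limit of the sums over [K <= k < N], each term of which is compared with [k ^ r * p k]. *)
Lemma trunc_moment_le r K B :
  (forall N, \sum_(k < N) k%:R ^+ r * p k <= B) -> trunc_moment r K <= B.
Proof.
move=> hB; rewrite /trunc_moment (trunc_sum K (fun t => t%:R ^+ r)).
rewrite (eq_bigr (fun k : 'I_K => k%:R ^+ r * p k)) => [|k _]; last by rewrite mulrC.
rewrite addrC -lerBrDr.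
have h : (fun N => (\sum_(k < N) p k - \sum_(k < K) p k) * K%:R ^+ r) @ \oo -->
    ((1 - \sum_(k < K) p k) * K%:R ^+ r).
  apply: cvgM; last exact: cvg_cst.
  by apply: cvgB; [exact: p_sum1|exact: cvg_cst].
apply: (ler_cvg_to h (cvg_cst _)).
near=> N; have KN : (K <= N)%N by near: N; exists K.
rewrite lerBrDr; apply: le_trans (hB N).
rewrite -!(big_mkord predT (fun k => p k)) -!(big_mkord predT (fun k => k%:R ^+ r * p k)).
rewrite (big_cat_nat (leq0n K) KN) [leRHS](big_cat_nat (leq0n K) KN)/= addrAC subrr add0r.
rewrite [leRHS]addrC lerD2r mulr_suml !big_nat; apply: ler_sum => k /andP[Kk kN].
rewrite mulrC ler_wpM2r// lerXn2r ?nnegrE// ler_nat.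
by [].
Unshelve. all: by end_near. Qed.

Lemma trunc_moment_cvg r (m : R) :
  (fun K => \sum_(k < K) k%:R ^+ r * p k) @ \oo --> m ->
  trunc_moment r @ \oo --> m.
Proof.
move=> hm; apply: (squeeze_cvgr _ hm (cvg_cst m)); near=> K.
rewrite trunc_moment_ge /=; apply: trunc_moment_le => N.
have /cvg_lim <- // := hm.
apply: (@nondecreasing_cvgn_le _ (fun K => \sum_(k < K) k%:R ^+ r * p k)).
  by apply/nondecreasing_seqP => n; rewrite big_ord_recr lerDl mulr_ge0 ?exprn_ge0.
by apply/cvg_ex; exists m; exact: hm.
Unshelve. all: by end_near. Qed.

End truncation.

(** * From finite product laws to convolutions of laws on the natural numbers *)

Section convolution_law.
Variables (R : realType) (p A : nat -> nat -> R) (K : nat).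
Hypothesis A0 : forall y, A 0 y = (y == 0%N)%:R.
Hypothesis AS : forall n y, A n.+1 y = \sum_(j < y.+1) A n j * p n (y - j)%N.

Let Q i : {poly R} := \sum_(t < K.+1) @trunc_pmf R (p i) K t *: 'X^t.

Let coefQ i k : (k < K)%N -> (Q i)`_k = p i k.
Proof.
move=> kK; rewrite coef_sum (bigD1 (inord k))//= big1 ?addr0.
  by rewrite coefZ coefXn /trunc_pmf inordK ?kK ?eqxx ?mulr1// ltnW.
move=> t tk; rewrite coefZ coefXn; case: eqP => [kt|]; last by rewrite mulr0.
by move: tk; rewrite kt inord_val eqxx.
Qed.

Let coef_prodQ n y : (y < K)%N -> (\prod_(i < n) Q i)`_y = A n y.
Proof.
elim: n y => [|n IH] y yK; first by rewrite big_ord0 A0 coef1.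
rewrite big_ord_recr /= coefM AS; apply: eq_bigr => j _.
rewrite IH ?coefQ//; first exact: leq_ltn_trans (leq_subr _ _) yK.
exact: leq_trans (ltn_ord j) yK.
Qed.

(** Generating polynomials: the coefficients of [Q i] below degree [K] are those of [p i], and the
    coefficients of a product below degree [K] depend on no others. Truncation is therefore
    invisible to the event that the sum is below [N]. *)
Lemma trunc_sum_law n N : (N <= K)%N ->
  pexp (fun i : 'I_n => @trunc_pmf R (p i) K)
    (fun f => (\sum_i f i < N)%N%:R) = \sum_(y < N) A n y.
Proof.
move=> NK.
rewrite (eq_bigr (fun y : 'I_N => (\prod_(i < n) Q i)`_y)); last first.
  by move=> y _; rewrite coef_prodQ// (leq_trans _ NK).
rewrite (bigA_distr_bigA (fun (i : 'I_n) t => @trunc_pmf R (p i) K t *: 'X^t)) /=.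
under [RHS]eq_bigr do rewrite coef_sum.
rewrite exchange_big; apply: eq_bigr => f _ /=.
rewrite scaler_prod -(big_morph _ (@exprD _ 'X) (expr0 _)).
under [RHS]eq_bigr do rewrite coefZ coefXn.
rewrite -mulr_sumr; congr (_ * _).
case: ltnP => h.
  rewrite (bigD1 (Ordinal h))//= eqxx big1 ?addr0// => y.
  by rewrite -val_eqE /= => /negPf ->.
rewrite big1// => y _; case: eqP => // yE.
by move: (ltn_ord y); rewrite yE ltnNge h.
Qed.

End convolution_law.

Section berry_esseen_nat.
Variables (R : realType) (p A : nat -> nat -> R).
Hypothesis p_ge0 : forall i k, 0 <= p i k.
Hypothesis A0 : forall y, A 0 y = (y == 0%N)%:R.
Hypothesis AS : forall n y, A n.+1 y = \sum_(j < y.+1) A n j * p n (y - j)%N.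

Variables (n : nat) (m1 m2 B : nat -> R).
Hypothesis p_sum1 : forall i, (i < n)%N -> (fun K => \sum_(k < K) p i k) @ \oo --> (1 : R).
Hypothesis p_m1 : forall i, (i < n)%N ->
  (fun K => \sum_(k < K) k%:R ^+ 1 * p i k) @ \oo --> m1 i.
Hypothesis p_m2 : forall i, (i < n)%N ->
  (fun K => \sum_(k < K) k%:R ^+ 2 * p i k) @ \oo --> m2 i.
Hypothesis p_m3 : forall i K, (i < n)%N -> \sum_(k < K) k%:R ^+ 3 * p i k <= B i.

Let M := \sum_(i < n) m1 i.
Let V := \sum_(i < n) (m2 i - m1 i ^+ 2).
Hypothesis V_gt0 : 0 < V.

Section fixed_truncation.
Variable K : nat.
Let q (i : 'I_n) := @trunc_pmf R (p i) K.
Let a (i : 'I_n) := trunc_moment (p i) 1 K.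
Let c (i : 'I_n) := trunc_moment (p i) 2 K.
Let VK := \sum_i (c i - a i ^+ 2).
Let MK := \sum_i a i.
Hypothesis VK_gt0 : 0 < VK.

(** The variables are centred at [a i] and divided by the standard deviation. The factor 2 comes
    from [|t - a i| ^+ 3 <= t ^+ 3 + a i ^+ 3], where the second cube is at most the third moment by
    Jensen's inequality. *)
Lemma berry_esseen_trunc (L : R) :
  `|pexp q (fun f => ((\sum_i f i)%:R <= L)%R%:R) - Phi ((L - MK) / Num.sqrt VK)|
  <= (3 * stein_cst R + 50) * (2 * (\sum_(i < n) B i) / (VK * Num.sqrt VK)).
Proof.
have q0 i t : 0 <= q i t by apply: trunc_pmf_ge0 => //; exact: p_sum1.
have q1 i : \sum_t q i t = 1 by apply: trunc_pmf_sum1 => //; exact: p_sum1.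
set s := Num.sqrt VK; have s0 : 0 < s by rewrite sqrtr_gt0.
have s2 : s ^+ 2 = VK by rewrite sqr_sqrtr// ltW.
pose xi (i : 'I_n) (t : 'I_K.+1) : R := s^-1 * (t%:R + - a i).
have xi0 i : cexp q i (xi i) = 0.
  rewrite cexpZ cexpD (cexp_cst q1).
  have -> : cexp q i (fun t => t%:R) = a i.
    by apply: eq_bigr => t _; rewrite expr1.
  by rewrite subrr mulr0.
have var i : cexp q i (fun t => xi i t ^+ 2) = VK^-1 * (c i - a i ^+ 2).
  transitivity (cexp q i (fun t => VK^-1 * (t%:R ^+ 2 + ((- (2 * a i)) * t%:R ^+ 1 + a i ^+ 2)))).
    apply: eq_bigr => t _; congr (_ * _); rewrite /xi exprMn exprVn s2; congr (_ * _).
    by ring.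
  rewrite cexpZ !cexpD cexpZ (cexp_cst q1) -/(a i) -/(c i); congr (_ * _).
  rewrite {1}/cexp -/(trunc_moment _ _ _) -/(c i) [X in _ * X]/cexp -/(trunc_moment _ _ _) -/(a i).
  by ring.
have var1 : \sum_i cexp q i (fun t => xi i t ^+ 2) = 1.
  under eq_bigr do rewrite var.
  by rewrite -mulr_sumr mulVf// gt_eqF.
have := berry_esseen_product q0 q1 xi0 var1 ((L - MK) / s).
set X := pexp _ _; set Y := pexp _ _.
have -> : X = Y.
  apply: eq_pexp => f; rewrite /xi -mulr_sumr big_split /= sumrN -/MK mulrC.
  by rewrite ler_pM2r ?invr_gt0// lerD2r natr_sum.
move/le_trans; apply; apply: ler_wpM2l.
  by have := stein_cst_ge1 R; lra.
rewrite ler_pdivlMr; last by rewrite mulr_gt0.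
rewrite mulr_suml mulr_sumr; apply: ler_sum => i _.
have a_ge0 : 0 <= a i.
  by apply: sumr_ge0 => t _; rewrite mulr_ge0 ?q0.
have a3 : a i ^+ 3 <= trunc_moment (p i) 3 K.
  (* The cube lies above its tangent at the mean; averaging this inequality is Jensen's
     inequality. *)
  have tang (t : nat) : a i ^+ 3 + 3 * a i ^+ 2 * (t%:R ^+ 1 - a i) <= t%:R ^+ 3.
    rewrite -subr_ge0 (_ : _ - _ = (t%:R - a i) ^+ 2 * (t%:R + 2 * a i)); last by ring.
    by rewrite mulr_ge0 ?sqr_ge0// addr_ge0 ?mulr_ge0.
  have -> : a i ^+ 3 = cexp q i (fun t => (a i ^+ 3 - 3 * a i ^+ 3) + 3 * a i ^+ 2 * t%:R ^+ 1).
    have ea : cexp q i (fun t => t%:R ^+ 1) = a i by [].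
    by rewrite cexpD cexpZ (cexp_cst q1) ea; ring.
  apply: cexp_le => // t; apply: le_trans (tang t).
  by rewrite le_eqVlt; apply/orP; left; apply/eqP; ring.
have m3B : trunc_moment (p i) 3 K <= B i.
  by apply: trunc_moment_le => // [|N]; [exact: p_sum1|exact: p_m3].
apply: (@le_trans _ _ (trunc_moment (p i) 3 K + a i ^+ 3)); last by lra.
have -> : trunc_moment (p i) 3 K + a i ^+ 3 = cexp q i (fun t => t%:R ^+ 3 + a i ^+ 3).
  by rewrite cexpD (cexp_cst q1).
rewrite mulrC -cexpZ; apply: cexp_le => // t.
have -> : VK * s = s ^+ 3 by rewrite -s2 -exprSr.
rewrite /xi normrM normfV (gtr0_norm s0) exprMn mulrA -exprMn divff ?gt_eqF// expr1n mul1r.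
have [at_|ta] := leP (a i) t%:R.
  have h : (t%:R - a i) ^+ 3 <= t%:R ^+ 3 by rewrite lerXn2r ?nnegrE ?subr_ge0//; lra.
  by rewrite ger0_norm ?subr_ge0//; have := exprn_ge0 3 a_ge0; lra.
have t0 : 0 <= t%:R :> R by [].
have h : (a i - t%:R) ^+ 3 <= a i ^+ 3 by rewrite lerXn2r ?nnegrE ?subr_ge0//; lra.
rewrite ltr0_norm ?subr_lt0// opprB; have := exprn_ge0 3 t0; lra.
Qed.

End fixed_truncation.

(** For [K >= N] truncation does not affect the probability, while the truncated means and variances
    converge, so the bound passes to the limit in [K]. The third moments need only a bound, not a
    limit. *)
Lemma berry_esseen_nat (L : R) (N : nat) :
  (forall k : nat, (k%:R <= L) = (k < N)%N) ->
  `|\sum_(k < N) A n k - Phi ((L - M) / Num.sqrt V)| <=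
  (3 * stein_cst R + 50) * (2 * (\sum_(i < n) B i) / (V * Num.sqrt V)).
Proof.
move=> LN.
pose VK K := \sum_(i < n) (trunc_moment (p i) 2 K - trunc_moment (p i) 1 K ^+ 2).
pose MK K := \sum_(i < n) trunc_moment (p i) 1 K.
have VKcvg : VK @ \oo --> V.
  apply: cvg_sumr => i _; apply: cvgB.
    by apply: trunc_moment_cvg; [by []|exact: p_sum1|exact: p_m2].
  rewrite (_ : (fun x => _) = (fun x => trunc_moment (p i) 1 x * trunc_moment (p i) 1 x)).
    by rewrite expr2; apply: cvgM; apply: trunc_moment_cvg => //; [exact: p_sum1|exact: p_m1|exact: p_sum1|exact: p_m1].
  by apply/funext => x; rewrite expr2.
have MKcvg : MK @ \oo --> M.
  apply: cvg_sumr => i _.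
  by apply: trunc_moment_cvg; [by []|exact: p_sum1|exact: p_m1].
have sVK : (fun K => Num.sqrt (VK K)) @ \oo --> Num.sqrt V.
  exact: (continuous_cvg _ (@sqrt_continuous R V) VKcvg).
have sV0 : Num.sqrt V != 0 by rewrite gt_eqF// sqrtr_gt0.
have lhs : (fun K => `|\sum_(k < N) A n k - Phi ((L - MK K) / Num.sqrt (VK K))|) @ \oo -->
   `|\sum_(k < N) A n k - Phi ((L - M) / Num.sqrt V)|.
  apply: cvg_norm; apply: cvgB; first exact: cvg_cst.
  apply: (continuous_cvg _ (@Phi_continuous R _)).
  apply: cvgM; last exact: cvgV.
  by apply: cvgB => //; exact: cvg_cst.
have rhs : (fun K => (3 * stein_cst R + 50) * (2 * (\sum_(i < n) B i) / (VK K * Num.sqrt (VK K)))) @ \oo -->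
   (3 * stein_cst R + 50) * (2 * (\sum_(i < n) B i) / (V * Num.sqrt V)).
  apply: cvgM; first exact: cvg_cst.
  apply: cvgM; first exact: cvg_cst.
  apply: cvgV; first by rewrite mulf_neq0// gt_eqF.
  exact: cvgM.
apply: (ler_cvg_to lhs rhs); near=> K.
have NK : (N <= K)%N by near: K; exists N.
have VK0 : 0 < VK K by near: K; exact: (cvgr_gt V VKcvg 0 V_gt0).
rewrite -(trunc_sum_law A0 AS n NK).
rewrite (eq_pexp _ (h := fun f : {ffun 'I_n -> 'I_K.+1} => ((\sum_i (f i : nat))%:R <= L)%R%:R)); last by move=> f; rewrite LN.
exact: berry_esseen_trunc.
Unshelve. all: by end_near. Qed.

End berry_esseen_nat.

(** * Quenched law of the hitting times *)

Section hitting_pmf.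
Variables (R : realType) (w : int -> R).
Implicit Types (x y z : int) (k : nat) (s : seq bool).

(* The quenched probability that the walk started at [x] first visits [z] at
   time [k]. *)
Fixpoint hit_pmf k x z : R :=
  if k is k'.+1 then
    if x == z then 0
    else w x * hit_pmf k' (x + 1) z + (1 - w x) * hit_pmf k' (x - 1) z
  else (x == z)%:R.

Lemma hit_pmf_refl k z : hit_pmf k z z = (k == 0%N)%:R.
Proof. by case: k => [|k] /=; rewrite eqxx. Qed.

(** A nearest-neighbour walk from [x <= z] visits [z] before [z + 1]; this is the strong Markov
    property at the first visit to [z], obtained by induction on the first step. *)
Lemma hit_pmf_conv k x z : x <= z ->
  hit_pmf k x (z + 1) =
  \sum_(j < k.+1) hit_pmf j x z * hit_pmf (k - j) z (z + 1).
Proof.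
elim: k x => [|k IH] x xz.
  have zz : (z == z + 1) = false by lia.
  have -> : hit_pmf 0 x (z + 1) = 0 by rewrite /= (_ : _ == _ = false)//; lia.
  by rewrite big_ord1 /= zz mulr0.
have xz1 : (x == z + 1) = false by lia.
rewrite big_ord_recl subn0 /=.
have [->|xnz] := eqVneq x z.
  rewrite mul1r (_ : (z == z + 1) = false); last by lia.
  rewrite big1 ?addr0// => j _.
  by rewrite mul0r.
rewrite mul0r add0r xz1 !IH; [|lia|lia].
rewrite !mulr_sumr -big_split /=; apply: eq_bigr => j _.
by rewrite /bump /= add1n subSS; ring.
Qed.

Definition step (b : bool) : int := if b then 1 else -1.

Definition tr x (b : bool) : R := if b then w x else 1 - w x.

Fixpoint path_weight x s : R :=
  if s is b :: s' then tr x b * path_weight (x + step b) s' else 1.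

Fixpoint path_pos x s k : int :=
  match k, s with
  | k'.+1, b :: s' => path_pos (x + step b) s' k'
  | _, _ => x
  end.

(** The first visit to [z] takes place exactly at the end of [s], so that [hit_pmf k] sums the
    weights of such paths of length [k]. *)
Fixpoint path_hits x z s : bool :=
  if s is b :: s' then (x != z) && path_hits (x + step b) z s' else x == z.

Fixpoint all_paths k : seq (seq bool) :=
  if k is k'.+1 then map (cons true) (all_paths k') ++ map (cons false) (all_paths k')
  else [:: [::]].

Lemma all_paths_size k s : s \in all_paths k -> size s = k.
Proof.
elim: k s => [|k IH] s /=; first by rewrite inE => /eqP ->.
by rewrite mem_cat => /orP[] /mapP[s' /IH <- ->].
Qed.

Lemma all_paths_uniq k : uniq (all_paths k).
Proof.
elim: k => //= k IH; rewrite cat_uniq !map_inj_uniq ?IH//=; try by move=> ? ? [].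
by rewrite andbT -all_predC; apply/allP => _ /mapP[s _ ->] /=; apply/mapP => -[].
Qed.

Lemma path_weight_sum1 k x : \sum_(s <- all_paths k) path_weight x s = 1.
Proof.
elim: k x => [|k IH] x /=; first by rewrite big_seq1.
by rewrite big_cat !big_map /= -!mulr_sumr !IH /tr; ring.
Qed.

Lemma hit_pmfE k x z :
  hit_pmf k x z = \sum_(s <- all_paths k | path_hits x z s) path_weight x s.
Proof.
elim: k x => [|k IH] x /=.
  by rewrite big_mkcond big_seq1 /=; case: eqP.
rewrite big_cat !big_map /=; case: eqP => _ /=.
  by rewrite !big_pred0// addr0.
by rewrite -!mulr_sumr !IH.
Qed.

Lemma path_pos0 x s : path_pos x s 0 = x.
Proof. by case: s. Qed.

Lemma path_pos_rcons x s b k : (k <= size s)%N ->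
  path_pos x (rcons s b) k = path_pos x s k.
Proof. by elim: s x k => [|c s IH] x [|k] //= ks; exact: IH. Qed.

Lemma path_pos_rcons_last x s b :
  path_pos x (rcons s b) (size s).+1 = path_pos x s (size s) + step b.
Proof. by elim: s x => [|c s IH] x //=; exact: IH. Qed.

Lemma path_weight_rcons x s b :
  path_weight x (rcons s b) = path_weight x s * tr (path_pos x s (size s)) b.
Proof.
elim: s x => [|c s IH] x /=; first by rewrite mulrC.
by rewrite IH mulrA.
Qed.

Lemma path_pos_inj x s s' : size s = size s' ->
  (forall k, (k <= size s)%N -> path_pos x s k = path_pos x s' k) -> s = s'.
Proof.
elim: s s' x => [|b s IH] [|b' s'] //= x [ss'] h.
have bb' : b = b'.
  have := h 1%N isT; rewrite !path_pos0 => /addrI.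
  by rewrite /step; case: b {h}; case: b'.
rewrite -bb' in h *; congr (_ :: _); apply: (IH _ (x + step b)) => // k ks.
exact: (h k.+1 ks).
Qed.

Lemma path_hitsP x z s : reflect
  (path_pos x s (size s) = z /\ forall j, (j < size s)%N -> path_pos x s j <> z)
  (path_hits x z s).
Proof.
elim: s x => [|b s IH] x /=; first by apply: (iffP eqP) => [->|[]].
apply: (iffP andP) => [[xz /IH[h1 h2]]|[h1 h2]].
  by split=> // -[_|j /h2//]; exact/eqP.
split; first by apply/eqP; exact: (h2 0%N).
by apply/IH; split=> // j js; exact: (h2 j.+1).
Qed.

Hypothesis w01 : forall y, 0 <= w y <= 1.

Lemma hit_pmf_ge0 k x z : 0 <= hit_pmf k x z.
Proof.
elim: k x => [|k IH] x /=; first by rewrite ler0n.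
have /andP[w0 w1] := w01 x.
by case: ifP => // _; rewrite addr_ge0// mulr_ge0// subr_ge0.
Qed.

End hitting_pmf.

(** * Identification of the law of the hitting times of a quenched walk *)

Section quenched_law.
Variables (R : realType) (w : int -> R) (d : measure_display)
  (S : measurableType d) (X : nat -> S -> int) (x : int) (Q : probability S R).
Hypothesis w01 : forall y, 0 <= w y <= 1.
Hypothesis walk : quenched_walk X w x Q.

Definition path_event (s : seq bool) : set S :=
  [set o | forall k, (k <= size s)%N -> X k o = path_pos x s k].

Definition first_hit_event (z : int) (k : nat) : set S :=
  [set o | X k o = z /\ forall j, (j < k)%N -> X j o <> z].

Lemma measurable_path_event s : measurable (path_event s).
Proof.
rewrite (_ : path_event s =
  \bigcap_(k in `I_(size s).+1) [set o | X k o = path_pos x s k]).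
  by apply: bigcap_measurableType => // k _; exact: (qw_measurable walk).
by apply/seteqP; split=> o h k; exact: (h k).
Qed.

Lemma measurable_first_hit z k : measurable (first_hit_event z k).
Proof.
rewrite (_ : first_hit_event z k =
  [set o | X k o = z] `&` \bigcap_(j in `I_k) ~` [set o | X j o = z]).
  apply: measurableI; first exact: (qw_measurable walk).
  apply: bigcap_measurableType => // j _; apply: measurableC.
  exact: (qw_measurable walk).
by apply/seteqP; split=> o [h1 h2]; split=> // j jk; exact: (h2 j).
Qed.

Lemma cond_prob_step n y b : (0 < Q [set o | X n o = y])%E ->
  cond_prob Q [set o | X n.+1 o = y + step b] [set o | X n o = y] = tr w y b.
Proof.
move=> Q0; case: b; rewrite /tr /step; first exact: (qw_right walk).
by rewrite -(qw_left walk Q0) subKr.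
Qed.

(** The path is extended at its end, where the Markov property replaces conditioning on the whole
    past by conditioning on the present. The transition rules say nothing about null events, but
    then both sides vanish. *)
Lemma path_event_law s : Q (path_event s) = (path_weight w x s)%:E.
Proof.
elim/last_ind: s => [|s b IH].
  rewrite (_ : path_event [::] = [set o | X 0%N o = x]) ?(qw_start walk)//.
  apply/seteqP; split=> o /= h; first exact: (h 0%N).
  by move=> k; rewrite leqn0 => /eqP ->; rewrite path_pos0.
have mE := measurable_path_event.
set n := size s; set y := path_pos x s n.
have -> : path_event (rcons s b) = [set o | X n.+1 o = y + step b] `&` path_event s.
  apply/seteqP; split=> o.
    move=> h; split.
      by have := h (size s).+1; rewrite size_rcons path_pos_rcons_last; apply.
    move=> k ks; rewrite -(path_pos_rcons x b ks); apply: h.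
    by rewrite size_rcons ltnW.
  move=> [/= h1 h2] k; rewrite size_rcons leq_eqVlt => /predU1P[->|].
    by rewrite path_pos_rcons_last.
  by rewrite ltnS => ks; rewrite path_pos_rcons//; exact: h2.
have mX : measurable [set o | X n.+1 o = y + step b] by exact: (qw_measurable walk).
have fin_s : Q (path_event s) \is a fin_num by rewrite fin_num_measure.
rewrite path_weight_rcons EFinM -IH.
have [Q0|Q0] := eqVneq (Q (path_event s)) 0%E.
  rewrite Q0 mul0e; apply/eqP; rewrite eq_le measure_ge0 andbT -Q0.
  by apply: le_measure; rewrite ?inE//; exact: measurableI.
have Qpos : (0 < Q (path_event s))%E by rewrite lt_neqAle eq_sym Q0 measure_ge0.
have Qy : (0 < Q [set o | X n o = y])%E.
  apply: (lt_le_trans Qpos); apply: le_measure; rewrite ?inE//.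
    exact: (qw_measurable walk).
  by move=> o; exact.
have := qw_markov walk (path := path_pos x s) (y + step b) Qpos.
rewrite cond_prob_step// /cond_prob -/n -/y => h.
have fI : Q ([set o | X n.+1 o = y + step b] `&` path_event s) \is a fin_num.
  by rewrite fin_num_measure//; exact: measurableI.
rewrite -(fineK fI) -(fineK fin_s) -EFinM; congr EFin.
rewrite -h mulrCA divff ?mulr1// fine_eq0//.
Qed.

Lemma path_events_le k (P : pred (seq bool)) (A : set S) : measurable A ->
  (forall s, s \in all_paths k -> P s -> path_event s `<=` A) ->
  ((\sum_(s <- all_paths k | P s) path_weight w x s)%:E <= Q A)%E.
Proof.
move=> mA sA; rewrite -sumEFin.
under eq_bigr do rewrite -path_event_law.
rewrite -big_filter; set r := [seq s <- all_paths k | P s].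
have ru : uniq r by rewrite filter_uniq// all_paths_uniq.
have rk s : s \in r -> size s = k /\ path_event s `<=` A.
  rewrite mem_filter => /andP[Ps sk]; split; first exact: all_paths_size sk.
  exact: sA.
rewrite fsbig_seq// -measure_fin_bigcup//.
- apply: le_measure; rewrite ?inE//.
    by apply: fin_bigcup_measurable => // s _; exact: measurable_path_event.
  by move=> o [s /= /rk[_ sA']]; exact: sA'.
- move=> s s' /= /rk[ss _] /rk[ss' _] [p [h h']].
  apply: (@path_pos_inj x); first by rewrite ss.
  by move=> j js; rewrite -(h j js) (h' j)// ss' -ss.
- by move=> s _; exact: measurable_path_event.
Qed.

(** Path events inside an event give only a lower bound, as trajectories with other steps are not
    excluded pointwise. The bound is applied to the event and to its complement; since all path
    weights sum to one, both inequalities are equalities. *)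
Lemma first_hit_law z k : Q (first_hit_event z k) = (hit_pmf w k x z)%:E.
Proof.
have mH := measurable_first_hit z k.
have h1 : ((hit_pmf w k x z)%:E <= Q (first_hit_event z k))%E.
  rewrite hit_pmfE; apply: path_events_le => // s /all_paths_size sk.
  move=> /path_hitsP; rewrite sk => -[h1 h2] o h; split.
    by rewrite h ?sk.
  by move=> j jk; rewrite h ?sk 1?ltnW//; exact: h2.
have h2 : ((1 - hit_pmf w k x z)%:E <= Q (~` first_hit_event z k))%E.
  have -> : 1 - hit_pmf w k x z =
      \sum_(s <- all_paths k | ~~ path_hits x z s) path_weight w x s.
    rewrite hit_pmfE -(path_weight_sum1 w k x).
    by rewrite [in LHS](bigID (path_hits x z)) /= addrAC subrr add0r.
  apply: path_events_le; first exact: measurableC.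
  move=> s /all_paths_size sk /path_hitsP; rewrite sk => nh o h [g1 g2]; apply: nh.
  split; first by rewrite -g1 h ?sk.
  by move=> j jk; rewrite -h ?sk 1?ltnW//; exact: g2.
apply/eqP; rewrite eq_le h1 andbT.
have fH : Q (first_hit_event z k) \is a fin_num by rewrite fin_num_measure.
move: h2; rewrite probability_setC// -(fineK fH) -EFinB !lee_fin.
by rewrite lerD2l lerN2.
Qed.

Lemma hitting_timeE z k o : first_hit_event z k o ->
  hitting_time R X z o = (k%:R)%:E.
Proof.
move=> [h1 h2]; apply/eqP; rewrite eq_le; apply/andP; split.
  by apply: ereal_inf_lbound; exists k.
apply: le_ereal_inf_tmp => _ [j /= hj <-]; rewrite lee_fin ler_nat leqNgt.
by apply/negP => jk; exact: (h2 j jk hj).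
Qed.

Lemma first_hit_or_infinite z o :
  (exists k, first_hit_event z k o) \/ hitting_time R X z o = +oo%E.
Proof.
have [[k hk]|nh] := pselect (exists k, X k o = z).
  left; have ex : exists k, X k o == z by exists k; exact/eqP.
  exists (ex_minn ex); case: ex_minnP => j /eqP hj jm; split=> // i ij /eqP hi.
  by have := jm i hi; rewrite leqNgt ij.
right; rewrite /hitting_time (_ : [set _ | _ in _] = set0) ?ereal_inf0//.
by rewrite -subset0 => y [k /= hk _]; apply: nh; exists k.
Qed.

Lemma measurable_hitting_time z : measurable_fun setT (hitting_time R X z : S -> \bar R).
Proof.
pose f (k : nat) o : \bar R := if X k o == z then (k%:R)%:E else +oo%E.
have -> : hitting_time R X z = fun o => einfs (f ^~ o) 0.
  apply/funext => o; apply/eqP; rewrite eq_le; apply/andP; split.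
    apply: le_ereal_inf_tmp => _ [k _ <-]; rewrite /f; case: eqP => h; last exact: leey.
    by apply: ereal_inf_lbound; exists k.
  apply: le_ereal_inf_tmp => _ [k /= hk <-]; apply: ereal_inf_lbound.
  by exists k => //; rewrite /f hk eqxx.
apply: measurable_fun_einfs => k; apply: measurable_fun_ifT; last 2 first.
- exact: measurable_cst.
- exact: measurable_cst.
apply: (measurable_fun_bool true).
rewrite setTI (_ : _ @^-1` _ = [set o | X k o = z]); first exact: (qw_measurable walk).
by apply/seteqP; split=> o /= /eqP.
Qed.

Lemma first_hit_trivIset z : trivIset setT (first_hit_event z).
Proof.
move=> i j _ _ [p [[h1 h2] [h1' h2']]].
by case: (ltngtP i j) => // ij; [case: (h2' i ij)|case: (h2 j ij)].
Qed.

(** As the first-passage probabilities sum to one, the first-hit events partition the space up to a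
    null set, and [G] is constant on each of them. *)
Lemma integral_hitting_time z (G : S -> \bar R) (u : nat -> R) (m : R) :
  (fun K => \sum_(k < K) hit_pmf w k x z) @ \oo --> (1 : R) ->
  (fun K => \sum_(k < K) u k * hit_pmf w k x z) @ \oo --> m ->
  measurable_fun setT G -> (forall o, (0 <= G o)%E) ->
  (forall k o, first_hit_event z k o -> G o = (u k)%:E) ->
  (\int[Q]_o G o)%E = m%:E.
Proof.
move=> h1 hm mG G0 GE.
have mH := measurable_first_hit z.
have mU : measurable (\bigcup_k first_hit_event z k) by exact: bigcup_measurable.
have nn : Q (~` \bigcup_k first_hit_event z k) = 0%E.
  rewrite probability_setC//; suff -> : Q (\bigcup_k first_hit_event z k) = 1%E.
    by rewrite subee.
  rewrite measure_bigcup//; last exact: first_hit_trivIset.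
  apply/cvg_lim => //.
  rewrite (_ : (fun n => _) = EFin \o (fun K => \sum_(k < K) hit_pmf w k x z)).
    by apply/fine_cvgP; split; [apply: nearW|exact: h1].
  apply/funext => K /=; rewrite -sumEFin big_mkord; apply: eq_big => k.
    by apply/mem_set.
  by move=> _; exact: first_hit_law.
rewrite (ge0_negligible_integral (measurableC mU))//.
rewrite setDE setCK setTI ge0_integral_bigcup//; last 2 first.
- by apply: (measurable_funS measurableT).
- exact: first_hit_trivIset.
apply/cvg_lim => //.
rewrite (_ : (fun n => _) = EFin \o (fun K => \sum_(k < K) u k * hit_pmf w k x z)).
  by apply/fine_cvgP; split; [apply: nearW|exact: hm].
apply/funext => K /=; rewrite -sumEFin big_mkord; apply: eq_bigr => k _.
rewrite (eq_integral (cst (u k)%:E)); first by rewrite integral_cst// EFinM; congr (_ * _)%E; exact: first_hit_law.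
by move=> o; rewrite inE => /GE.
Qed.

Lemma hitting_time_cdf z (m c y : R) (N : nat) : 0 < c ->
  (forall k : nat, ((k%:R - m) * c <= y)%R = (k < N)%N) ->
  fine (Q [set o | ((hitting_time R X z o - m%:E) * c%:E <= y%:E)%E]) =
  \sum_(k < N) hit_pmf w k x z.
Proof.
move=> c0 hN.
rewrite (_ : [set _ | _] = \big[setU/set0]_(k < N) first_hit_event z k); last first.
  rewrite -(bigcup_mkord N (first_hit_event z)); apply/seteqP; split=> o /=.
    case: (first_hit_or_infinite z o) => [[k hk]|->].
      rewrite (hitting_timeE hk) -EFinB -EFinM lee_fin hN => kN.
      by exists k.
    (* An infinite hitting time stays infinite after normalisation, because [c] is positive, and so
       lies outside the event. *)
    by rewrite addye// mulyr gtr0_sg// mul1e leye_eq.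
  by move=> [k kN hk]; rewrite (hitting_timeE hk) -EFinB -EFinM lee_fin hN.
rewrite measure_bigsetU_ord//.
- rewrite (eq_bigr (fun k : 'I_N => (hit_pmf w k x z)%:E)) ?sumEFin//.
  by move=> k _; exact: first_hit_law.
- by move=> k; exact: measurable_first_hit.
- move=> i j _ _ ij; apply/val_inj; exact: (@first_hit_trivIset z).
Qed.

End quenched_law.

Lemma eq_cvgn (R : realType) (f g : nat -> R) (l : R) :
  f =1 g -> f @ \oo --> l -> g @ \oo --> l.
Proof. by move=> /funext ->. Qed.

Lemma cvgnD (R : realType) (f g : nat -> R) (a b : R) :
  f @ \oo --> a -> g @ \oo --> b -> (fun K => f K + g K) @ \oo --> a + b.
Proof. by move=> fa gb; apply: cvgD. Qed.

Lemma cvgnM (R : realType) (f g : nat -> R) (a b : R) :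
  f @ \oo --> a -> g @ \oo --> b -> (fun K => f K * g K) @ \oo --> a * b.
Proof. by move=> fa gb; apply: cvgM. Qed.

Lemma cvgn_cst (R : realType) (a : R) : (fun=> a : R) @ \oo --> a.
Proof. exact: cvg_cst. Qed.

(** * Cauchy products and moments of convolutions *)

Section cauchy_product.
Variable R : realType.
Implicit Types (f g : nat -> R).

Definition conv f g k : R := \sum_(j < k.+1) f j * g (k - j)%N.

Lemma sum_triangle (F : nat -> nat -> R) K :
  \sum_(k < K) \sum_(j < k.+1) F j (k - j)%N = \sum_(j < K) \sum_(i < K - j) F j i.
Proof.
elim: K => [|K IH]; first by rewrite !big_ord0.
rewrite big_ord_recr /= IH big_ord_recr /= subnn.
rewrite [RHS]big_ord_recr /= subSn// subnn big_ord1 addrA -big_split /=; congr (_ + _).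
apply: eq_bigr => j _.
by rewrite (subSn (ltnW (ltn_ord j))) big_ord_recr.
Qed.

Lemma sum_conv f g K :
  \sum_(k < K) conv f g k = \sum_(j < K) f j * \sum_(i < K - j) g i.
Proof.
rewrite (sum_triangle (fun j i => f j * g i)).
by apply: eq_bigr => j _; rewrite mulr_sumr.
Qed.

Lemma sum_ord_le f m n : (forall k, 0 <= f k) -> (m <= n)%N ->
  \sum_(k < m) f k <= \sum_(k < n) f k.
Proof.
move=> f0 mn; rewrite -!(big_mkord predT f) (big_cat_nat (leq0n m) mn) /=.
by rewrite lerDl sumr_ge0.
Qed.

Lemma sum_conv_le f g K : (forall k, 0 <= f k) -> (forall k, 0 <= g k) ->
  \sum_(k < K) conv f g k <= (\sum_(k < K) f k) * (\sum_(k < K) g k).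
Proof.
move=> f0 g0; rewrite sum_conv mulr_suml; apply: ler_sum => j _.
by apply: ler_wpM2l => //; apply: sum_ord_le => //; exact: leq_subr.
Qed.

(** The triangle [j + i < K] contains the square of side [K./2] and is contained in the square of
    side [K], so the partial sums are squeezed between two products of partial sums. *)
Lemma cvg_conv f g (a b : R) : (forall k, 0 <= f k) -> (forall k, 0 <= g k) ->
  (fun K => \sum_(k < K) f k) @ \oo --> a ->
  (fun K => \sum_(k < K) g k) @ \oo --> b ->
  (fun K => \sum_(k < K) conv f g k) @ \oo --> a * b.
Proof.
move=> f0 g0 fa gb.
have half : (fun K => K./2) @ \oo --> \oo.
  apply/cvgnyPge => A; near=> K.
  by rewrite geq_half_double; near: K; exists A.*2.
apply: (squeeze_cvgr _ _ (cvgM fa gb)); last first.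
  exact: (cvgM (cvg_comp _ _ half fa) (cvg_comp _ _ half gb)).
near=> K; rewrite sum_conv_le// andbT sum_conv /= mulr_suml.
apply: (@le_trans _ _ (\sum_(j < K./2) f j * \sum_(i < K - j) g i)).
  apply: ler_sum => j _; apply: ler_wpM2l => //; apply: sum_ord_le => //.
  have := ltn_ord j; move: (nat_of_ord j) => i; lia.
apply: (@sum_ord_le (fun j => f j * \sum_(i < K - j) g i)); last by lia.
by move=> j; rewrite mulr_ge0// sumr_ge0.
Unshelve. all: by end_near. Qed.

Lemma cvg_nondecreasing_bounded f B : (forall k, 0 <= f k) ->
  (forall K, \sum_(k < K) f k <= B) ->
  (fun K => \sum_(k < K) f k) @ \oo --> limn (fun K => \sum_(k < K) f k).
Proof.
move=> f0 fB; apply: nondecreasing_is_cvgn.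
  by apply/nondecreasing_seqP => n; rewrite big_ord_recr lerDl.
by exists B => _ [K _ <-]; exact: fB.
Qed.

End cauchy_product.

Section convolution_moments.
Variables (R : realType) (p A : nat -> nat -> R).
Hypothesis p_ge0 : forall i k, 0 <= p i k.
Hypothesis A0 : forall y, A 0 y = (y == 0%N)%:R.
Hypothesis AS : forall n y, A n.+1 y = \sum_(j < y.+1) A n j * p n (y - j)%N.
Variables (n : nat) (m1 m2 : nat -> R).
Hypothesis p_sum1 : forall i, (i < n)%N -> (fun K => \sum_(k < K) p i k) @ \oo --> (1 : R).
Hypothesis p_m1 : forall i, (i < n)%N ->
  (fun K => \sum_(k < K) k%:R ^+ 1 * p i k) @ \oo --> m1 i.
Hypothesis p_m2 : forall i, (i < n)%N ->
  (fun K => \sum_(k < K) k%:R ^+ 2 * p i k) @ \oo --> m2 i.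

Lemma conv_law_ge0 l y : 0 <= A l y.
Proof.
elim: l y => [|l IH] y; first by rewrite A0 ler0n.
by rewrite AS sumr_ge0// => j _; rewrite mulr_ge0.
Qed.

(** Moments of a convolution follow by expanding powers of [k = j + (k - j)]. The second moment is
    stored as a sum of variances plus the squared mean, so that variances add along the
    induction. *)
Lemma conv_law_moments l : (l <= n)%N ->
  [/\ (fun K => \sum_(k < K) A l k) @ \oo --> (1 : R),
     (fun K => \sum_(k < K) k%:R ^+ 1 * A l k) @ \oo --> \sum_(i < l) m1 i &
     (fun K => \sum_(k < K) k%:R ^+ 2 * A l k) @ \oo -->
       \sum_(i < l) (m2 i - m1 i ^+ 2) + (\sum_(i < l) m1 i) ^+ 2].
Proof.
elim: l => [_|l IH ln].
  have h (u : nat -> R) : (fun K => \sum_(k < K) u k * A 0 k) @ \oo --> u 0%N.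
    apply: cvg_near_cst; near=> K.
    have K0 : (0 < K)%N by near: K; exists 1%N.
    rewrite (bigD1 (Ordinal K0))//= big1 ?addr0 ?A0 ?eqxx ?mulr1// => k.
    by rewrite -val_eqE A0 /= => /negPf ->; rewrite mulr0.
  split.
  - by apply: eq_cvgn (h (fun=> 1)) => K; apply: eq_bigr => k _; rewrite mul1r.
  - by rewrite big_ord0; have := h (fun k => k%:R ^+ 1).
  - by rewrite !big_ord0 add0r expr0n; have := h (fun k => k%:R ^+ 2); rewrite expr0n.
have [h0 h1 h2] := IH (ltnW ln).
have A_ge0 := conv_law_ge0.
have g0 := p_sum1 ln; have g1 := p_m1 ln; have g2 := p_m2 ln.
pose a r k := k%:R ^+ r * A l k; pose b r k := k%:R ^+ r * p l k.
have a_ge0 r k : 0 <= a r k by rewrite mulr_ge0 ?exprn_ge0.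
have b_ge0 r k : 0 <= b r k by rewrite mulr_ge0 ?exprn_ge0.
split.
- have := cvg_conv (A_ge0 l) (p_ge0 l) h0 g0; rewrite mul1r.
  by move=> H; apply: eq_cvgn H => K; apply: eq_bigr => k _; rewrite AS.
- have := cvgnD (cvg_conv (a_ge0 1%N) (p_ge0 l) h1 g0) (cvg_conv (A_ge0 l) (b_ge0 1%N) h0 g1).
  rewrite mulr1 mul1r big_ord_recr /=.
  move=> H; apply: eq_cvgn H => K /=; rewrite -big_split; apply: eq_bigr => k _ /=.
  rewrite /conv -big_split AS mulr_sumr; apply: eq_bigr => j _ /=.
  rewrite /a /b !expr1 natrB; last by rewrite -ltnS.
  by ring.
- have := cvgnD (cvgnD (cvg_conv (a_ge0 2%N) (p_ge0 l) h2 g0)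
      (cvgnM (@cvgn_cst R (2 : R)) (cvg_conv (a_ge0 1%N) (b_ge0 1%N) h1 g1)))
      (cvg_conv (A_ge0 l) (b_ge0 2%N) h0 g2).
  move=> H.
  rewrite (_ : _ + _ ^+ 2 = (\sum_(i < l) (m2 i - m1 i ^+ 2) + (\sum_(i < l) m1 i) ^+ 2) * 1
    + 2 * (\sum_(i < l) m1 i * m1 l) + 1 * m2 l); last by rewrite !big_ord_recr /= -mulr_suml; ring.
  rewrite -mulr_suml.
  apply: eq_cvgn H => K /=; rewrite mulr_sumr -!big_split; apply: eq_bigr => k _ /=.
  rewrite /conv mulr_sumr -!big_split AS mulr_sumr; apply: eq_bigr => j _ /=.
  rewrite /a /b !expr1 natrB; last by rewrite -ltnS.
  by ring.
Unshelve. all: by end_near. Qed.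

End convolution_moments.

Section variance_lower_bound.
Variables (R : realType) (p : nat -> R) (m1 m2 : R).
Hypothesis p_ge0 : forall k, 0 <= p k.
Hypothesis p0 : p 0%N = 0.
Hypothesis p_sum1 : (fun K => \sum_(k < K) p k) @ \oo --> (1 : R).
Hypothesis p_m1 : (fun K => \sum_(k < K) k%:R ^+ 1 * p k) @ \oo --> m1.
Hypothesis p_m2 : (fun K => \sum_(k < K) k%:R ^+ 2 * p k) @ \oo --> m2.

(* The mean is at distance at least 1/2 either from 1 or from every k >= 2. *)
Lemma variance_ge : p 1%N * (1 - p 1%N) / 4 <= m2 - m1 ^+ 2.
Proof.
have S0 K : \sum_(k < K.+2) p k = p 1%N + \sum_(k < K) p k.+2.
  by rewrite big_ord_recl p0 add0r big_ord_recl.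
have p1_le1 : p 1%N <= 1.
  have /cvg_lim <- // := p_sum1.
  apply: (@le_trans _ _ (\sum_(k < 2) p k)); first by rewrite S0 big_ord0 addr0.
  apply: (@nondecreasing_cvgn_le _ (fun K => \sum_(k < K) p k)).
    by apply/nondecreasing_seqP => n; rewrite big_ord_recr lerDl.
  by apply/cvg_ex; exists 1; exact: p_sum1.
have vcvg : (fun K => \sum_(k < K) (k%:R - m1) ^+ 2 * p k) @ \oo --> m2 - m1 ^+ 2.
  have := cvgnD (cvgnD p_m2 (cvgnM (@cvgn_cst R (- (2 * m1) : R)) p_m1)) (cvgnM (@cvgn_cst R (m1 ^+ 2 : R)) p_sum1).
  rewrite (_ : m2 - m1 ^+ 2 = m2 + - (2 * m1) * m1 + m1 ^+ 2 * 1); last by ring.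
  move=> H; apply: eq_cvgn H => K /=; rewrite !mulr_sumr -!big_split; apply: eq_bigr => k _ /=.
  by ring.
have p1_ge0 := p_ge0 1%N.
have p11 : p 1%N * (1 - p 1%N) <= p 1%N by rewrite ler_piMr// lerBlDr lerDl.
have p11' : p 1%N * (1 - p 1%N) <= 1 - p 1%N by rewrite ler_piMl ?subr_ge0.
have [m1le|m1gt] := leP m1 (3/2).
  have lb : (fun K => (\sum_(k < K) p k - p 1%N) / 4) @ \oo --> ((1 - p 1%N) / 4).
    by apply: cvgM; [apply: cvgB; [exact: p_sum1|exact: cvg_cst]|exact: cvg_cst].
  apply: (@le_trans _ _ ((1 - p 1%N) / 4)); first by lra.
  apply: (ler_cvg_to lb vcvg); near=> K.
  have K2 : (2 <= K)%N by near: K; exists 2%N.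
  rewrite -(subnK K2) addn2 S0 addrAC subrr add0r.
  rewrite big_ord_recl p0 mulr0 add0r big_ord_recl mulr_suml.
  rewrite -[leLHS]add0r; apply: lerD; first by rewrite mulr_ge0 ?sqr_ge0.
  apply: ler_sum => k _; rewrite /= /bump /= !add1n.
  rewrite mulrC ler_wpM2r//.
  have h : 1/2 <= k.+2%:R - m1.
    by have h2 : (2 : R) <= k.+2%:R by [rewrite ler_nat]; lra.
  have : (1/2) ^+ 2 <= (k.+2%:R - m1) ^+ 2 by rewrite lerXn2r ?nnegrE//; lra.
  by apply: le_trans; lra.
apply: (@le_trans _ _ (p 1%N / 4)); first by lra.
apply: (ler_cvg_to (cvg_cst _) vcvg); near=> K.
have K2 : (2 <= K)%N by near: K; exists 2%N.
rewrite -(subnK K2) addn2.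
rewrite big_ord_recl p0 mulr0 add0r big_ord_recl /= /bump /= add1n.
rewrite -[leLHS]addr0; apply: lerD; last by apply: sumr_ge0 => k _; rewrite mulr_ge0 ?sqr_ge0.
rewrite mulrC ler_wpM2r//.
have h : 1/2 <= m1 - 1 by lra.
have : (1/2) ^+ 2 <= (m1 - 1) ^+ 2 by rewrite lerXn2r ?nnegrE//; lra.
by rewrite -[(m1 - 1) ^+ 2]sqrrN opprB; apply: le_trans; lra.
Unshelve. all: by end_near. Qed.

End variance_lower_bound.

Section one_step_pmf.
Variables (R : realType) (w : int -> R).
Implicit Types (x : int) (k : nat).

Definition step_pmf x k : R := hit_pmf w k x (x + 1).

Lemma step_pmf0 x : step_pmf x 0 = 0.
Proof. by rewrite /step_pmf /= (_ : x == x + 1 = false)//; lia. Qed.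

Lemma step_pmfS x k : step_pmf x k.+1 =
  w x * (k == 0%N)%:R + (1 - w x) * conv (step_pmf (x - 1)) (step_pmf x) k.
Proof.
rewrite /step_pmf /= (_ : x == x + 1 = false); last by lia.
rewrite hit_pmf_refl hit_pmf_conv; last by lia.
by rewrite /conv subrK.
Qed.

Lemma step_pmf1 x : step_pmf x 1 = w x.
Proof.
by rewrite step_pmfS mulr1 /conv big_ord1 !step_pmf0 mul0r mulr0 addr0.
Qed.

End one_step_pmf.

Lemma real_nat_threshold (R : realType) (L : R) :
  exists N : nat, forall k : nat, (k%:R <= L) = (k < N)%N.
Proof.
have [L0|L0] := ltP L 0.
  exists 0%N => k; rewrite ltn0; apply/negbTE; rewrite -ltNge.
  by apply: lt_le_trans L0 _.
exists (Num.truncn L).+1 => k; rewrite ltnS.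
by rewrite truncn_ge_nat.
Qed.

(** * The Berry-Esseen bound for a quenched hitting time *)

Section quenched_berry_esseen.
Variables (R : realType) (w : int -> R) (d : measure_display)
  (S : measurableType d) (X : nat -> S -> int) (Q : probability S R).
Hypothesis w01 : forall y, 0 <= w y <= 1.
Hypothesis walk : quenched_walk X w 0 Q.

(** The 16 is the factor 2 of the centred third moments times the factor 8 lost when the variance is
    replaced by [U / 4] in the power 3/2. *)
Definition be_cst : R := 16 * (3 * stein_cst R + 50).

Lemma be_cst_gt0 : 0 < be_cst.
Proof. by rewrite /be_cst; have := stein_cst_ge1 R; lra. Qed.

Lemma quenched_berry_esseen (n : nat) (B : nat -> R) (U : R) (y : R) :
  (forall i : nat, (i < n)%N ->
     (fun K => \sum_(k < K) step_pmf w i%:Z k) @ \oo --> (1 : R)) ->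
  (forall (i K : nat), (i < n)%N -> \sum_(k < K) k%:R ^+ 3 * step_pmf w i%:Z k <= B i) ->
  0 < U -> U <= \sum_(i < n) w i%:Z * (1 - w i%:Z) ->
  `|normalized_cdf Q (hitting_time R X n%:Z) y - Phi y| <=
    be_cst * (\sum_(i < n) B i) / (U * Num.sqrt U).
Proof.
move=> s1 m3 U0 UV.
pose p i k := step_pmf w i%:Z k.
pose A l k := hit_pmf w k 0 l%:Z.
have p_ge0 i k : 0 <= p i k by exact: hit_pmf_ge0.
have A0 k : A 0%N k = (k == 0%N)%:R by exact: hit_pmf_refl.
have AS l k : A l.+1 k = \sum_(j < k.+1) A l j * p l (k - j)%N.
  by rewrite /A -addn1 PoszD hit_pmf_conv.
(* The third moment dominates the lower ones because a crossing takes at least one step: the term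
   [k = 0], where [0 ^ 0 = 1], has weight zero. *)
have mom r : (r <= 3)%N -> forall i : nat, (i < n)%N ->
   (fun K => \sum_(k < K) k%:R ^+ r * p i k) @ \oo -->
   limn (fun K => \sum_(k < K) k%:R ^+ r * p i k).
  move=> r3 i ltin.
  apply: (@cvg_nondecreasing_bounded R (fun k => k%:R ^+ r * p i k) (B i)) => [k|K].
    by rewrite mulr_ge0 ?exprn_ge0.
  apply: le_trans (m3 i K ltin); apply: ler_sum => -[[|k] kK] _ /=.
    by rewrite /p step_pmf0 !mulr0.
  by apply: ler_wpM2r => //; rewrite ler_weXn2l// ler1n.
pose m1 i : R := limn (fun K => \sum_(k < K) k%:R ^+ 1 * p i k).
pose m2 i : R := limn (fun K => \sum_(k < K) k%:R ^+ 2 * p i k).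
have hm1 := mom 1%N isT; have hm2 := mom 2%N isT.
pose M : R := \sum_(i < n) m1 i.
pose V : R := \sum_(i < n) (m2 i - m1 i ^+ 2).
have [a0 a1 a2] := conv_law_moments p_ge0 A0 AS s1 hm1 hm2 (leqnn n).
rewrite -/M in a1 a2; rewrite -/V in a2.
have UV4 : U / 4 <= V.
  apply: (@le_trans _ _ (\sum_(i < n) w i%:Z * (1 - w i%:Z) / 4)).
    by rewrite -mulr_suml ler_pM2r.
  apply: ler_sum => i _; rewrite -(step_pmf1 w i).
  by apply: variance_ge (hm1 i _) (hm2 i _) => //; [exact: step_pmf0|exact: s1].
have V0 : 0 < V by lra.
have B0 : 0 <= \sum_(i < n) B i.
  by apply: sumr_ge0 => i _; have := m3 i 0%N (ltn_ord i); rewrite big_ord0.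
have sV0 : 0 < Num.sqrt V by rewrite sqrtr_gt0.
have mT := measurable_hitting_time walk n%:Z.
have T0 o : (0 <= hitting_time R X n%:Z o)%E.
  by apply: le_ereal_inf_tmp => _ [k _ <-]; rewrite lee_fin.
have meanT : mean Q (hitting_time R X n%:Z) = M%:E.
  rewrite /mean; apply: (integral_hitting_time walk (u := fun k => k%:R ^+ 1) a0 a1) => // k o.
  by rewrite expr1; exact: hitting_timeE.
have meanT2 : mean Q (fun o => hitting_time R X n%:Z o ^+ 2)%E = (V + M ^+ 2)%:E.
  rewrite /mean; apply: (integral_hitting_time walk (u := fun k => k%:R ^+ 2) a0 a2) => //.
  - by apply: emeasurable_funM.
  - by move=> o; rewrite expe_ge0.
  - by move=> k o /hitting_timeE ->; rewrite EFin_expe.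
have varT : fine (var Q (hitting_time R X n%:Z)) = V.
  by rewrite /var meanT meanT2 -EFin_expe -EFinB /= addrK.
rewrite /normalized_cdf meanT varT.
have [N hN] := real_nat_threshold (M + y * Num.sqrt V).
have -> := @hitting_time_cdf _ w _ _ _ _ Q walk n%:Z M (Num.sqrt V)^-1 y N;
  last 2 first.
- by rewrite invr_gt0.
- by move=> k; rewrite ler_pdivrMr// lerBlDr addrC hN.
have := berry_esseen_nat p_ge0 A0 AS s1 hm1 hm2 (fun i K => m3 i K) V0 hN.
rewrite -/M -/V addrAC subrr add0r mulfK ?gt_eqF// => /le_trans; apply.
have sU0 : 0 < Num.sqrt U by rewrite sqrtr_gt0.
have s4 : Num.sqrt (U / 4) = Num.sqrt U / 2.
  rewrite sqrtrM ?(ltW U0)//; congr (_ * _).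
  by rewrite (_ : 4^-1 = (2^-1) ^+ 2) ?sqrtr_sqr ?ger0_norm//; field.
have h1 : Num.sqrt U / 2 <= Num.sqrt V by rewrite -s4 ler_wsqrtr.
have key : 2 / (V * Num.sqrt V) <= 16 / (U * Num.sqrt U).
  rewrite ler_pdivrMr; last by rewrite mulr_gt0.
  rewrite mulrAC ler_pdivlMr; last by rewrite mulr_gt0.
  have : (U / 4) * (Num.sqrt U / 2) <= V * Num.sqrt V.
    by apply: ler_pM => //; rewrite divr_ge0// ltW.
  by lra.
have K0 : 0 <= 3 * stein_cst R + 50 by have := stein_cst_ge1 R; lra.
have := ler_wpM2l (mulr_ge0 K0 B0) key.
rewrite /be_cst; move: (V * Num.sqrt V)^-1 (U * Num.sqrt U)^-1 => a b; lra.
Qed.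

End quenched_berry_esseen.

(** * Recursions for truncated crossing moments *)

Section truncated_moments.
Variables (R : realType) (w : int -> R).
Hypothesis w01 : forall y, 0 < w y <= 1.
Implicit Types (x : int) (k K r : nat).

(* Truncated moments of one plus the crossing time: the shift makes the
   first-step decomposition homogeneous. *)
Definition trunc_mom r K x : R := \sum_(k < K) k.+1%:R ^+ r * step_pmf w x k.

Definition odds x : R := (1 - w x) / w x.

Let w01' y : 0 <= w y <= 1.
Proof. by have /andP[w0 ->] := w01 y; rewrite ltW. Qed.

Let p_ge0 x k : 0 <= step_pmf w x k.
Proof. exact: hit_pmf_ge0. Qed.

Lemma odds_ge0 x : 0 <= odds x.
Proof. by have /andP[w0 w1] := w01 x; rewrite divr_ge0 ?subr_ge0// ltW. Qed.

Lemma trunc_mom_ge0 r K x : 0 <= trunc_mom r K x.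
Proof. by apply: sumr_ge0 => k _; rewrite mulr_ge0 ?exprn_ge0. Qed.

Lemma trunc_mom_ndecr r K L x : (K <= L)%N -> trunc_mom r K x <= trunc_mom r L x.
Proof.
move=> KL; apply: (@sum_ord_le R (fun k => k.+1%:R ^+ r * step_pmf w x k)) => // k.
by rewrite mulr_ge0 ?exprn_ge0.
Qed.

(** After a step to the left the two further crossings satisfy [j + i < K]. Enlarging this triangle
    to a square, the only loss, lets the double sum factor into products of truncated moments after
    expansion of the power. *)
Lemma trunc_mom_recr r K x : trunc_mom r K.+1 x <=
  w x * 2 ^+ r + (1 - w x) * \sum_(j < K) \sum_(i < K)
    (j.+1%:R + i.+1%:R) ^+ r * (step_pmf w (x - 1) j * step_pmf w x i).
Proof.
have /andP[w0 w1] := w01 x.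
rewrite /trunc_mom big_ord_recl step_pmf0 mulr0 add0r.
under eq_bigr => k _ do rewrite /= /bump /= add1n step_pmfS mulrDr.
rewrite big_split /=; apply: lerD.
  (* A step to the right crosses in time 1, which the shift by one turns into [2 ^ r]. *)
  case: K => [|K]; first by rewrite big_ord0 mulr_ge0 ?(ltW w0).
  rewrite big_ord_recl /= mulr1 big1 ?addr0 1?mulrC// => k _.
  by rewrite mul0r mulr0.
pose F (j i : nat) : R :=
  (j.+1%:R + i.+1%:R) ^+ r * (step_pmf w (x - 1) j * step_pmf w x i).
rewrite (eq_bigr (fun k : 'I_K => (1 - w x) * \sum_(j < k.+1) F j (k - j)%N)).
  rewrite -mulr_sumr; apply: ler_wpM2l; first by rewrite subr_ge0.
  rewrite sum_triangle; apply: ler_sum => j _.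
  apply: (@sum_ord_le R (F j)); last exact: leq_subr.
  by move=> i; rewrite /F !mulr_ge0// exprn_ge0.
move=> k _; rewrite mulrCA; congr (_ * _); rewrite /conv mulr_sumr.
apply: eq_bigr => j _; rewrite /F -natrD addSn addnS subnKC//.
by rewrite -ltnS.
Qed.

Let mom2 K x r l : \sum_(j < K) \sum_(i < K) (j.+1%:R ^+ r * i.+1%:R ^+ l) *
   (step_pmf w (x - 1) j * step_pmf w x i) = trunc_mom r K (x - 1) * trunc_mom l K x.
Proof.
rewrite mulr_suml; apply: eq_bigr => j _; rewrite mulr_sumr; apply: eq_bigr => i _.
by rewrite mulrACA.
Qed.

Lemma trunc_mom0_le1 K x : trunc_mom 0 K x <= 1.
Proof.
elim: K x => [|K IH] x; first by rewrite /trunc_mom big_ord0.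
have /andP[w0 w1] := w01 x.
apply: le_trans (trunc_mom_recr 0 K x) _.
have -> : \sum_(j < K) \sum_(i < K) (j.+1%:R + i.+1%:R) ^+ 0 *
    (step_pmf w (x - 1) j * step_pmf w x i) = trunc_mom 0 K (x - 1) * trunc_mom 0 K x.
  rewrite -mom2; apply: eq_bigr => j _; apply: eq_bigr => i _.
  by rewrite !expr0 !mul1r.
rewrite expr0 mulr1.
have : trunc_mom 0 K (x - 1) * trunc_mom 0 K x <= 1.
  by apply: mulr_ile1; rewrite ?trunc_mom_ge0 ?IH.
have : 0 <= 1 - w x by rewrite subr_ge0.
nra.
Qed.

Let mom2_le K x r : trunc_mom 0 K (x - 1) * trunc_mom r K x <= trunc_mom r K x.
Proof. by rewrite ler_piMl ?trunc_mom_ge0 ?trunc_mom0_le1. Qed.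

Let mom2_le' K x r : trunc_mom r K (x - 1) * trunc_mom 0 K x <= trunc_mom r K (x - 1).
Proof. by rewrite ler_piMr ?trunc_mom_ge0 ?trunc_mom0_le1. Qed.

(* Absorbs the term [t] of the same site, which is at most the left-hand side. *)
Let absorb (x : int) (t' t v c A : R) : t <= t' ->
  t' <= w x * c + (1 - w x) * A -> A <= t + v -> t' <= c + odds x * v.
Proof.
have /andP[w0 w1] := w01 x.
have oE : w x * odds x = 1 - w x by rewrite mulrC divfK ?gt_eqF.
move=> tt h Av; rewrite -(ler_pM2l w0) mulrDr mulrA oE.
have : (1 - w x) * A <= (1 - w x) * (t' + v).
  by apply: ler_wpM2l; [rewrite subr_ge0|lra].
lra.
Qed.

Lemma trunc_mom1_le K x :
  trunc_mom 1 K.+1 x <= 2 + odds x * trunc_mom 1 K (x - 1).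
Proof.
apply: (absorb (trunc_mom_ndecr 1 x (leqnSn K)) (trunc_mom_recr 1 K x)).
apply: le_trans (lerD (mom2_le K x 1) (mom2_le' K x 1)).
rewrite -!mom2 -!big_split; apply: ler_sum => j _ /=; rewrite -!big_split.
by apply: ler_sum => i _ /=; rewrite le_eqVlt; apply/orP; left; apply/eqP; ring.
Qed.

Lemma trunc_mom2_le K x :
  trunc_mom 2 K.+1 x <= 4 + odds x *
    (trunc_mom 2 K (x - 1) + 2 * (trunc_mom 1 K (x - 1) * trunc_mom 1 K x)).
Proof.
have -> : 4 = 2 ^+ 2 :> R by ring.
apply: (absorb (trunc_mom_ndecr 2 x (leqnSn K)) (trunc_mom_recr 2 K x)).
rewrite addrA; apply: le_trans (lerD (lerD (mom2_le K x 2) (mom2_le' K x 2)) (lexx _)).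
rewrite -!mom2 mulr_sumr -!big_split; apply: ler_sum => j _ /=.
rewrite mulr_sumr -!big_split.
by apply: ler_sum => i _ /=; rewrite le_eqVlt; apply/orP; left; apply/eqP; ring.
Qed.

Lemma trunc_mom3_le K x :
  trunc_mom 3 K.+1 x <= 8 + odds x *
    (trunc_mom 3 K (x - 1) + 3 * (trunc_mom 1 K (x - 1) * trunc_mom 2 K x
       + trunc_mom 2 K (x - 1) * trunc_mom 1 K x)).
Proof.
have -> : 8 = 2 ^+ 3 :> R by ring.
apply: (absorb (trunc_mom_ndecr 3 x (leqnSn K)) (trunc_mom_recr 3 K x)).
rewrite addrA; apply: le_trans (lerD (lerD (mom2_le K x 3) (mom2_le' K x 3)) (lexx _)).
rewrite mulrDr -!mom2 !mulr_sumr -!big_split; apply: ler_sum => j _ /=.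
rewrite !mulr_sumr -!big_split.
by apply: ler_sum => i _ /=; rewrite le_eqVlt; apply/orP; left; apply/eqP; ring.
Qed.

(** The first moment at [x] is eliminated through its own recursion. Every term becomes a function
    of [odds x] times a function of site [x - 1] and its past, two factors that are independent
    under the law of the environment. *)
Lemma trunc_mom2_recursion K x :
  trunc_mom 2 K.+1 x <= odds x * trunc_mom 2 K (x - 1)
    + 4 * (1 + odds x) ^+ 2 * (1 + trunc_mom 1 K (x - 1)) ^+ 2.
Proof.
apply: le_trans (trunc_mom2_le K x) _.
have o := odds_ge0 x; have v := trunc_mom_ge0 1 K (x - 1).
have u : trunc_mom 1 K x <= 2 + odds x * trunc_mom 1 K (x - 1).
  exact: le_trans (trunc_mom_ndecr 1 x (leqnSn K)) (trunc_mom1_le K x).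
have : (odds x * trunc_mom 1 K (x - 1)) * trunc_mom 1 K x <=
  (odds x * trunc_mom 1 K (x - 1)) * (2 + odds x * trunc_mom 1 K (x - 1)).
  by apply: ler_wpM2l => //; rewrite mulr_ge0.
move: (trunc_mom 1 K x) (trunc_mom 2 K (x - 1)) (trunc_mom 1 K (x - 1)) (odds x) o v {u}.
move=> u v2 v o o0 v0.
have ov : 0 <= o * v by rewrite mulr_ge0.
have : 0 <= o * v * o by rewrite mulr_ge0.
have : 0 <= o * v * v by rewrite mulr_ge0.
have : 0 <= o * v * (o * v) by rewrite mulr_ge0.
have : 0 <= o * o by rewrite mulr_ge0.
have : 0 <= v * v by rewrite mulr_ge0.
lra.
Qed.

Lemma trunc_mom3_recursion K x :
  trunc_mom 3 K.+1 x <= odds x * trunc_mom 3 K (x - 1)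
    + (1 + odds x) ^+ 3 * (20 * (1 + trunc_mom 1 K (x - 1)) ^+ 3
       + 9 * (1 + trunc_mom 1 K (x - 1)) * trunc_mom 2 K (x - 1)).
Proof.
apply: le_trans (trunc_mom3_le K x) _.
have o := odds_ge0 x; have v := trunc_mom_ge0 1 K (x - 1).
have v' := trunc_mom_ge0 2 K (x - 1).
have u : trunc_mom 1 K x <= 2 + odds x * trunc_mom 1 K (x - 1).
  exact: le_trans (trunc_mom_ndecr 1 x (leqnSn K)) (trunc_mom1_le K x).
have u' : trunc_mom 2 K x <= odds x * trunc_mom 2 K (x - 1)
    + 4 * (1 + odds x) ^+ 2 * (1 + trunc_mom 1 K (x - 1)) ^+ 2.
  exact: le_trans (trunc_mom_ndecr 2 x (leqnSn K)) (trunc_mom2_recursion K x).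
move: (trunc_mom 1 K x) (trunc_mom 2 K x) u u'.
move: (trunc_mom 3 K (x - 1)) (trunc_mom 2 K (x - 1)) (trunc_mom 1 K (x - 1)) (odds x) o v v'.
move=> v3 v2 v o o0 v0 v20 u u2 hu hu2.
have s1 : 1 <= 1 + v by lra.
have g1 : 1 <= 1 + o by lra.
have vs : v <= 1 + v by lra.
have og : o <= 1 + o by lra.
have ov0 : 0 <= o * v by rewrite mulr_ge0.
have ovgs : 2 + o * v <= 2 * ((1 + o) * (1 + v)) by lra.
have gg2 : (1 + o) * v2 <= (1 + o) ^+ 2 * v2.
  by apply: ler_wpM2r => //; rewrite ler_eXnr.
have og2 : o * v2 <= (1 + o) * v2 by apply: ler_wpM2r.
move: (1 + v) (1 + o) s1 g1 vs og ovgs gg2 og2 hu2 => s g s1 g1 vs og ovgs gg2 og2 hu2.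
have s0 : 0 <= s by lra.
have g0 : 0 <= g by lra.
have gs0 : 0 <= g * s by rewrite mulr_ge0.
have ovg : o * v <= g * s by apply: ler_pM.
have h1 : o * v * u2 <= g * s * (g * v2 + 4 * g ^+ 2 * s ^+ 2).
  apply: (@le_trans _ _ (o * v * (g * v2 + 4 * g ^+ 2 * s ^+ 2))).
    by apply: ler_wpM2l; [rewrite mulr_ge0|lra].
  apply: ler_wpM2r => //.
  by rewrite addr_ge0 ?mulr_ge0 ?exprn_ge0.
have h2 : o * v2 * u <= g * v2 * (2 * (g * s)).
  apply: (@le_trans _ _ (o * v2 * (2 * (g * s)))).
    by apply: ler_wpM2l; [rewrite mulr_ge0|lra].
  apply: ler_wpM2r => //.
  by rewrite mulr_ge0.
have h3 : 1 <= (g * s) ^+ 3.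
  by rewrite exprn_ege1// mulr_ege1.
have h4 : g ^+ 2 * (s * v2) <= g ^+ 3 * (s * v2).
  by apply: ler_wpM2r; [rewrite mulr_ge0|rewrite ler_weXn2l].
rewrite exprMn in h3.
lra.
Qed.

End truncated_moments.

(** * Moments and growth of the environment *)

Section independent_product.
Context (R : realType) (d : measure_display) (Omega : measurableType d)
  (P : probability Omega R).
Local Open Scope ereal_scope.

(** Independence says that the joint law agrees with the product of the laws on rectangles, hence
    everywhere; the integral then factors by Tonelli's theorem, with no integrability to be
    known. *)
Lemma integral_mul_indep (Y h : Omega -> R) :
  measurable_fun setT Y -> measurable_fun setT h ->
  (forall o, (0 <= Y o)%R) -> (forall o, (0 <= h o)%R) ->
  (forall A B : set R, measurable A -> measurable B ->
     P (Y @^-1` A `&` h @^-1` B) = P (Y @^-1` A) * P (h @^-1` B)) ->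
  \int[P]_o (Y o * h o)%:E = (\int[P]_o (Y o)%:E) * (\int[P]_o (h o)%:E).
Proof.
move=> mY mh Y0 h0 ind.
pose Y' : {mfun Omega >-> R} := HB.pack Y (isMeasurableFun.Build _ _ _ _ Y mY).
pose h' : {mfun Omega >-> R} := HB.pack h (isMeasurableFun.Build _ _ _ _ h mh).
pose Z := fun o => (Y o, h o).
have mZ : measurable_fun setT Z by exact: measurable_fun_pair.
pose Z' : {mfun Omega >-> (R * R)%type} :=
  HB.pack Z (isMeasurableFun.Build _ _ _ _ Z mZ).
(* The absolute values make the integrand nonnegative on the whole plane, while the variables are
   nonnegative only along their values. *)
pose F (z : R * R) : \bar R := (`|z.1| * `|z.2|)%:E.
have mF : measurable_fun setT F.
  apply/measurable_EFinP; apply: measurable_funM; apply: measurableT_comp => //.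
transitivity (\int[distribution P Z']_z F z).
  rewrite ge0_integral_distribution//; last by move=> z; rewrite lee_fin mulr_ge0.
  by apply: eq_integral => o _; rewrite /F /= !ger0_norm.
transitivity (\int[(distribution P Y') \x (distribution P h')]_z F z).
  apply: eq_measure_integral => A mA _.
  apply/esym; apply: product_measure_unique => [B C mB mC|]; last exact: mA.
  exact: (ind B C mB mC).
rewrite fubini_tonelli1//; last by move=> z; rewrite lee_fin mulr_ge0.
have mabs : measurable_fun setT (fun x : R => `|x|%:E).
  by apply/measurable_EFinP; exact: normr_measurable.
have iY : \int[distribution P Y']_x `|x|%:E = \int[P]_o (Y o)%:E.
  rewrite ge0_integral_distribution//.
  by apply: eq_integral => o _; rewrite /= ger0_norm.
have ih : \int[distribution P h']_x `|x|%:E = \int[P]_o (h o)%:E.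
  rewrite ge0_integral_distribution//.
  by apply: eq_integral => o _; rewrite /= ger0_norm.
rewrite -iY -ih /fubini_F /F.
rewrite -ge0_integralZr//; last by apply: integral_ge0 => x _; rewrite lee_fin.
apply: eq_integral => x _ /=; under eq_integral do rewrite EFinM.
by rewrite ge0_integralZl_EFin.
Qed.

End independent_product.

Section power_inequalities.
Variable R : realType.
Implicit Types a b c e q r t x y : R.

Lemma le_powR q a b : 0 <= q -> 0 <= a -> a <= b -> a `^ q <= b `^ q.
Proof.
by move=> q0 a0 ab; apply: ge0_ler_powR; rewrite ?nnegrE// (le_trans a0).
Qed.

(* Young's inequality, or concavity of the power. *)
Lemma powR_le_affine r t : 0 < r -> r <= 1 -> 0 <= t -> t `^ r <= r * t + (1 - r).
Proof.
move=> r0; rewrite le_eqVlt => /predU1P[->|r1] t0.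
  by rewrite powRr1// mul1r subrr addr0.
have r10 : 0 < 1 - r by rewrite subr_gt0.
have := @conjugate_powR R (t `^ r) 1 r^-1 (1 - r)^-1 (powR_ge0 _ _) ler01.
rewrite !invr_gt0 !invrK mulr1 powR1 mul1r -powRrM mulfV ?gt_eqF// powRr1// => /(_ r0 r10).
by rewrite (mulrC r) addrC subrK; exact.
Qed.

(** According to whether [b <= e * a], the sum is at most [(1 + e) * a] or [(1 + e^-1) * b]. The
    factor on [a] can be taken close to one, so that a contraction stays a contraction. *)
Lemma powR_add_le q e a b : 0 < q -> 0 < e -> 0 <= a -> 0 <= b ->
  (a + b) `^ q <= (1 + e) `^ q * a `^ q + (1 + e^-1) `^ q * b `^ q.
Proof.
move=> q0 e0 a0 b0; have ei0 : 0 < e^-1 by rewrite invr_gt0.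
have e10 : 0 <= 1 + e by lra.
have ei10 : 0 <= 1 + e^-1 by lra.
rewrite -!powRM//; have [h|h] := leP b (e * a).
  apply: (@le_trans _ _ (((1 + e) * a) `^ q)); last by rewrite lerDl powR_ge0.
  by apply: le_powR; [exact: ltW|lra|lra].
have h' : a <= e^-1 * b.
  by rewrite mulrC ler_pdivlMr// mulrC ltW.
apply: (@le_trans _ _ (((1 + e^-1) * b) `^ q)); last by rewrite lerDr powR_ge0.
by apply: le_powR; [exact: ltW|lra|lra].
Qed.

Lemma exists_small_power q A : 0 < q -> 0 <= A -> A < 1 ->
  exists2 e, 0 < e & (1 + e) `^ q * A < 1.
Proof.
move=> q0 A0 A1.
pose B := (1 + A) / 2; have B0 : 0 < B by rewrite /B; lra.
have B1 : B < 1 by rewrite /B; lra.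
exists ((B^-1) `^ q^-1 - 1).
  have : 1 `^ q^-1 < B^-1 `^ q^-1.
    apply: gt0_ltr_powR; rewrite ?invr_gt0// ?nnegrE ?invr_ge0 ?(ltW B0)//.
    by rewrite invf_gt1.
  by rewrite powR1 subr_gt0.
rewrite addrC subrK -powRrM mulVf ?gt_eqF// powRr1 ?invr_ge0 ?ltW//.
by rewrite mulrC ltr_pdivrMr// mul1r /B; lra.
Qed.

(** A fraction [t] of the sum satisfies [t <= t ^ r]; this is added for the two fractions
    [a / (a + b)] and [b / (a + b)]. *)
Lemma powR_subadditive r a b : 0 < r -> r <= 1 -> 0 <= a -> 0 <= b ->
  (a + b) `^ r <= a `^ r + b `^ r.
Proof.
move=> r0 r1 a0 b0; have [ab0|ab0] := eqVneq (a + b) 0.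
  by rewrite ab0 powR0 ?gt_eqF// addr_ge0 ?powR_ge0.
have abp : 0 < a + b by rewrite lt_neqAle eq_sym ab0 addr_ge0.
have key c : 0 <= c -> c <= a + b -> (a + b) `^ r * (c / (a + b)) <= c `^ r.
  move=> c0 cab; have t0 : 0 <= c / (a + b) by rewrite divr_ge0// addr_ge0.
  have cE : c = (a + b) * (c / (a + b)) by field.
  rewrite [X in _ <= X `^ _]cE powRM ?(ltW abp)//; apply: ler_wpM2l; first exact: powR_ge0.
  have [->|tn0] := eqVneq (c / (a + b)) 0; first exact: powR_ge0.
  have tp : 0 < c / (a + b) by rewrite lt_neqAle eq_sym tn0.
  rewrite -[X in X <= _]powRr1//; apply: ger_powR => //.
  by rewrite tp /= ler_pdivrMr// mul1r.
have := lerD (key a a0 _) (key b b0 _).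
rewrite -mulrDr -mulrDl divff// mulr1; apply; lra.
Qed.

Lemma powR_subadditive_sum (r : R) (n : nat) (F : nat -> R) : 0 < r -> r <= 1 ->
  (forall i, 0 <= F i) -> (\sum_(i < n) F i) `^ r <= \sum_(i < n) F i `^ r.
Proof.
move=> r0 r1 F0; elim: n => [|n IH]; first by rewrite !big_ord0 powR0// gt_eqF.
rewrite !big_ord_recr /=; apply: le_trans (powR_subadditive r0 r1 _ _) _ => //.
  exact: sumr_ge0.
by rewrite lerD2r.
Qed.

(* The derivative of [|a|^q / q]. *)
Definition dpow q a : R := Num.sg a * `|a| `^ (q - 1).

Lemma dpowN q a : dpow q (- a) = - dpow q a.
Proof. by rewrite /dpow sgrN normrN mulNr. Qed.

Lemma norm_dpow q a : `|dpow q a| <= `|a| `^ (q - 1).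
Proof.
rewrite /dpow normrM (ger0_norm (powR_ge0 _ _)) normr_sg.
by rewrite ler_piMl ?powR_ge0// lern1 leq_b1.
Qed.

(* The pointwise inequality behind the von Bahr-Esseen moment bound. *)
Lemma powR_norm_add_le q a b : 1 < q -> q <= 2 ->
  `|a + b| `^ q <= `|a| `^ q + q * (dpow q a * b) + 3 * `|b| `^ q.
Proof.
move=> q1 q2; have q0 : 0 < q by lra.
wlog a0 : a b / 0 <= a => [hw|].
  have [/hw//|a0] := leP 0 a.
  have := hw (- a) (- b); rewrite -opprD !normrN dpowN mulrNN; apply; lra.
have [->|an0] := eqVneq a 0.
  rewrite add0r /dpow sgr0 !mul0r mulr0 normr0 powR0 ?gt_eqF// !add0r.
  have := powR_ge0 `|b| q; lra.
have ap : 0 < a by rewrite lt_neqAle eq_sym an0.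
rewrite /dpow gtr0_sg// mul1r (ger0_norm a0).
have P x : 0 <= x -> x * x `^ (q - 1) = x `^ q by move=> x0; rewrite mulr_powRB1.
(* If [a + b < 0] then [a < |b|]: the left-hand side is at most [|b| ^ q] and the linear term at
   least [- 2 * |b| ^ q], whence the constant 3. *)
have [ab0|ab0] := leP 0 (a + b); last first.
  have h1 : `|a + b| `^ q <= `|b| `^ q.
    apply: le_powR => //; first exact: ltW.
    by rewrite !ltr0_norm; lra.
  have h2 : a `^ (q - 1) * `|b| <= `|b| `^ q.
    rewrite -[leRHS]P// mulrC; apply: ler_wpM2l => //.
    by apply: le_powR; [lra|lra|rewrite ltr0_norm; lra].
  have := powR_ge0 a q; have := powR_ge0 `|b| q.
  have bE : b = - `|b| by rewrite ltr0_norm ?opprK//; lra.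
  move=> h3 h4.
  have h5 : a `^ (q - 1) * b = - (a `^ (q - 1) * `|b|) by rewrite {1}bE mulrN.
  have : q * (a `^ (q - 1) * `|b|) <= 2 * `|b| `^ q.
    by apply: ler_pM => //; [exact: ltW|rewrite mulr_ge0// powR_ge0].
  rewrite h5; lra.
rewrite (ger0_norm ab0).
have young : q * (a * (a + b) `^ (q - 1)) <= a `^ q + (q - 1) * (a + b) `^ q.
  have := @conjugate_powR R a ((a + b) `^ (q - 1)) q (q / (q - 1)) a0 (powR_ge0 _ _) q0.
  rewrite divr_gt0 ?subr_gt0// => /(_ isT).
  have qn0 : q != 0 by rewrite gt_eqF.
  have q1n0 : q - 1 != 0 by rewrite gt_eqF// subr_gt0.
  rewrite -powRrM (_ : (q - 1) * (q / (q - 1)) = q); last by field.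
  have conj : q^-1 + (q / (q - 1))^-1 = 1 by field; apply/andP.
  move=> /(_ conj).
  rewrite [a * _]mulrC -(ler_pM2l q0) mulrDr => /le_trans; apply.
  rewrite le_eqVlt; apply/orP; left; apply/eqP; field.
  exact/andP.
(* Convexity of the power, with the tangent taken at [a + b]; Young's inequality supplies it without
   differentiation. *)
have tangent : (a + b) `^ q <= a `^ q + q * (b * (a + b) `^ (q - 1)).
  have e2 : q * (a * (a + b) `^ (q - 1)) + q * (b * (a + b) `^ (q - 1)) = q * (a + b) `^ q.
    by rewrite -mulrDr -mulrDl P.
  lra.
(* Moving the slope from [a + b] back to [a] uses Holder continuity of exponent [q - 1 <= 1], that
   is, subadditivity of the power. *)
have hold : b * ((a + b) `^ (q - 1) - a `^ (q - 1)) <= `|b| `^ q.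
  have [b0|b0] := leP 0 b.
    rewrite -(P `|b|)// {1}(ger0_norm b0); apply: ler_wpM2l => //.
    by rewrite lerBlDl (ger0_norm b0); apply: powR_subadditive; lra.
  have -> : b * ((a + b) `^ (q - 1) - a `^ (q - 1)) =
     `|b| * (a `^ (q - 1) - (a + b) `^ (q - 1)) by rewrite ltr0_norm//; ring.
  rewrite -(P `|b|)//; apply: ler_wpM2l => //.
  rewrite lerBlDl; have -> : a = (a + b) + `|b| by rewrite ltr0_norm//; ring.
  have -> : a + b + `|b| + b = a + b by rewrite ltr0_norm//; ring.
  by apply: powR_subadditive => //; lra.
have : q * (b * ((a + b) `^ (q - 1) - a `^ (q - 1))) <= q * `|b| `^ q.
  by rewrite ler_pM2l.
have : q * `|b| `^ q <= 3 * `|b| `^ q by rewrite ler_wpM2r ?powR_ge0//; lra.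
lra.
Qed.

Lemma mul_sqr_le (x y : R) : 0 <= x -> 0 <= y ->
  x * y <= x ^+ 3 + y `^ (3 / 2).
Proof.
move=> x0 y0.
have e : y `^ (3/2) = Num.sqrt y ^+ 3.
  rewrite -powR_mulrn ?sqrtr_ge0// -powR12_sqrt// -powRrM; congr (_ `^ _); lra.
have s0 := sqrtr_ge0 y; have ys : y = Num.sqrt y ^+ 2 by rewrite sqr_sqrtr.
rewrite e {1}ys; move: (Num.sqrt y) s0 => s s0.
have [xs|sx] := leP x s.
  have : x * s ^+ 2 <= s * s ^+ 2 by rewrite ler_wpM2r ?sqr_ge0.
  by have := exprn_ge0 3 x0; rewrite -exprS; lra.
have : x * s ^+ 2 <= x * x ^+ 2 by rewrite ler_wpM2l// lerXn2r ?nnegrE// ltW.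
by have := exprn_ge0 3 s0; rewrite -exprS; lra.
Qed.

End power_inequalities.

Section nonneg_expectation.
Context (R : realType) (d : measure_display) (Omega : measurableType d)
  (P : probability Omega R).
Implicit Types f g : Omega -> R.

Definition Ex f : \bar R := (\int[P]_o (f o)%:E)%E.

Lemma Ex_ge0 f : (forall o, 0 <= f o) -> (0 <= Ex f)%E.
Proof. by move=> f0; apply: integral_ge0 => o _; rewrite lee_fin. Qed.

Lemma Ex_le f g : measurable_fun setT f -> measurable_fun setT g ->
  (forall o, 0 <= f o) -> (forall o, f o <= g o) -> (Ex f <= Ex g)%E.
Proof.
move=> mf mg f0 fg; apply: ge0_le_integral => //.
- by move=> o _; rewrite lee_fin.
- exact/measurable_EFinP.
- exact/measurable_EFinP.
- by move=> o _; rewrite lee_fin.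
Qed.

Lemma ExD f g : measurable_fun setT f -> measurable_fun setT g ->
  (forall o, 0 <= f o) -> (forall o, 0 <= g o) ->
  Ex (fun o => f o + g o) = (Ex f + Ex g)%E.
Proof.
move=> mf mg f0 g0; rewrite /Ex -ge0_integralD//.
- by move=> o _; rewrite lee_fin.
- exact/measurable_EFinP.
- by move=> o _; rewrite lee_fin.
- exact/measurable_EFinP.
Qed.

Lemma ExZ c f : 0 <= c -> measurable_fun setT f -> (forall o, 0 <= f o) ->
  Ex (fun o => c * f o) = (c%:E * Ex f)%E.
Proof.
move=> c0 mf f0; rewrite /Ex -ge0_integralZl_EFin//.
- by move=> o _; rewrite lee_fin.
- exact/measurable_EFinP.
Qed.

Lemma Ex_cst c : Ex (fun=> c) = c%:E.
Proof.
transitivity (c%:E * P setT)%E; first exact: (integral_cst P measurableT).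
by rewrite probability_setT mule1.
Qed.

Lemma Ex_sum (n : nat) (f : nat -> Omega -> R) :
  (forall i, measurable_fun setT (f i)) -> (forall i o, 0 <= f i o) ->
  Ex (fun o => \sum_(i < n) f i o) = (\sum_(i < n) Ex (f i))%E.
Proof.
move=> mf f0; elim: n => [|n IH].
  rewrite big_ord0; transitivity (Ex (fun=> 0)); last exact: Ex_cst.
  by congr Ex; apply/funext => o; rewrite big_ord0.
rewrite big_ord_recr /= -IH -ExD//.
- by congr Ex; apply/funext => o; rewrite big_ord_recr.
- exact: measurable_sum.
- by move=> o; apply: sumr_ge0.
Qed.

Lemma measurable_gt f (t : R) : measurable_fun setT f -> measurable [set o | t < f o].
Proof.
move=> mf; rewrite (_ : [set o | t < f o] = f @^-1` `]t, +oo[).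
  by rewrite -[X in measurable X]setTI; apply: mf.
by apply/seteqP; split=> o /=; rewrite in_itv/= andbT.
Qed.

Lemma markov_bound f (t D : R) : measurable_fun setT f -> (forall o, 0 <= f o) -> 0 < t ->
  (Ex f <= D%:E)%E -> (P [set o | (t < f o)%R] <= (D / t)%:E)%E.
Proof.
move=> mf f0 t0 fD; set A := [set o | t < f o].
have mA : measurable A := measurable_gt t mf.
rewrite EFinM lee_pdivlMr//; apply: le_trans fD.
apply: (@le_trans _ _ (\int[P]_(o in A) (f o)%:E)%E).
  rewrite muleC; have <- := integral_cst P mA t%:E.
  apply: ge0_le_integral => //.
  - by move=> o _; rewrite lee_fin ltW.
  - by apply/measurable_EFinP; apply: (measurable_funS measurableT).
  - by move=> o Ao; rewrite lee_fin ltW.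
apply: ge0_subset_integral => //.
  exact/measurable_EFinP.
by move=> o _; rewrite lee_fin.
Qed.

Lemma Ex_powR_le_ge0 f (q D : R) : (Ex (fun o => (f o `^ q)%R) <= D%:E)%E -> 0 <= D.
Proof.
by move=> h; rewrite -lee_fin; apply: le_trans h; apply: Ex_ge0 => o; exact: powR_ge0.
Qed.

Lemma measurable_powR_fun f (q : R) : measurable_fun setT f -> measurable_fun setT (fun o => f o `^ q).
Proof. by move=> mf; exact: (measurableT_comp (measurable_powR q)). Qed.

(** The affine bound is a convex combination of [A] and 1, so a moment bound below one at order [p]
    stays below one at every smaller positive order. *)
Lemma Ex_powR_interpolate f (p r A : R) : measurable_fun setT f -> (forall o, 0 <= f o) ->
  0 < r -> r <= p -> (Ex (fun o => (f o `^ p)%R) <= A%:E)%E ->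
  (Ex (fun o => (f o `^ r)%R) <= (r / p * A + (1 - r / p))%:E)%E.
Proof.
move=> mf f0 r0 rp hA; have p0 : 0 < p by lra.
have c0 : 0 < r / p by rewrite divr_gt0.
have c1 : r / p <= 1 by rewrite ler_pdivrMr// mul1r.
have mp := measurable_powR_fun p mf.
have mc : measurable_fun setT (fun o => r / p * f o `^ p) by exact: measurable_funM.
apply: (@le_trans _ _ (Ex (fun o => r / p * f o `^ p + (1 - r / p)))).
  apply: Ex_le => //; [exact: measurable_powR_fun|exact: measurable_funD| |].
    by move=> o; exact: powR_ge0.
  move=> o; have := powR_le_affine c0 c1 (powR_ge0 (f o) p).
  by rewrite -powRrM (_ : p * (r / p) = r)//; field; rewrite gt_eqF.
rewrite (ExD mc) //; last 2 first.
- by move=> o; rewrite mulr_ge0 ?powR_ge0// ltW.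
- by move=> o; rewrite subr_ge0.
rewrite (ExZ (ltW c0) mp); last by move=> o; exact: powR_ge0.
rewrite Ex_cst [leRHS]EFinD; apply: leeD => //; rewrite (EFinM (r / p) A).
by apply: lee_wpmul2l => //; rewrite lee_fin ltW.
Qed.

End nonneg_expectation.
Arguments Ex {R d Omega} P f.

Lemma norm_sub_powR_le (R : realType) (q x y : R) : 0 <= q -> 0 <= x -> 0 <= y ->
  `|x - y| `^ q <= x `^ q + y `^ q.
Proof.
move=> q0 x0 y0; have [xy|yx] := leP y x.
  rewrite ger0_norm ?subr_ge0//.
  apply: (@le_trans _ _ (x `^ q)); last by rewrite lerDl powR_ge0.
  by apply: le_powR => //; [rewrite subr_ge0|lra].
rewrite ltr0_norm ?subr_lt0// opprB.
apply: (@le_trans _ _ (y `^ q)); last by rewrite lerDr powR_ge0.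
by apply: le_powR => //; [rewrite subr_ge0 ltW|lra].
Qed.

(** * Borel-Cantelli along powers of two *)

Section borel_cantelli_dyadic.
Context (R : realType) (d : measure_display) (Omega : measurableType d)
  (P : probability Omega R).

Lemma borel_cantelli_geometric (E : nat -> set Omega) (C r : R) :
  (forall k, measurable (E k)) -> 0 <= C -> 0 <= r -> r < 1 ->
  (forall k, (P (E k) <= (C * r ^+ k)%:E)%E) ->
  {ae P, forall o, exists k0, forall k, (k0 <= k)%N -> ~ E k o}.
Proof.
move=> mE C0 r0 r1 hE.
have r1' : 0 < 1 - r by rewrite subr_gt0.
have sumE : (\sum_(0 <= k <oo) P (E k) < +oo)%E.
  apply: (@le_lt_trans _ _ (C / (1 - r))%:E); last by rewrite ltry.
  apply: lime_le; first by apply: is_cvg_nneseries => k _ _; exact: measure_ge0.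
  apply: nearW => n.
  apply: (@le_trans _ _ (\sum_(0 <= k < n) (C * r ^+ k)%:E)%E).
    by apply: lee_sum => k _.
  rewrite sumEFin lee_fin big_mkord.
  elim: n C C0 {hE} => [|n IH] C C0.
    by rewrite big_ord0 divr_ge0 ?(ltW r1').
  rewrite big_ord_recl expr0 mulr1.
  have := IH (C * r) (mulr_ge0 C0 r0).
  under eq_bigr do rewrite -mulrA -exprS.
  have -> : C / (1 - r) = C + C * r / (1 - r) by field; rewrite gt_eqF.
  by rewrite lerD2l.
have h0 := lim_sup_set_cvg0 mE sumE.
exists (lim_sup_set E); split=> //.
  apply: bigcapT_measurable => n; apply: bigcup_measurable => k _; exact: mE.
move=> o /= nh n _; apply: contrapT => hn; apply: nh; exists n => k nk Ek.
by apply: hn; exists k.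
Qed.

(** For fixed [k] the bad events increase with [K], so their union over all truncation levels obeys
    the same bound and Borel-Cantelli applies to the unions. Monotonicity in [n] fills the gaps
    between powers of two. *)
Lemma eventually_dyadic (S : nat -> nat -> Omega -> R) (y : nat -> R) (C r : R) :
  (forall K n, measurable_fun setT (S K n)) ->
  (forall K n o, S K n o <= S K.+1 n o) ->
  (forall K n o, S K n o <= S K n.+1 o) ->
  0 <= C -> 0 <= r -> r < 1 ->
  (forall K k, (P [set o | (y k < S K (2 ^ k)%N o)%R] <= (C * r ^+ k)%:E)%E) ->
  {ae P, forall o, exists k0, forall k, (k0 <= k)%N ->
     forall K n, (n <= 2 ^ k)%N -> S K n o <= y k}.
Proof.
move=> mS SK Sn C0 r0 r1 hP.
pose E k := \bigcup_K [set o | (y k < S K (2 ^ k)%N o)%R].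
have mEK k K : measurable [set o | (y k < S K (2 ^ k)%N o)%R].
  rewrite (_ : [set o | _] = S K (2 ^ k)%N @^-1` `]y k, +oo[).
    by rewrite -[X in measurable X]setTI; apply: mS.
  by apply/seteqP; split=> o /=; rewrite in_itv/= andbT.
have mE k : measurable (E k) by apply: bigcup_measurable.
have hE k : (P (E k) <= (C * r ^+ k)%:E)%E.
  have nd : nondecreasing_seq (fun K => [set o | (y k < S K (2 ^ k)%N o)%R]).
    apply/nondecreasing_seqP => K; apply/subsetPset => o /= h.
    exact: lt_le_trans (SK _ _ _).
  have := nondecreasing_cvg_mu (mu := P) (mEK k) (mE k) nd.
  move=> /cvg_lim <- //; apply: lime_le.
    apply: ereal_nondecreasing_is_cvgn => i j ij; apply: le_measure; rewrite ?inE//.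
    by apply/subsetPset; exact: nd.
  by apply: nearW => K; exact: hP.
apply: filterS (borel_cantelli_geometric mE C0 r0 r1 hE) => o [k0 hk0].
exists k0 => k k0k K n nk.
have h2 : S K (2 ^ k)%N o <= y k.
  rewrite leNgt; apply/negP => h; apply: (hk0 k k0k); by exists K.
apply: le_trans h2.
have /nondecreasing_seqP nd : forall m, S K m o <= S K m.+1 o by move=> m; exact: Sn.
exact: nd.
Qed.

End borel_cantelli_dyadic.

Lemma dyadic_bracket (n : nat) : (0 < n)%N ->
  exists k, (n <= 2 ^ k < 2 * n)%N.
Proof.
elim: n => // n IH _; have [->|n0] := posnP n; first by exists 0%N.
have [k /andP[h1 h2]] := IH n0.
have [h|h] := ltnP n (2 ^ k).
  by exists k; rewrite h /=; lia.
exists k.+1; rewrite expnS; lia.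
Qed.

(** * Probability of ever crossing a site *)

Section escape_probability.
Variables (R : realType) (w : int -> R).
Hypothesis w01 : forall y, 0 < w y <= 1.

(** The quenched probability that the walk from [x] ever reaches [x + 1]. *)
Definition success x : R := limn (fun K => \sum_(k < K) step_pmf w x k).

Let w01' y : 0 <= w y <= 1.
Proof. by have /andP[w0 ->] := w01 y; rewrite ltW. Qed.

Let p_ge0 x k : 0 <= step_pmf w x k.
Proof. exact: hit_pmf_ge0. Qed.

Let sum_le1 x K : \sum_(k < K) step_pmf w x k <= 1.
Proof.
have := trunc_mom0_le1 w01 K x; rewrite /trunc_mom.
by under eq_bigr do rewrite expr0 mul1r.
Qed.

Lemma success_cvg x : (fun K => \sum_(k < K) step_pmf w x k) @ \oo --> success x.
Proof. exact: cvg_nondecreasing_bounded (sum_le1 x). Qed.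

Lemma success_le1 x : success x <= 1.
Proof.
have h := @success_cvg x; apply: (ler_cvg_to h (cvg_cst _)).
by apply: nearW => K; exact: sum_le1.
Qed.

Lemma success_ge0 x : 0 <= success x.
Proof.
have h := @success_cvg x; apply: (ler_cvg_to (cvg_cst _) h).
by apply: nearW => K; exact: sumr_ge0.
Qed.

Lemma success_recr x :
  success x = w x + (1 - w x) * (success (x - 1) * success x).
Proof.
have h1 : (fun K => \sum_(k < K.+2) step_pmf w x k) @ \oo --> success x.
  have h := @success_cvg x.
  rewrite -(cvg_shiftn 2) in h.
  by apply: eq_cvgn h => K; rewrite /= addn2.
have h2 : (fun K => w x + (1 - w x) *
   \sum_(k < K.+1) conv (step_pmf w (x - 1)) (step_pmf w x) k) @ \oo -->
   w x + (1 - w x) * (success (x - 1) * success x).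
  apply: cvgnD; first exact: cvgn_cst.
  apply: cvgnM; first exact: cvgn_cst.
  have h := cvg_conv (p_ge0 (x - 1)) (p_ge0 x) (@success_cvg _) (@success_cvg _).
  by rewrite -cvg_shiftS in h.
have h3 : (fun K => \sum_(k < K.+2) step_pmf w x k) @ \oo -->
    w x + (1 - w x) * (success (x - 1) * success x).
  apply: eq_cvgn h2 => K; rewrite [RHS]big_ord_recl step_pmf0 add0r.
  under [RHS]eq_bigr => k _ do rewrite /= /bump /= add1n step_pmfS.
  rewrite [RHS]big_split /= -!mulr_sumr; congr (_ + _).
  by rewrite big_ord_recl /= big1 ?addr0 ?mulr1.
exact: (cvg_unique (@norm_hausdorff _ R) h1 h3).
Qed.

(** The first-step equation rearranges to [w x * (1 - success x) = (1 - w x) * success x * (1 -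
    success (x - 1))], and the middle factor is at most one. Iterated, this bounds the failure
    probability by products of odds of any length. *)
Lemma failure_recr x : 1 - success x <= odds w x * (1 - success (x - 1)).
Proof.
have /andP[w0 w1] := w01 x.
have oE : w x * odds w x = 1 - w x by rewrite mulrC divfK ?gt_eqF.
rewrite -(ler_pM2l w0) mulrA oE.
have u0 := success_ge0 x; have u1 := success_le1 x.
have v1 := success_le1 (x - 1); have e := success_recr x.
have ww : 0 <= 1 - w x by rewrite subr_ge0.
have e1 : w x * (1 - success x) = (1 - w x) * (success x * (1 - success (x - 1))).
  have : success x - (w x + (1 - w x) * (success (x - 1) * success x)) = 0 by rewrite -e subrr.
  lra.
rewrite e1; apply: ler_wpM2l => //.
by rewrite ler_piMl// subr_ge0.
Qed.

Fixpoint odds_prod J x : R := if J is J'.+1 then odds w x * odds_prod J' (x - 1) else 1.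

Lemma failure_le_odds_prod J x : 1 - success x <= odds_prod J x.
Proof.
elim: J x => [|J IH] x /=; first by rewrite lerBlDr lerDl success_ge0.
apply: le_trans (failure_recr x) _; apply: ler_wpM2l => //.
exact: odds_ge0.
Qed.

End escape_probability.

(** * Independence of a site from its past, and moments along the environment *)

Section environment.
Context (R : realType) (d : measure_display) (Omega : measurableType d)
  (P : probability Omega R) (xi : int -> Omega -> R).
Hypothesis xi01 : forall x o, 0 < xi x o <= 1.
Hypothesis mxi : forall x, measurable_fun setT (xi x).
Hypothesis xi_indep : forall (s : seq int) (B : int -> set R), uniq s ->
  (forall i, measurable (B i)) ->
  P (\bigcap_(i in [set` s]) (xi i @^-1` B i)) =
  (\big[*%E/1%E]_(i <- s) P (xi i @^-1` B i))%E.
Hypothesis xi_ident : forall (i : int) (B : set R), measurable B ->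
  P (xi i @^-1` B) = P (xi 0 @^-1` B).
Implicit Types (x y : int) (a b f : R -> R) (h : Omega -> R).

(** Finite cylinders over sites left of [x]. They are closed under intersection, so finite measures
    that agree on them agree on the sigma-algebra they generate. *)
Definition past_cylinder x : set (set Omega) :=
  [set A | exists s : seq int, exists B : int -> set R,
    [/\ uniq s, forall i, i \in s -> i < x, forall i, measurable (B i) &
     A = \bigcap_(i in [set` s]) (xi i @^-1` B i)]].

(* [h] is measurable with respect to the environment strictly to the left of
   [x]. *)
Definition adapted x (h : Omega -> R) : Prop :=
  @measurable_fun _ _ (g_sigma_algebraType (past_cylinder x)) R setT h.

Let mpre x (B : set R) : measurable B -> measurable (xi x @^-1` B).
Proof. by move=> mB; rewrite -[X in measurable X]setTI; exact: mxi. Qed.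

Lemma past_cylinder_measurable x : past_cylinder x `<=` measurable.
Proof.
move=> _ [s [B [us sx mB ->]]].
by apply: fin_bigcap_measurable => // i _; exact: mpre.
Qed.

Lemma past_measurable x : <<s past_cylinder x >> `<=` measurable.
Proof.
apply: smallest_sub; last exact: past_cylinder_measurable.
exact: sigma_algebra_measurable.
Qed.

Lemma adapted_measurable x h : adapted x h -> measurable_fun setT h.
Proof. by move=> ah _ B mB; apply: past_measurable (ah _ B mB). Qed.

Lemma adapted_le x y h : x <= y -> adapted x h -> adapted y h.
Proof.
move=> xy ah _ B mB; have := ah measurableT B mB.
apply: sub_sigma_algebra2 => A [s [C [us sx mC AE]]]; exists s, C; split=> // i /sx ix.
exact: lt_le_trans xy.
Qed.

Lemma adapted_xi x y : y < x -> adapted x (xi y).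
Proof.
move=> yx _ B mB; rewrite setTI; apply: sub_gen_smallest.
exists [:: y], (fun=> B); split=> //.
  by move=> i; rewrite inE => /eqP ->.
rewrite (_ : [set` [:: y]] = [set y]) ?bigcap_set1//.
by apply/seteqP; split=> i /=; rewrite inE => /eqP.
Qed.

Lemma past_cylinder_setI x : setI_closed (past_cylinder x).
Proof.
move=> _ _ [s [B [us sx mB ->]]] [t [C [ut tx mC ->]]].
exists (undup (s ++ t)), (fun i => (if i \in s then B i else setT)
   `&` (if i \in t then C i else setT)); split.
- exact: undup_uniq.
- by move=> i; rewrite mem_undup mem_cat => /orP[/sx|/tx].
- by move=> i; apply: measurableI; case: ifP.
- apply/seteqP; split=> o /=.
    by move=> [h1 h2] i /=; rewrite mem_undup mem_cat => _; split;
      case: ifP => // ii; [exact: h1|exact: h2].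
  move=> h; split=> i /= ii; have := h i; rewrite /= mem_undup mem_cat ii ?orbT.
    by case/(_ isT).
  by case/(_ isT).
Qed.

(** Both sides are finite measures in [E]. They agree on past cylinders by independence of finitely
    many sites, and uniqueness of measures extends this to the whole past. *)
Lemma past_indep x (A : set R) (E : set Omega) : measurable A ->
  <<s past_cylinder x >> E ->
  P (xi x @^-1` A `&` E) = (P (xi x @^-1` A) * P E)%E.
Proof.
move=> mA sE.
have mxA := mpre x mA.
have PA0 : 0 <= fine (P (xi x @^-1` A)) by rewrite fine_ge0.
pose m1 : {measure set Omega -> \bar R} := mrestr P mxA.
pose m2 : {measure set Omega -> \bar R} := mscale (NngNum PA0) P.
have m1E C : m1 C = P (C `&` xi x @^-1` A) by [].
have m2E C : m2 C = (P (xi x @^-1` A) * P C)%E.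
  rewrite -[P (xi x @^-1` A)]fineK ?fin_num_measure//.
have cT : past_cylinder x setT.
  exists [::], (fun=> setT); split=> //.
  by apply/seteqP; split=> // o _ i.
have agree C : past_cylinder x C -> m1 C = m2 C.
    move=> [s [B [us sx mB ->]]].
    have xs : x \notin s by apply/negP => /sx; rewrite ltxx.
    (* Since [x] is not among the past sites, the condition at [x] can be merged into the family,
       and independence is used for the list [x :: s]. *)
    pose B' i := if i == x then A else B i.
    have B'B : \bigcap_(i in [set` s]) xi i @^-1` B i = \bigcap_(i in [set` s]) xi i @^-1` B' i.
      apply: eq_bigcapr => i /= ii; rewrite /B'; case: eqP => // ix.
      by rewrite -ix ii in xs.
    rewrite m1E m2E setIC B'B (xi_indep us); last by move=> i; rewrite /B'; case: ifP.
    have -> : xi x @^-1` A `&` \bigcap_(i in [set` s]) xi i @^-1` B' i =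
       \bigcap_(i in [set` x :: s]) xi i @^-1` B' i.
      apply/seteqP; split=> o.
        move=> [h1 h2] i /=; rewrite inE => /orP[/eqP ->|]; last exact: h2.
        by rewrite /B' eqxx.
      move=> h; split; last by move=> i /= ii; apply: h; rewrite /= inE ii orbT.
      by have := h x; rewrite /= inE eqxx /B' eqxx; exact.
    rewrite xi_indep/= ?xs//; last by move=> i; rewrite /B'; case: ifP.
    by rewrite big_cons {1}/B' eqxx.
have m1oo (k : nat) : (m1 ((fun=> setT) k) < +oo)%E.
  by rewrite m1E setTI ltey_eq fin_num_measure.
have : m1 E = m2 E.
  apply: (@g_sigma_algebra_measure_unique _ _ _ (past_cylinder x)
    (@past_cylinder_measurable x) (fun=> setT) (fun=> cT) _ m1 m2
    (@past_cylinder_setI x) agree m1oo) => //.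
  by apply/seteqP; split=> // o _; exists 0%N.
by rewrite m1E m2E setIC.
Qed.

Lemma integral_site_past x (f : R -> R) (h : Omega -> R) :
  measurable_fun setT f -> adapted x h ->
  (forall o, 0 <= f (xi x o)) -> (forall o, 0 <= h o) ->
  (\int[P]_o (f (xi x o) * h o)%:E =
   (\int[P]_o (f (xi x o))%:E) * (\int[P]_o (h o)%:E))%E.
Proof.
move=> mf ah f0 h0.
apply: (@integral_mul_indep R _ _ P (fun o => f (xi x o)) h) => //.
- exact: measurableT_comp.
- exact: adapted_measurable ah.
- move=> A B mA mB.
  rewrite (_ : (fun o => f (xi x o)) @^-1` A = xi x @^-1` (f @^-1` A))//.
  apply: past_indep; first by rewrite -[X in measurable X]setTI; exact: mf.
  by have := ah measurableT B mB; rewrite setTI.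
Qed.

Lemma integral_site_ident x (f : R -> R) : measurable_fun setT f ->
  (forall y o, 0 <= f (xi y o)) ->
  (\int[P]_o (f (xi x o))%:E = \int[P]_o (f (xi 0 o))%:E)%E.
Proof.
move=> mf f0.
pose X y : {mfun Omega >-> R} :=
  HB.pack (xi y) (isMeasurableFun.Build _ _ _ _ (xi y) (@mxi y)).
have h y : (\int[P]_o (f (xi y o))%:E = \int[distribution P (X y)]_z `|f z|%:E)%E.
  rewrite ge0_integral_distribution//.
    by apply: eq_integral => o _; rewrite /= ger0_norm.
  by apply/measurable_EFinP; exact: measurableT_comp.
rewrite !h; apply: eq_measure_integral => A mA _.
exact: xi_ident.
Qed.

Lemma Ex_site_past x f h : measurable_fun setT f -> (forall y o, 0 <= f (xi y o)) ->
  adapted x h -> (forall o, 0 <= h o) ->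
  Ex P (fun o => f (xi x o) * h o) = (Ex P (fun o => f (xi 0 o)) * Ex P h)%E.
Proof.
move=> mf f0 ah h0.
by rewrite /Ex (integral_site_past) // (integral_site_ident).
Qed.

Lemma measurable_site x f : measurable_fun setT f -> measurable_fun setT (fun o => f (xi x o)).
Proof. by move=> mf; exact: measurableT_comp. Qed.

Lemma adapted_powR x h (q : R) : adapted x h -> adapted x (fun o => h o `^ q).
Proof. by move=> mh; exact: (measurableT_comp (measurable_powR q)). Qed.

Lemma Ex_site_past_le x f h (q A D : R) : measurable_fun setT f -> (forall y o, 0 <= f (xi y o)) ->
  adapted x h -> (forall o, 0 <= h o) -> 0 <= A ->
  (Ex P (fun o => (f (xi 0 o) `^ q)%R) <= A%:E)%E -> (Ex P (fun o => (h o `^ q)%R) <= D%:E)%E ->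
  (Ex P (fun o => ((f (xi x o) * h o) `^ q)%R) <= (A * D)%:E)%E.
Proof.
move=> mf f0 ah h0 A0 fA hD.
have -> : Ex P (fun o => (f (xi x o) * h o) `^ q) =
    (Ex P (fun o => (f (xi 0 o) `^ q)%R) * Ex P (fun o => (h o `^ q)%R))%E.
  transitivity (Ex P (fun o => f (xi x o) `^ q * h o `^ q)).
    by congr Ex; apply/funext => o; rewrite powRM.
  apply: (@Ex_site_past x (fun t => f t `^ q)).
  - exact: measurable_powR_fun.
  - by move=> y o; exact: powR_ge0.
  - exact: adapted_powR.
  - by move=> o; exact: powR_ge0.
rewrite EFinM; apply: lee_pmul => //; apply: Ex_ge0 => o; exact: powR_ge0.
Qed.

Definition bounded_moments (q : R) (V : nat -> int -> Omega -> R) :=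
  exists D : R, forall K x, (Ex P (fun o => (V K x o `^ q)%R) <= D%:E)%E.

Definition nonneg_adapted (V : nat -> int -> Omega -> R) :=
  forall K x, adapted (x + 1) (V K x) /\ forall o, 0 <= V K x o.

(** The coefficients read site [x] only and are thus independent of the processes at [x - 1]. The
    truncation level drops by one, which permits an induction on [K] over all sites at once. *)
Definition recursion_bound a b (U V : nat -> int -> Omega -> R) :=
  forall K x o, V K.+1 x o <= a (xi x o) * V K (x - 1) o + b (xi x o) * U K (x - 1) o.

(** If the moments at level [K] are at most [D], those at level [K.+1] are at most [A' * D + C],
    where [A' = (1 + e) ^ q * A] is still below one. A bound stable under this affine map holds for
    every [K] and [x]. *)
Lemma moment_recursion (q A B : R) a b U V : 0 < q ->
  measurable_fun setT a -> (forall x o, 0 <= a (xi x o)) ->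
  measurable_fun setT b -> (forall x o, 0 <= b (xi x o)) ->
  0 <= A -> A < 1 -> (Ex P (fun o => (a (xi 0 o) `^ q)%R) <= A%:E)%E ->
  0 <= B -> (Ex P (fun o => (b (xi 0 o) `^ q)%R) <= B%:E)%E ->
  nonneg_adapted U -> bounded_moments q U ->
  nonneg_adapted V -> (forall x o, V 0%N x o <= 1) ->
  recursion_bound a b U V -> bounded_moments q V.
Proof.
move=> q0 ma a0 mb b0 A0 A1 aA B0 bB aU [DU hU] aV V1 rec.
have [e e0 eA] := exists_small_power q0 A0 A1.
set A' := _ * A in eA.
have A'0 : 0 <= A' by rewrite mulr_ge0 ?powR_ge0.
have DU0 : 0 <= DU := Ex_powR_le_ge0 (hU 0%N 0).
set C := (1 + e^-1) `^ q * (B * DU).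
have C0 : 0 <= C by rewrite !mulr_ge0 ?powR_ge0.
(* The fixed point of [D |-> A' * D + C], raised by 1 to cover the initial level. *)
exists (1 + C / (1 - A')); set D := _ + _.
have A'1 : 0 < 1 - A' by rewrite subr_gt0.
have DE : A' * D + C <= D.
  have : (1 - A') * D = (1 - A') + C by rewrite /D; field; rewrite gt_eqF.
  lra.
have D1 : 1 <= D by rewrite lerDl divr_ge0// ltW.
have mh K x (W : nat -> int -> Omega -> R) : nonneg_adapted W -> measurable_fun setT (W K x).
  by move=> /(_ K x)[aW _]; exact: (adapted_measurable aW).
have ax K x (W : nat -> int -> Omega -> R) : nonneg_adapted W -> adapted x (W K (x - 1)).
  by move=> /(_ K (x - 1))[aW _]; rewrite subrK in aW.
elim=> [|K IH] x.
  apply: (@le_trans _ _ (Ex P (fun=> 1))); last by rewrite Ex_cst lee_fin.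
  apply: Ex_le => //.
  - by apply: measurable_powR_fun; exact: mh.
  - by move=> o; exact: powR_ge0.
  - move=> o; have <- : 1 `^ q = 1 :> R by rewrite powR1.
    apply: le_powR => //; first exact: ltW.
    by have [_] := aV 0%N x.
have [_ V0'] := aV K.+1 x; have [_ V0] := aV K (x - 1); have [_ U0] := aU K (x - 1).
pose f1 o := (a (xi x o) * V K (x - 1) o) `^ q.
pose f2 o := (b (xi x o) * U K (x - 1) o) `^ q.
have mf1 : measurable_fun setT f1.
  by apply: measurable_powR_fun; apply: measurable_funM; [exact: measurable_site|exact: mh].
have mf2 : measurable_fun setT f2.
  by apply: measurable_powR_fun; apply: measurable_funM; [exact: measurable_site|exact: mh].
apply: (@le_trans _ _ (Ex P (fun o => (1 + e) `^ q * f1 o + (1 + e^-1) `^ q * f2 o))).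
  apply: Ex_le.
  - by apply: measurable_powR_fun; exact: mh.
  - by apply: measurable_funD; apply: measurable_funM.
  - by move=> o; exact: powR_ge0.
  move=> o; apply: le_trans (powR_add_le q0 e0 _ _); [|by rewrite mulr_ge0..].
  by apply: le_powR; [exact: ltW|exact: V0'|exact: rec].
rewrite ExD; [|exact: measurable_funM|exact: measurable_funM|by move=> o; rewrite mulr_ge0 ?powR_ge0..].
rewrite !ExZ ?powR_ge0//; [|by move=> o; exact: powR_ge0..].
have h1 : (Ex P f1 <= (A * D)%:E)%E.
  by apply: Ex_site_past_le => //; exact: ax.
have h2 : (Ex P f2 <= (B * DU)%:E)%E.
  by apply: Ex_site_past_le => //; exact: ax.
apply: (@le_trans _ _ (((1 + e) `^ q)%:E * (A * D)%:E + ((1 + e^-1) `^ q)%:E * (B * DU)%:E)%E).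
  by apply: leeD; apply: lee_wpmul2l => //; rewrite lee_fin powR_ge0.
by rewrite -!EFinM -EFinD lee_fin mulrA.
Qed.

(** * The von Bahr-Esseen bound for centred sums *)

Section martingale_bound.
Variables (q : R) (al : R -> R) (be A D : R) (U : nat -> Omega -> R).
Hypothesis q1 : 1 < q.
Hypothesis q2 : q <= 2.
Hypothesis mal : measurable_fun setT al.
Hypothesis al0 : forall x o, 0 <= al (xi x o).
Hypothesis al_mean : Ex P (fun o => al (xi 0 o)) = be%:E.
Hypothesis al_mom : (Ex P (fun o => (al (xi 0%Z o) `^ q)%R) <= A%:E)%E.
Hypothesis aU : forall n : nat, adapted n%:Z (U n).
Hypothesis U0 : forall n o, 0 <= U n o.
Hypothesis U_mom : forall n, (Ex P (fun o => (U n o `^ q)%R) <= D%:E)%E.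

(** A martingale in [n]: [U i] depends on sites left of [i] only, and [be] is the mean of [al] at a
    site. *)
Definition centered_sum n o : R := \sum_(i < n) (al (xi i%:Z o) - be) * U i o.

Let q0 : 0 < q. Proof. exact: (lt_trans ltr01 q1). Qed.

Let be0 : 0 <= be.
Proof. by rewrite -lee_fin -al_mean; apply: Ex_ge0 => o. Qed.

Let A0 : 0 <= A.
Proof. exact: Ex_powR_le_ge0 al_mom. Qed.

Let D0 : 0 <= D.
Proof. exact: Ex_powR_le_ge0 (U_mom 0). Qed.

Lemma adapted_centered_sum n : adapted n%:Z (centered_sum n).
Proof.
have m (i : 'I_n) : adapted n%:Z (fun o => (al (xi i%:Z o) - be) * U i o).
  have aUi : adapted n%:Z (U i).
    have iN : i%:Z <= n%:Z by have := ltn_ord i; lia.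
    exact (adapted_le iN (@aU i)).
  apply: measurable_funM; last exact: aUi.
  apply: measurable_funB => //.
  have iN : i%:Z < n%:Z by have := ltn_ord i; lia.
  have axi : adapted n%:Z (xi i) := adapted_xi iN.
  exact: (measurableT_comp mal axi).
rewrite /adapted /centered_sum.
by apply: measurable_sum => i; exact: m.
Qed.

Let mU n : measurable_fun setT (U n).
Proof. exact: (adapted_measurable (@aU n)). Qed.

Let mM n : measurable_fun setT (centered_sum n).
Proof. exact: (adapted_measurable (@adapted_centered_sum n)). Qed.

Let mMn n : measurable_fun setT (fun o => `|centered_sum n o|).
Proof. exact: (measurableT_comp (@normr_measurable _ _) (mM n)). Qed.

Let mMq n : measurable_fun setT (fun o => `|centered_sum n o| `^ q).
Proof. exact: measurable_powR_fun (mMn n). Qed.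

Let K : R := 3 * (A + be `^ q) * D.

Let K0 : 0 <= K.
Proof. by rewrite !mulr_ge0// addr_ge0// powR_ge0. Qed.

(** The expectation of [powR_norm_add_le] is summed over the increments; the linear term has mean
    zero because the new site is independent of the past. To keep all integrands nonnegative, that
    term is split into positive and negative parts distributed over the two sides as [L1] and [L2].
    These have equal expectations, which cancel once known to be finite. *)
Lemma centered_sum_moment n :
  (Ex P (fun o => (`|centered_sum n o| `^ q)%R) <= (n%:R * K)%:E)%E.
Proof.
elim: n => [|n IH].
  apply: (@le_trans _ _ (Ex P (fun=> 0))); last by rewrite Ex_cst mul0r.
  apply: Ex_le => //.
  - by move=> o; rewrite /centered_sum big_ord0 normr0 powR0 ?gt_eqF.
pose m := centered_sum n; pose u := U n.
pose a o := dpow q (m o) * u o.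
pose ap o := Num.max (a o) 0; pose an o := Num.max (- a o) 0.
have aapn o : a o = ap o - an o.
  by rewrite /ap /an; case: (leP (a o) 0) => h; case: (leP (- a o) 0) => h'; lra.
have ap0 o : 0 <= ap o by rewrite le_max lexx orbT.
have an0 o : 0 <= an o by rewrite le_max lexx orbT.
(* Measurability is immediate once [dpow] is written as a difference of powers of the positive and
   negative parts. *)
have mdpow : measurable_fun setT (dpow q).
  have -> : dpow q = fun x : R => Num.max x 0 `^ (q - 1) - Num.max (- x) 0 `^ (q - 1).
    have z : 0 `^ (q - 1) = 0 :> R by rewrite powR0// gt_eqF// subr_gt0.
    apply/funext => x; rewrite /dpow; have [x0|x0|->] := ltgtP x 0.
    - have -> : Num.max (- x) 0 = - x by rewrite max_l// oppr_ge0 ltW.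
      by rewrite ltr0_sg// ltr0_norm// z sub0r mulN1r.
    - have -> : Num.max (- x) 0 = 0 by rewrite max_r// oppr_le0 ltW.
      by rewrite gtr0_sg// gtr0_norm// z subr0 mul1r.
    - by rewrite sgr0 mul0r oppr0 maxxx z subrr.
  apply: measurable_funB; apply: measurable_powR_fun; apply: measurable_maxr => //.
have aa : adapted n%:Z a.
  apply: measurable_funM; last exact: aU.
  by apply: (measurableT_comp mdpow); exact: adapted_centered_sum.
have aap : adapted n%:Z ap by apply: measurable_maxr.
have aan : adapted n%:Z an.
  by apply: measurable_maxr => //; exact: measurable_funN.
have map_ := adapted_measurable aap.
have man := adapted_measurable aan.
(* This gives the finiteness needed for the cancellation: the larger of [|m|] and [u] absorbs the
   product [|m| ^ (q - 1) * u]. *)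
have bound o : ap o + an o <= `|m o| `^ q + u o `^ q.
  have -> : ap o + an o = `|a o|.
    rewrite /ap /an; case: (leP (a o) 0) => h; case: (leP (- a o) 0) => h'.
    - by rewrite (_ : a o = 0) ?normr0; lra.
    - by rewrite ler0_norm//; lra.
    - by rewrite gtr0_norm//; lra.
    - lra.
  rewrite /a normrM (ger0_norm (U0 n o)).
  apply: (@le_trans _ _ (`|m o| `^ (q - 1) * u o)).
    by apply: ler_wpM2r => //; exact: norm_dpow.
  have P' (r : R) : 0 <= r -> r `^ (q - 1) * r = r `^ q by move=> r0; rewrite mulrC mulr_powRB1.
  have q10 : 0 <= q - 1 by rewrite subr_ge0 ltW.
  have [h|h] := leP `|m o| (u o).
    apply: (@le_trans _ _ (u o `^ q)); last by rewrite lerDr powR_ge0.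
    rewrite -(P' _ (U0 n o)); apply: ler_wpM2r; first exact: U0.
    exact: (le_powR q10 (normr_ge0 _) h).
  apply: (@le_trans _ _ (`|m o| `^ q)); last by rewrite lerDl powR_ge0.
  rewrite -(P' `|m o|)//; apply: ler_wpM2l; first exact: powR_ge0.
  exact: ltW.
have mmq : measurable_fun setT (fun o => `|m o| `^ q).
  exact: mMq.
have muq : measurable_fun setT (fun o => u o `^ q) := measurable_powR_fun q (mU n).
have finE : (Ex P ap + Ex P an < +oo)%E.
  rewrite -ExD//; apply: (@le_lt_trans _ _ ((n%:R * K)%:E + D%:E)%E); last by rewrite -EFinD ltry.
  apply: (@le_trans _ _ (Ex P (fun o => `|m o| `^ q + u o `^ q))).
    apply: Ex_le => //; first exact: measurable_funD.
      exact: measurable_funD.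
    by move=> o; rewrite addr_ge0.
  rewrite ExD//; first by apply: leeD => //; exact: U_mom.
  by move=> o; exact: powR_ge0.
pose x o := al (xi n%:Z o).
have mx : measurable_fun setT x by apply: measurable_site.
have mq : measurable_fun setT (fun o => `|centered_sum n.+1 o| `^ q).
  exact: mMq.
pose L1 o := be * ap o + x o * an o.
pose L2 o := x o * ap o + be * an o.
pose L3 o := 3 * ((x o `^ q + be `^ q) * u o `^ q).
have L10 o : 0 <= L1 o by rewrite addr_ge0 ?mulr_ge0// /x.
have L20 o : 0 <= L2 o by rewrite addr_ge0 ?mulr_ge0// /x.
have L30 o : 0 <= L3 o by rewrite !mulr_ge0 ?addr_ge0 ?powR_ge0.
have mL1 : measurable_fun setT L1 by apply: measurable_funD; apply: measurable_funM.
have mL2 : measurable_fun setT L2 by apply: measurable_funD; apply: measurable_funM.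
have mL3 : measurable_fun setT L3.
  apply: measurable_funM => //; apply: measurable_funM => //.
  by apply: measurable_funD => //; exact: measurable_powR_fun.
have ineq o : `|centered_sum n.+1 o| `^ q + q * L1 o <= `|m o| `^ q + q * L2 o + L3 o.
  have -> : centered_sum n.+1 o = m o + (x o - be) * u o.
    by rewrite /centered_sum big_ord_recr.
  have := powR_norm_add_le (m o) ((x o - be) * u o) q1 q2.
  have -> : dpow q (m o) * ((x o - be) * u o) = (ap o - an o) * (x o - be).
    by rewrite -aapn /a; ring.
  have : `|(x o - be) * u o| `^ q <= (x o `^ q + be `^ q) * u o `^ q.
    rewrite normrM (ger0_norm (U0 n o)) powRM//; apply: ler_wpM2r; first exact: powR_ge0.
    by apply: norm_sub_powR_le => //; [exact: ltW|exact: al0].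
  by rewrite /L1 /L2 /L3; lra.
have Exa h : adapted n%:Z h -> (forall o, 0 <= h o) ->
    Ex P (fun o => x o * h o) = (be%:E * Ex P h)%E.
  by move=> ah h0; rewrite /x (Ex_site_past)// al_mean.
have EL1 : Ex P L1 = (be%:E * (Ex P ap + Ex P an))%E.
  rewrite ExD//; [|exact: measurable_funM|exact: measurable_funM| | ]; last 2 first.
  - by move=> o; rewrite mulr_ge0.
  - by move=> o; rewrite mulr_ge0// /x.
  by rewrite ExZ// Exa// [RHS](ge0_muleDr _ (Ex_ge0 P ap0) (Ex_ge0 P an0)).
have EL2 : Ex P L2 = (be%:E * (Ex P ap + Ex P an))%E.
  rewrite ExD//; [|exact: measurable_funM|exact: measurable_funM| | ]; last 2 first.
  - by move=> o; rewrite mulr_ge0// /x.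
  - by move=> o; rewrite mulr_ge0.
  by rewrite ExZ// Exa// [RHS](ge0_muleDr _ (Ex_ge0 P ap0) (Ex_ge0 P an0)).
have EL3 : (Ex P L3 <= K%:E)%E.
  rewrite ExZ//; last 2 first.
  - apply: measurable_funM => //; apply: measurable_funD => //; exact: measurable_powR_fun.
  - by move=> o; rewrite mulr_ge0 ?addr_ge0 ?powR_ge0.
  have -> : Ex P (fun o => (x o `^ q + be `^ q) * u o `^ q) =
      (Ex P (fun o => (al (xi 0%Z o) `^ q + be `^ q)%R) * Ex P (fun o => (u o `^ q)%R))%E.
    apply: (Ex_site_past (f := fun t => al t `^ q + be `^ q)).
    - by apply: measurable_funD => //; exact: measurable_powR_fun.
    - by move=> y o; rewrite addr_ge0 ?powR_ge0.
    - by apply: adapted_powR; exact: aU.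
    - by move=> o; exact: powR_ge0.
  rewrite /K -mulrA EFinM; apply: lee_wpmul2l; first by rewrite lee_fin.
  rewrite EFinM; apply: lee_pmul; last exact: U_mom.
  - by apply: Ex_ge0 => o; rewrite addr_ge0 ?powR_ge0.
  - by apply: Ex_ge0 => o; exact: powR_ge0.
  rewrite ExD//.
  - by rewrite Ex_cst EFinD leeD2r.
  - by apply: measurable_powR_fun; exact: measurable_site.
  - by move=> o; exact: powR_ge0.
  - by move=> o; exact: powR_ge0.
have : (Ex P (fun o => (`|centered_sum n.+1 o| `^ q + q * L1 o)%R) <=
        Ex P (fun o => (`|m o| `^ q + q * L2 o + L3 o)%R))%E.
  apply: Ex_le => //.
  - by apply: measurable_funD => //; exact: measurable_funM.
  - by apply: measurable_funD => //; apply: measurable_funD => //; exact: measurable_funM.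
  - by move=> o; rewrite addr_ge0 ?powR_ge0// mulr_ge0// ltW.
have qL1 o : 0 <= q * L1 o by rewrite mulr_ge0// ltW.
have qL2 o : 0 <= q * L2 o by rewrite mulr_ge0// ltW.
have mqL1 : measurable_fun setT (fun o => q * L1 o) by exact: measurable_funM.
have mqL2 : measurable_fun setT (fun o => q * L2 o) by exact: measurable_funM.
have m1 : measurable_fun setT (fun o => `|m o| `^ q + q * L2 o) by apply: measurable_funD.
have m10 o : 0 <= `|m o| `^ q + q * L2 o by rewrite addr_ge0 ?powR_ge0.
rewrite (ExD P (mMq n.+1) mqL1 (fun o => powR_ge0 _ _) qL1).
rewrite (ExD P m1 mL3 m10 L30) (ExD P mmq mqL2 (fun o => powR_ge0 _ _) qL2).
rewrite (ExZ P (ltW q0) mL1 L10) (ExZ P (ltW q0) mL2 L20) EL1 EL2.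
set T := (q%:E * _)%E => h.
have Tfin : T \is a fin_num.
  rewrite ge0_fin_numE; last first.
    apply: mule_ge0; first by rewrite lee_fin ltW.
    by apply: mule_ge0; [rewrite lee_fin|exact: adde_ge0 (Ex_ge0 P ap0) (Ex_ge0 P an0)].
  rewrite /T; move: finE; case: (Ex P ap + Ex P an)%E (adde_ge0 (Ex_ge0 P ap0) (Ex_ge0 P an0)) => //= r _ _.
  by rewrite -!EFinM ltry.
rewrite -(leeD2rE _ _ Tfin); apply: (le_trans h).
rewrite addeAC leeD2rE//.
rewrite -natr1 mulrDl mul1r EFinD.
exact: leeD.
Qed.

Lemma centered_sum_tail t n : 0 < t -> (0 < n)%N ->
  (P [set o | (t * n%:R < `|centered_sum n o|)%R] <= (K / t `^ q * n%:R `^ (1 - q))%:E)%E.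
Proof.
move=> t0 n0; have n0' : 0 < n%:R :> R by rewrite ltr0n.
have tn0 : 0 < t * n%:R by rewrite mulr_gt0.
have mmq := mMq n.
have := @markov_bound _ _ _ P _ ((t * n%:R) `^ q) _ mmq (fun o => powR_ge0 _ _)
  (powR_gt0 q tn0) (centered_sum_moment n).
rewrite powRM ?(ltW t0)//.
have -> : n%:R * K / (t `^ q * n%:R `^ q) = K / t `^ q * n%:R `^ (1 - q).
  rewrite powRB; last by rewrite (gt_eqF n0') implybT.
  rewrite powRr1 ?(ltW n0')//; field.
  by rewrite !gt_eqF ?powR_gt0.
apply: le_trans; apply: le_measure; rewrite ?inE.
- exact: (measurable_gt _ (mMn n)).
- exact: (measurable_gt _ mmq).
move=> o /= h; rewrite -powRM ?(ltW t0)//.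
by apply: gt0_ltr_powR; rewrite ?nnegrE ?(ltW tn0).
Qed.

End martingale_bound.

Lemma prob_cover2 (A B C : set Omega) (a b : R) :
  measurable A -> measurable B -> measurable C -> C `<=` A `|` B ->
  (P A <= a%:E)%E -> (P B <= b%:E)%E -> (P C <= (a + b)%:E)%E.
Proof.
move=> mA mB mC CAB PA PB.
apply: (@le_trans _ _ (P (A `|` B))).
  by apply: le_measure; rewrite ?inE//; exact: measurableU.
apply: le_trans (measureU2 _ mA mB) _.
by rewrite EFinD; exact: leeD.
Qed.

Definition partial_sum (V : nat -> int -> Omega -> R) K n o : R :=
  \sum_(i < n) V K i%:Z o.

(** Linear growth in probability, uniformly in the truncation level; for [q > 1] the error is
    geometric, hence summable, along powers of two. *)
Definition linear_growth (q : R) (V : nat -> int -> Omega -> R) :=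
  exists C c : R, [/\ 0 <= C, 0 <= c & forall K n, (0 < n)%N ->
    (P [set o | (C * n%:R < partial_sum V K n o)%R] <= (c * n%:R `^ (1 - q))%:E)%E].

Lemma measurable_process V K x : nonneg_adapted V -> measurable_fun setT (V K x).
Proof. by move=> /(_ K x)[aV _]; exact: (adapted_measurable aV). Qed.

Lemma measurable_partial_sum V K n : nonneg_adapted V ->
  measurable_fun setT (partial_sum V K n).
Proof. by move=> aV; apply: measurable_sum => i; exact: measurable_process. Qed.

Lemma adapted_shift V K x : nonneg_adapted V -> adapted x (V K (x - 1)).
Proof. by move=> /(_ K (x - 1))[aV _]; rewrite subrK in aV. Qed.

Lemma partial_sum_shift V K n o : nonneg_adapted V ->
  \sum_(i < n) V K (i%:Z - 1) o <= V K (- 1) o + partial_sum V K n o.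
Proof.
move=> aV; have V0 x : 0 <= V K x o by have [_] := aV K x.
case: n => [|n]; first by rewrite /partial_sum !big_ord0 addr0.
rewrite big_ord_recl sub0r lerD2l /partial_sum big_ord_recr /=.
have -> : \sum_(i < n) V K ((lift ord0 i)%:Z - 1) o = \sum_(i < n) V K i%:Z o.
  apply: eq_bigr => i _; congr (V K _ o).
  by rewrite lift0 -addn1 PoszD addrK.
by rewrite lerDl.
Qed.

Lemma linear_growth_cst q : linear_growth q (fun _ _ _ => 1).
Proof.
exists 1, 0; split=> // K n n0; rewrite mul0r.
rewrite (_ : [set o | _] = set0) ?measure0//.
rewrite -subset0 => o /=; rewrite /partial_sum sumr_const card_ord mul1r.
by rewrite ltxx.
Qed.

Lemma linear_growthD q U V : nonneg_adapted U -> nonneg_adapted V ->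
  linear_growth q U -> linear_growth q V ->
  linear_growth q (fun K x o => U K x o + V K x o).
Proof.
move=> aU aV [C [c [C0 c0 hU]]] [C' [c' [C'0 c'0 hV]]].
exists (C + C'), (c + c'); split; [exact: addr_ge0|exact: addr_ge0|].
move=> K n n0; rewrite !mulrDl.
have sE o : partial_sum (fun K x o => U K x o + V K x o) K n o =
  partial_sum U K n o + partial_sum V K n o by exact: big_split.
apply: (prob_cover2 _ _ _ _ (hU K n n0) (hV K n n0)).
- exact/measurable_gt/measurable_partial_sum.
- exact/measurable_gt/measurable_partial_sum.
- apply: measurable_gt; rewrite (_ : partial_sum _ K n =
    (fun o => partial_sum U K n o + partial_sum V K n o)); last exact/funext.
  by apply: measurable_funD; exact: measurable_partial_sum.
move=> o /=; rewrite sE => h.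
have [?|h1] := ltP (C * n%:R) (partial_sum U K n o); first by left.
by right; lra.
Qed.

Lemma linear_growth_single q V x : 1 < q -> nonneg_adapted V ->
  bounded_moments q V -> exists2 c : R, 0 <= c & forall K n, (0 < n)%N ->
  (P [set o | (n%:R < V K x o)%R] <= (c * n%:R `^ (1 - q))%:E)%E.
Proof.
move=> q1 aV [D hD]; have q0 : 0 < q by lra.
have D0 : 0 <= D := Ex_powR_le_ge0 (hD 0%N 0).
exists D => // K n n0; have n0' : (0 : R) < n%:R by rewrite ltr0n.
have mV : measurable_fun setT (V K x) by exact: measurable_process.
have V0 o : 0 <= V K x o by have [_] := aV K x.
have mVq := measurable_powR_fun q mV.
have := @markov_bound _ _ _ P _ (n%:R `^ q) D mVq (fun o => powR_ge0 _ _) (powR_gt0 q n0') (hD K x).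
move=> h.
apply: (@le_trans _ _ (P [set o | (n%:R `^ q < V K x o `^ q)%R])).
  apply: le_measure; rewrite ?inE; [exact: measurable_gt|exact: measurable_gt|].
  by move=> o /= h'; apply: gt0_ltr_powR; rewrite ?nnegrE ?(ltW n0').
apply: (le_trans h); rewrite lee_fin; apply: ler_wpM2l => //.
rewrite -powRN; apply: ler_powR; last by lra.
by rewrite ler1n.
Qed.

Lemma Ex_site_fin (a : R -> R) (q A : R) : 1 < q ->
  measurable_fun setT a -> (forall x o, 0 <= a (xi x o)) ->
  (Ex P (fun o => (a (xi 0%Z o) `^ q)%R) <= A%:E)%E ->
  exists2 al, Ex P (fun o => a (xi 0 o)) = al%:E & 0 <= al /\ al <= q^-1 * A + (1 - q^-1).
Proof.
move=> q1 ma a0 aA; have q0 : 0 < q by lra.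
have Ele : (Ex P (fun o => a (xi 0 o)) <= (q^-1 * A + (1 - q^-1))%:E)%E.
  have := Ex_powR_interpolate (measurable_site 0 ma) (fun o => a0 0 o) ltr01 (ltW q1) aA.
  by rewrite div1r (_ : (fun o => _) = fun o => a (xi 0 o))//; apply/funext => o; rewrite powRr1.
have E0 : (0 <= Ex P (fun o => a (xi 0 o)))%E by exact: Ex_ge0.
have Efin : Ex P (fun o => a (xi 0 o)) \is a fin_num.
  by rewrite ge0_fin_numE// (le_lt_trans Ele)// ltry.
exists (fine (Ex P (fun o => a (xi 0 o)))); first by rewrite fineK.
by split; [rewrite fine_ge0|rewrite -lee_fin fineK].
Qed.

(** The recursion is summed over [i < n] with [a] and [b] replaced by their means [al] and [be]; the
    corrections are centred sums, of size at most [n] outside a small event. Since [al < 1], the sum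
    of [V] on the right is absorbed on the left. Monotonicity in [K] puts both sides at the same
    truncation level. *)
Lemma linear_growth_recursion (q A B : R) (a b : R -> R) (U V : nat -> int -> Omega -> R) :
  1 < q -> q <= 2 ->
  measurable_fun setT a -> (forall x o, 0 <= a (xi x o)) ->
  measurable_fun setT b -> (forall x o, 0 <= b (xi x o)) ->
  A < 1 -> (Ex P (fun o => (a (xi 0%Z o) `^ q)%R) <= A%:E)%E ->
  (Ex P (fun o => (b (xi 0%Z o) `^ q)%R) <= B%:E)%E ->
  nonneg_adapted U -> bounded_moments q U -> linear_growth q U ->
  nonneg_adapted V -> bounded_moments q V ->
  (forall K x o, V K x o <= V K.+1 x o) ->
  recursion_bound a b U V -> linear_growth q V.
Proof.
move=> q1 q2 ma a0 mb b0 A1 aA bB aU [DU hDU] [C [c [C0 c0 hU]]] aV [DV hDV] Vmono rec.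
have q0 : 0 < q by lra.
have [al alE [al0 al_le]] := Ex_site_fin q1 ma a0 aA.
have [be beE [be0 _]] := Ex_site_fin q1 mb b0 bB.
have al1 : al < 1.
  apply: le_lt_trans al_le _.
  have : q^-1 * A < q^-1 * 1 by rewrite ltr_pM2l// invr_gt0.
  lra.
have [cV cV0 hV1] := linear_growth_single (-1) q1 aV (ex_intro _ DV hDV).
have [cU cU0 hU1] := linear_growth_single (-1) q1 aU (ex_intro _ DU hDU).
pose KA := 3 * (A + al `^ q) * DV / 1 `^ q.
pose KB := 3 * (B + be `^ q) * DU / 1 `^ q.
have V0 K x o : 0 <= V K x o by have [_] := aV K x.
have U0 K x o : 0 <= U K x o by have [_] := aU K x.
pose MA K := centered_sum a al (fun i => V K (i%:Z - 1)).
pose MB K := centered_sum b be (fun i => U K (i%:Z - 1)).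
have adV K (i : nat) : adapted i%:Z (V K (i%:Z - 1)) := adapted_shift K aV.
have adU K (i : nat) : adapted i%:Z (U K (i%:Z - 1)) := adapted_shift K aU.
have tA K n := centered_sum_tail q1 q2 ma a0 alE aA
  (adV K) (fun i => V0 K (i%:Z - 1)) (fun i => hDV K (i%:Z - 1)) (n := n) ltr01.
have tB K n := centered_sum_tail q1 q2 mb b0 beE bB
  (adU K) (fun i => U0 K (i%:Z - 1)) (fun i => hDU K (i%:Z - 1)) (n := n) ltr01.
(* The 2 pays for the two centred sums, [al] and [be] for the boundary values at site -1, and
   [be * C] for the sum of [U]. *)
pose L := (2 + al + be + be * C) / (1 - al).
have al1' : 0 < 1 - al by rewrite subr_gt0.
have L0 : 0 <= L by rewrite divr_ge0 ?(ltW al1')// !addr_ge0// mulr_ge0.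
have KA0 : 0 <= KA.
  rewrite /KA powR1 divr1 !mulr_ge0//.
    by rewrite addr_ge0 ?powR_ge0// (Ex_powR_le_ge0 aA).
  exact: Ex_powR_le_ge0 (hDV 0%N 0).
have KB0 : 0 <= KB.
  rewrite /KB powR1 divr1 !mulr_ge0//.
    by rewrite addr_ge0 ?powR_ge0// (Ex_powR_le_ge0 bB).
  exact: Ex_powR_le_ge0 (hDU 0%N 0).
exists L, (KA + (KB + (cV + (cU + c)))); split=> //; first by rewrite !addr_ge0.
move=> K n n0; have n0' : (0 : R) < n%:R by rewrite ltr0n.
rewrite !mulrDl.
have mMA : measurable [set o | (1 * n%:R < `|MA K n o|)%R].
  apply: measurable_gt; apply: (measurableT_comp (@normr_measurable _ _)).
  exact: (adapted_measurable (adapted_centered_sum q1 q2 ma a0 alE aA (adV K)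
    (fun i => hDV K (i%:Z - 1)) (n := n))).
have mMB : measurable [set o | (1 * n%:R < `|MB K n o|)%R].
  apply: measurable_gt; apply: (measurableT_comp (@normr_measurable _ _)).
  exact: (adapted_measurable (adapted_centered_sum q1 q2 mb b0 beE bB (adU K)
    (fun i => hDU K (i%:Z - 1)) (n := n))).
have mV1 : measurable [set o | (n%:R < V K (-1) o)%R] by exact/measurable_gt/measurable_process.
have mU1 : measurable [set o | (n%:R < U K (-1) o)%R] by exact/measurable_gt/measurable_process.
have mUs : measurable [set o | (C * n%:R < partial_sum U K n o)%R].
  exact/measurable_gt/measurable_partial_sum.
have mVs : measurable [set o | (L * n%:R < partial_sum V K n o)%R].
  exact/measurable_gt/measurable_partial_sum.
have m3 := measurableU _ _ mU1 mUs.
have m2 := measurableU _ _ mV1 m3.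
have m1 := measurableU _ _ mMB m2.
apply: (prob_cover2 mMA m1 mVs _ (tA K n n0)); last first.
  apply: (prob_cover2 mMB m2 m1 _ (tB K n n0)) => //.
  apply: (prob_cover2 mV1 m3 m2 _ (hV1 K n n0)) => //.
  exact: (prob_cover2 mU1 mUs m3 _ (hU1 K n n0) (hU K n n0)).
move=> o /= hL.
have [?|hA] := ltP (1 * n%:R) `|MA K n o|; first by left.
right; have [?|hB] := ltP (1 * n%:R) `|MB K n o|; first by left.
right; have [?|hV] := ltP n%:R (V K (-1) o); first by left.
right; have [?|hU'] := ltP n%:R (U K (-1) o); first by left.
right; have [//|hUs] := ltP (C * n%:R) (partial_sum U K n o).
exfalso; move: hL; apply/negP; rewrite -leNgt.
have main : partial_sum V K n o <= MA K n o + al * (\sum_(i < n) V K (i%:Z - 1) o)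
   + (MB K n o + be * (\sum_(i < n) U K (i%:Z - 1) o)).
  rewrite /MA /MB /centered_sum !mulr_sumr -!big_split /=; apply: ler_sum => i _.
  apply: le_trans (Vmono K i%:Z o) _; apply: le_trans (rec K i%:Z o) _.
  by rewrite le_eqVlt; apply/orP; left; apply/eqP; ring.
have sV := ler_wpM2l al0 (partial_sum_shift K n o aV).
have sU := ler_wpM2l be0 (partial_sum_shift K n o aU).
have hA' := le_trans (ler_norm _) hA.
have hB' := le_trans (ler_norm _) hB.
have hV' := ler_wpM2l al0 hV.
have hU'' := ler_wpM2l be0 hU'.
have hUs' := ler_wpM2l be0 hUs.
have : (1 - al) * partial_sum V K n o <= (1 - al) * (L * n%:R).
  have LE : (1 - al) * L = 2 + al + be + be * C by rewrite /L; field; rewrite gt_eqF.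
  rewrite mulrA LE.
  rewrite !mulrDr in sV sU; lra.
by rewrite ler_pM2l.
Qed.

(* For exponents at most one the power is subadditive, hence no cancellation
   is needed. *)
Lemma partial_sum_tail (q : R) V : 0 < q -> q <= 1 -> nonneg_adapted V ->
  bounded_moments q V -> exists2 c : R, 0 <= c & forall K n (t : R), 0 < t ->
  (P [set o | (t < partial_sum V K n o)%R] <= (c * n%:R / t `^ q)%:E)%E.
Proof.
move=> q0 q1 aV [D hD].
have D0 : 0 <= D := Ex_powR_le_ge0 (hD 0%N 0).
exists D => // K n t t0.
have V0 x o : 0 <= V K x o by have [_] := aV K x.
have mS : measurable_fun setT (partial_sum V K n) by exact: measurable_partial_sum.
have S0 o : 0 <= partial_sum V K n o by apply: sumr_ge0 => i _; exact: V0.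
have mSq := measurable_powR_fun q mS.
have hE : (Ex P (fun o => (partial_sum V K n o `^ q)%R) <= (D * n%:R)%:E)%E.
  have mVq (i : nat) : measurable_fun setT (fun o => V K i%:Z o `^ q).
    by apply: measurable_powR_fun; exact: measurable_process.
  apply: (@le_trans _ _ (Ex P (fun o => \sum_(i < n) V K i%:Z o `^ q))).
    apply: Ex_le => //; first exact: measurable_sum.
      by move=> o; exact: powR_ge0.
    move=> o; exact: (@powR_subadditive_sum _ q n (fun i => V K i%:Z o)).
  rewrite (@Ex_sum _ _ _ P n (fun i o => V K i%:Z o `^ q))//; last first.
    by move=> i o; exact: powR_ge0.
  apply: (@le_trans _ _ (\sum_(i < n) D%:E)%E); first by apply: lee_sum => i _.
  by rewrite sumEFin sumr_const card_ord mulr_natr.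
have := @markov_bound _ _ _ P _ (t `^ q) _ mSq (fun o => powR_ge0 _ _) (powR_gt0 q t0) hE.
apply: le_trans; apply: le_measure; rewrite ?inE; [exact: measurable_gt|exact: measurable_gt|].
by move=> o /= h; apply: gt0_ltr_powR; rewrite ?nnegrE ?(ltW t0).
Qed.

Definition env o : int -> R := fun x => xi x o.

(* Real powers are available as measurable functions, inversion is not. *)
Definition oddr (v : R) : R := (1 - v) * v `^ (-1).

Lemma oddrE o x : oddr (xi x o) = odds (env o) x.
Proof.
have /andP[w0 _] := xi01 x o.
by rewrite /oddr powR_inv1// ltW.
Qed.

Lemma measurable_oddr : measurable_fun setT oddr.
Proof.
apply: measurable_funM; first by apply: measurable_funB.
exact: measurable_powR.
Qed.

Lemma oddr_ge0 x o : 0 <= oddr (xi x o).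
Proof. by rewrite oddrE; apply: odds_ge0 => y; exact: xi01. Qed.

(** Until its first visit to [z], a walk from [x <= z] reads only sites to the left of [z]. *)
Lemma adapted_hit_pmf k x z : x <= z -> adapted z (fun o => hit_pmf (env o) k x z).
Proof.
elim: k x => [|k IH] x xz; first exact: measurable_cst.
rewrite /=; have [xzE|xz'] := eqVneq x z; first exact: measurable_cst.
have xltz : x < z by rewrite lt_neqAle xz'.
have ax : adapted z (xi x) := adapted_xi xltz.
have h1 := IH (x + 1) ltac:(lia); have h2 := IH (x - 1) ltac:(lia).
apply: measurable_funD; apply: measurable_funM => //.
exact: measurable_funB.
Qed.

Lemma adapted_trunc_mom r K x : adapted (x + 1) (fun o => trunc_mom (env o) r K x).
Proof.
apply: measurable_sum => k; apply: measurable_funM; first exact: measurable_cst.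
by apply: adapted_hit_pmf; lia.
Qed.

Lemma adapted_odds_prod J x : adapted (x + 1) (fun o => odds_prod (env o) J x).
Proof.
elim: J x => [|J IH] x /=; first exact: measurable_cst.
apply: measurable_funM.
  rewrite (_ : (fun o => odds (env o) x) = oddr \o xi x); last first.
    by apply/funext => o /=; rewrite oddrE.
  apply: (measurableT_comp measurable_oddr).
  have xx : x < x + 1 by lia.
  exact: (adapted_xi xx).
have xx : x - 1 + 1 <= x + 1 by lia.
exact: (adapted_le xx (IH (x - 1))).
Qed.

Lemma odds_prod_ge0 o J x : 0 <= odds_prod (env o) J x.
Proof. by elim: J x => //= J IH x; rewrite mulr_ge0// -oddrE; exact: oddr_ge0. Qed.

Lemma Ex_odds_prod (r : R) J x : Ex P (fun o => oddr (xi 0%Z o)) = r%:E ->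
  Ex P (fun o => odds_prod (env o) J x) = (r ^+ J)%:E.
Proof.
move=> rE; elim: J x => [|J IH] x /=; first exact: Ex_cst.
rewrite exprS EFinM -rE -(IH (x - 1)).
have a := @adapted_odds_prod J (x - 1); rewrite subrK in a.
rewrite -(Ex_site_past measurable_oddr oddr_ge0 a).
  by congr Ex; apply/funext => o; rewrite oddrE.
by move=> o; exact: odds_prod_ge0.
Qed.

(** A product of [J] odds has mean [r ^+ J]. For [t] strictly between [r] and 1, Markov's inequality
    and Borel-Cantelli make it eventually at most [t ^+ J], and the failure probability lies below
    all these products. *)
Lemma success_eq1 (r : R) x : Ex P (fun o => oddr (xi 0%Z o)) = r%:E -> r < 1 ->
  {ae P, forall o, success (env o) x = 1}.
Proof.
move=> rE r1.
have r0 : 0 <= r by rewrite -lee_fin -rE; apply: Ex_ge0 => o; exact: oddr_ge0.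
pose t := (1 + r) / 2.
have t0 : 0 < t by rewrite /t; lra.
have t1 : t < 1 by rewrite /t; lra.
have mprod J : measurable_fun setT (fun o => odds_prod (env o) J x).
  exact: (adapted_measurable (@adapted_odds_prod J x)).
have hP J : (P [set o | (t ^+ J < odds_prod (env o) J x)%R] <= (1 * (r / t) ^+ J)%:E)%E.
  rewrite mul1r (expr_div_n r t J); apply: (@markov_bound _ _ _ P (fun o => odds_prod (env o) J x) (t ^+ J) (r ^+ J)) => //.
  - by move=> o; exact: odds_prod_ge0.
  - exact: exprn_gt0.
  - by rewrite (Ex_odds_prod _ _ rE).
have rt0 : 0 <= r / t by rewrite divr_ge0// ltW.
have rt1 : r / t < 1 by rewrite ltr_pdivrMr// mul1r /t; lra.
apply: filterS (borel_cantelli_geometric (fun J => measurable_gt _ (mprod J)) ler01 rt0 rt1 hP).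
move=> o [J0 hJ].
have w01 : forall y, 0 < env o y <= 1 by move=> y; exact: xi01.
apply/eqP; rewrite eq_le success_le1// -subr_le0.
have tc : (fun J => t ^+ J) @ \oo --> (0 : R).
  by apply: cvg_expr; rewrite ger0_norm// ltW.
apply: (ler_cvg_to (cvg_cst _) tc).
near=> J; apply: le_trans (failure_le_odds_prod w01 J x) _.
by rewrite leNgt; apply/negP/hJ; near: J; exists J0.
Unshelve. all: by end_near. Qed.

Lemma dyadic_powR (k : nat) (s : R) : ((2 ^ k)%N%:R : R) `^ s = (2 `^ s) ^+ k.
Proof. by rewrite natrX -!powR_mulrn ?powR_ge0// -!powRrM mulrC. Qed.

(** Each [n] is rounded up to a power of two below [2 * n], which costs the factor [2 ^ b]. *)
Lemma eventually_le_powR (S : nat -> nat -> Omega -> R) (C c b s : R) :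
  (forall K n, measurable_fun setT (S K n)) ->
  (forall K n o, S K n o <= S K.+1 n o) ->
  (forall K n o, S K n o <= S K n.+1 o) ->
  0 <= C -> 0 <= c -> 0 <= b -> 0 < s ->
  (forall K n, (0 < n)%N ->
    (P [set o | (C * n%:R `^ b < S K n o)%R] <= (c * n%:R `^ (- s))%:E)%E) ->
  {ae P, forall o, exists n0, forall n, (n0 <= n)%N ->
     forall K, S K n o <= C * 2 `^ b * n%:R `^ b}.
Proof.
move=> mS SK Sn C0 c0 b0 s0 hP.
have r1 : 2 `^ (- s) < 1 :> R.
  have := @gt0_ltr_powR R s s0 1 2; rewrite !nnegrE powR1 => h.
  by rewrite powRN invf_lt1 ?powR_gt0//; apply: h => //; exact: ltr1n.
have h K k : (P [set o | (C * (2 ^ k)%N%:R `^ b < S K (2 ^ k)%N o)%R] <=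
    (c * (2 `^ (- s)) ^+ k)%:E)%E.
  by rewrite -dyadic_powR; apply: hP; rewrite expn_gt0.
apply: filterS (eventually_dyadic mS SK Sn c0 (powR_ge0 2 _) r1 h) => o [k0 hk0].
exists (2 ^ k0)%N => n hn K.
have n0 : (0 < n)%N by apply: leq_trans hn; rewrite expn_gt0.
have [k /andP[nk kn]] := dyadic_bracket n0.
have k0k : (k0 <= k)%N by rewrite -(leq_exp2l (m := 2))// (leq_trans hn).
apply: le_trans (hk0 k k0k K n nk) _.
rewrite -mulrA -powRM// ler_wpM2l//; apply: le_powR => //.
by rewrite -natrM ler_nat ltnW.
Qed.

Lemma odds_moment_le (p r A : R) : 0 < r -> r <= p -> A < 1 ->
  (Ex P (fun o => (oddr (xi 0%Z o) `^ p)%R) <= A%:E)%E ->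
  exists2 A' : R, 0 <= A' < 1 & (Ex P (fun o => (oddr (xi 0%Z o) `^ r)%R) <= A'%:E)%E.
Proof.
move=> r0 rp A1 hA; have p0 : 0 < p by lra.
have mo := measurable_site 0 measurable_oddr.
have c0 : 0 < r / p by rewrite divr_gt0.
have c1 : r / p <= 1 by rewrite ler_pdivrMr// mul1r.
have A0 : 0 <= A := Ex_powR_le_ge0 hA.
have A'0 : 0 <= r / p * A by rewrite mulr_ge0// ltW.
have A'1 : r / p * A < r / p * 1 by rewrite ltr_pM2l.
exists (r / p * A + (1 - r / p)); first by apply/andP; split; lra.
exact: Ex_powR_interpolate mo (fun o => oddr_ge0 0 o) r0 rp hA.
Qed.

(** The powers 3, 3/2 and 1 bring the moments of orders 1, 2 and 3 to the same degree. In their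
    recursions the multipliers are, up to [e], [rho ^ 3], [rho ^ (3/2)] and [rho]; at order [p / 3]
    these call for moments of [rho] of order at most [p]. *)
Definition crossing1 K x o : R := (1 + trunc_mom (env o) 1 K x) `^ 3.
Definition crossing2 K x o : R := trunc_mom (env o) 2 K x `^ (3 / 2).
Definition crossing3 K x o : R := trunc_mom (env o) 3 K x.

Let w01 o y : 0 < env o y <= 1. Proof. exact: xi01. Qed.

Let amom r K x := @adapted_trunc_mom r K x.

Lemma nonneg_adapted1 : nonneg_adapted crossing1.
Proof.
move=> K x; split; last by move=> o; exact: powR_ge0.
apply: adapted_powR; apply: measurable_funD; first exact: measurable_cst.
exact: (@amom 1%N K x).
Qed.

Lemma nonneg_adapted2 : nonneg_adapted crossing2.
Proof.
move=> K x; split; last by move=> o; exact: powR_ge0.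
apply: adapted_powR; exact: (@amom 2%N K x).
Qed.

Lemma nonneg_adapted3 : nonneg_adapted crossing3.
Proof.
move=> K x; split; last by move=> o; exact: (trunc_mom_ge0 (w01 o)).
exact: (@amom 3%N K x).
Qed.

Lemma nonneg_adaptedD U V : nonneg_adapted U -> nonneg_adapted V ->
  nonneg_adapted (fun K x o => U K x o + V K x o).
Proof.
move=> aU aV K x; have [a1 U0] := aU K x; have [a2 V0] := aV K x.
by split; [exact: measurable_funD|move=> o; exact: addr_ge0].
Qed.

Lemma bounded_momentsD q U V : 0 < q -> nonneg_adapted U -> nonneg_adapted V ->
  bounded_moments q U -> bounded_moments q V ->
  bounded_moments q (fun K x o => U K x o + V K x o).
Proof.
move=> q0 aU aV [D hD] [D' hD'].
exists ((1 + 1) `^ q * D + (1 + 1^-1) `^ q * D') => K x.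
have mU := measurable_process K x aU; have mV := measurable_process K x aV.
have [_ U0] := aU K x; have [_ V0] := aV K x.
have mUq := measurable_powR_fun q mU; have mVq := measurable_powR_fun q mV.
have m1 : measurable_fun setT (fun o => (1 + 1 : R) `^ q * U K x o `^ q) by exact: measurable_funM.
have m2 : measurable_fun setT (fun o => (1 + 1^-1 : R) `^ q * V K x o `^ q) by exact: measurable_funM.
have p1 o : 0 <= U K x o `^ q by exact: powR_ge0.
have p2 o : 0 <= V K x o `^ q by exact: powR_ge0.
apply: (@le_trans _ _ (Ex P (fun o => (1 + 1) `^ q * U K x o `^ q + (1 + 1^-1) `^ q * V K x o `^ q))).
  apply: Ex_le.
  - by apply: measurable_powR_fun; exact: measurable_funD.
  - exact: measurable_funD.
  - by move=> o; exact: powR_ge0.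
  - by move=> o; exact: powR_add_le.
rewrite (ExD P m1 m2) //; try by move=> o; rewrite mulr_ge0// powR_ge0.
rewrite (ExZ P (powR_ge0 _ _) mUq p1) (ExZ P (powR_ge0 _ _) mVq p2) EFinD !EFinM.
by apply: leeD; apply: lee_wpmul2l; rewrite ?lee_fin ?powR_ge0// ?hD ?hD'.
Qed.

Lemma crossing1_recursion e : 0 < e ->
  recursion_bound (fun v => (1 + e) `^ 3 * oddr v `^ 3)
    (fun=> (1 + e^-1) `^ 3 * 3 `^ 3) (fun _ _ _ => 1) crossing1.
Proof.
move=> e0 K x o; rewrite mulr1 -mulrA oddrE//.
have o0 : 0 <= odds (env o) x by exact: (odds_ge0 (w01 o)).
have s0 : 0 <= 1 + trunc_mom (env o) 1 K (x - 1).
  by rewrite addr_ge0// (trunc_mom_ge0 (w01 o)).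
rewrite /crossing1 -(powRM _ o0 s0).
apply: le_trans (powR_add_le _ e0 (mulr_ge0 o0 s0) _) => //.
apply: le_powR => //; first by rewrite addr_ge0// (trunc_mom_ge0 (w01 o)).
have := trunc_mom1_le (w01 o) K x.
by rewrite mulrDr mulr1; lra.
Qed.

Lemma crossing2_recursion e : 0 < e ->
  recursion_bound (fun v => (1 + e) `^ (3/2) * oddr v `^ (3/2))
    (fun v => (1 + e^-1) `^ (3/2) * (2 `^ 3 * (1 + oddr v) `^ 3)) crossing1 crossing2.
Proof.
move=> e0 K x o; rewrite -!mulrA oddrE//.
have o0 : 0 <= odds (env o) x by exact: (odds_ge0 (w01 o)).
have g0 : 0 <= 1 + odds (env o) x by rewrite addr_ge0.
have s0 : 0 <= 1 + trunc_mom (env o) 1 K (x - 1).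
  by rewrite addr_ge0// (trunc_mom_ge0 (w01 o)).
have t0 : 0 <= trunc_mom (env o) 2 K (x - 1) by exact: (trunc_mom_ge0 (w01 o)).
have gs0 := mulr_ge0 g0 s0; have n20 : 0 <= 2 :> R by [].
rewrite /crossing2 /crossing1 -(powRM _ o0 t0) -(powRM _ g0 s0) -(powRM _ n20 gs0).
(* The inhomogeneous term of the second-moment recursion is a perfect square, so its power 3/2 is a
   cube. *)
have -> : (2 * ((1 + odds (env o) x) * (1 + trunc_mom (env o) 1 K (x - 1)))) `^ 3 =
  (4 * (1 + odds (env o) x) ^+ 2 * (1 + trunc_mom (env o) 1 K (x - 1)) ^+ 2) `^ (3/2).
  have -> : 4 * (1 + odds (env o) x) ^+ 2 * (1 + trunc_mom (env o) 1 K (x - 1)) ^+ 2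
    = (2 * ((1 + odds (env o) x) * (1 + trunc_mom (env o) 1 K (x - 1)))) `^ 2.
    by rewrite powR_mulrn ?mulr_ge0//; ring.
  by rewrite -powRrM; congr (_ `^ _); field.
apply: le_trans (powR_add_le _ e0 _ _); last 3 first.
- by rewrite divr_gt0.
- exact: mulr_ge0.
- by rewrite !mulr_ge0 ?exprn_ge0.
apply: le_powR => //.
  exact: (trunc_mom_ge0 (w01 o)).
exact: (trunc_mom2_recursion (w01 o)).
Qed.

(** Degree three is already linear in the third moment, so no [e] is lost. The mixed product of
    first and second moments is split by [mul_sqr_le], and 29 is [20 + 9]. *)
Lemma crossing3_recursion :
  recursion_bound oddr (fun v => 29 * (1 + oddr v) `^ 3)
    (fun K x o => crossing1 K x o + crossing2 K x o) crossing3.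
Proof.
move=> K x o; rewrite oddrE//.
have o0 : 0 <= odds (env o) x by exact: (odds_ge0 (w01 o)).
have g0 : 0 <= 1 + odds (env o) x by rewrite addr_ge0.
have s0 : 0 <= 1 + trunc_mom (env o) 1 K (x - 1).
  by rewrite addr_ge0// (trunc_mom_ge0 (w01 o)).
have t0 : 0 <= trunc_mom (env o) 2 K (x - 1) by exact: (trunc_mom_ge0 (w01 o)).
apply: le_trans (trunc_mom3_recursion (w01 o) K x) _; rewrite lerD2l.
rewrite (powR_mulrn 3 g0) [29 * _]mulrC -[_ * 29 * _]mulrA; apply: ler_wpM2l; first exact: exprn_ge0.
rewrite /crossing1 /crossing2 (powR_mulrn 3 s0).
have := mul_sqr_le s0 t0; have := powR_ge0 (trunc_mom (env o) 2 K (x - 1)) (3/2).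
have := exprn_ge0 3 s0; lra.
Qed.

Lemma crossing3_ndecr K x o : crossing3 K x o <= crossing3 K.+1 x o.
Proof. exact: (trunc_mom_ndecr (w01 o)). Qed.

Lemma crossing1_ndecr K x o : crossing1 K x o <= crossing1 K.+1 x o.
Proof.
apply: le_powR => //; first by rewrite addr_ge0// (trunc_mom_ge0 (w01 o)).
by rewrite lerD2l (trunc_mom_ndecr (w01 o)).
Qed.

Lemma crossing2_ndecr K x o : crossing2 K x o <= crossing2 K.+1 x o.
Proof.
apply: le_powR; [lra|exact: (trunc_mom_ge0 (w01 o))|].
exact: (trunc_mom_ndecr (w01 o)).
Qed.

Section moments.
Variables (p A : R).
Hypothesis p0 : 0 < p.
Hypothesis A1 : A < 1.
Hypothesis hA : (Ex P (fun o => (oddr (xi 0%Z o) `^ p)%R) <= A%:E)%E.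
Let q := p / 3.

Let q0 : 0 < q. Proof. by rewrite divr_gt0. Qed.

Let mo : measurable_fun setT oddr := measurable_oddr.

Let o0 x o : 0 <= oddr (xi x o). Proof. exact: oddr_ge0. Qed.

(* The multiplier [(1 + e)^r rho^r] has moment of order [q] below one for small
   [e], since [rho^(r q)] does. *)
Lemma small_multiplier (r : R) : 0 < r -> r <= 3 ->
  exists e A' : R, [/\ 0 < e, 0 <= A', A' < 1 &
    (Ex P (fun o => (((1 + e) `^ r * oddr (xi 0%Z o) `^ r) `^ q)%R) <= A'%:E)%E].
Proof.
move=> r0 r3.
have rq0 : 0 < r * q by rewrite mulr_gt0.
have rqp : r * q <= p.
  have -> : p = 3 * q by rewrite /q; field.
  by rewrite ler_pM2r.
have [A' /andP[A'0 A'1] hA'] := odds_moment_le rq0 rqp A1 hA.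
have [e e0 he] := exists_small_power rq0 A'0 A'1.
exists e, ((1 + e) `^ (r * q) * A'); split=> //; first by rewrite mulr_ge0 ?powR_ge0.
have -> : (fun o => ((1 + e) `^ r * oddr (xi 0 o) `^ r) `^ q) =
   (fun o => (1 + e) `^ (r * q) * oddr (xi 0 o) `^ (r * q)).
  by apply/funext => o; rewrite powRM ?powR_ge0// -!powRrM.
rewrite ExZ ?powR_ge0//; last 2 first.
- by apply: measurable_powR_fun; exact: (measurable_site 0 mo).
- by move=> o; exact: powR_ge0.
by rewrite EFinM; apply: lee_wpmul2l => //; rewrite lee_fin powR_ge0.
Qed.

Lemma cube_moment (c : R) : 0 <= c -> exists2 B : R, 0 <= B &
  (Ex P (fun o => ((c * (1 + oddr (xi 0%Z o)) `^ 3) `^ q)%R) <= B%:E)%E.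
Proof.
move=> c0.
have A0 : 0 <= A := Ex_powR_le_ge0 hA.
exists (c `^ q * ((1 + 1) `^ p * 1 + (1 + 1^-1) `^ p * A)).
  by rewrite mulr_ge0 ?addr_ge0 ?mulr_ge0 ?powR_ge0.
have mx := measurable_site 0 mo.
have mxp := measurable_powR_fun p mx.
have xp0 o : 0 <= oddr (xi 0 o) `^ p by exact: powR_ge0.
have m2 : measurable_fun setT (fun o => (1 + 1^-1 : R) `^ p * oddr (xi 0 o) `^ p).
  exact: measurable_funM.
have m12 : measurable_fun setT (fun o => (1 + 1 : R) `^ p * 1 + (1 + 1^-1 : R) `^ p * oddr (xi 0 o) `^ p).
  exact: measurable_funD.
have p20 o : 0 <= (1 + 1^-1 : R) `^ p * oddr (xi 0 o) `^ p by rewrite mulr_ge0 ?powR_ge0.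
have p10 : 0 <= (1 + 1 : R) `^ p * 1 by rewrite mulr_ge0 ?powR_ge0.
have mg : measurable_fun setT (fun o => (1 + oddr (xi 0 o)) `^ p).
  by apply: measurable_powR_fun; exact: measurable_funD.
have -> : (fun o => (c * (1 + oddr (xi 0 o)) `^ 3) `^ q) =
   (fun o => c `^ q * (1 + oddr (xi 0 o)) `^ p).
  apply/funext => o; rewrite powRM ?powR_ge0// -powRrM; congr (_ * _ `^ _).
  by rewrite /q; field.
rewrite (ExZ P (powR_ge0 _ _) mg); last by move=> o; exact: powR_ge0.
rewrite EFinM; apply: lee_wpmul2l; first by rewrite lee_fin powR_ge0.
apply: (@le_trans _ _ (Ex P (fun o => (1 + 1) `^ p * 1 + (1 + 1^-1) `^ p * oddr (xi 0 o) `^ p))).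
  apply: Ex_le => //; first by move=> o; exact: powR_ge0.
  move=> o; have := powR_add_le p0 ltr01 ler01 (o0 0 o).
  by rewrite (_ : 1 `^ p = 1 :> R) // powR1.
rewrite ExD//.
rewrite Ex_cst (ExZ P (powR_ge0 _ _) mxp xp0) [leRHS]EFinD; apply: leeD => //.
by rewrite EFinM; apply: lee_wpmul2l => //; rewrite lee_fin powR_ge0.
Qed.

(** The three properties passed along the chain of crossing processes. Linear growth is asked only
    in the range [1 < q <= 2] of the von Bahr-Esseen bound. *)
Definition controlled V := [/\ nonneg_adapted V, bounded_moments q V &
  1 < q -> q <= 2 -> linear_growth q V].

Lemma controlled_cst : controlled (fun _ _ _ => 1).
Proof.
split; last by move=> *; exact: linear_growth_cst.
  by move=> K x; split=> //; exact: measurable_cst.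
by exists 1 => K x; rewrite (_ : (fun=> _) = fun=> 1) ?Ex_cst ?powR1//.
Qed.

Lemma controlledD U V : controlled U -> controlled V ->
  controlled (fun K x o => U K x o + V K x o).
Proof.
move=> [aU mU gU] [aV mV gV]; split.
- exact: nonneg_adaptedD.
- exact: (bounded_momentsD).
- by move=> q1 q2; apply: (linear_growthD) => //; [exact: gU|exact: gV].
Qed.

Lemma controlled_recursion (r B : R) (a b : R -> R) U V :
  measurable_fun setT a -> (forall x o, 0 <= a (xi x o)) ->
  measurable_fun setT b -> (forall x o, 0 <= b (xi x o)) ->
  0 <= r -> r < 1 -> (Ex P (fun o => (a (xi 0%Z o) `^ q)%R) <= r%:E)%E ->
  0 <= B -> (Ex P (fun o => (b (xi 0%Z o) `^ q)%R) <= B%:E)%E ->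
  controlled U -> nonneg_adapted V -> (forall x o, V 0%N x o <= 1) ->
  (forall K x o, V K x o <= V K.+1 x o) ->
  recursion_bound a b U V -> controlled V.
Proof.
move=> ma a0 mb b0 r0 r1 ra B0 bB [aU mU gU] aV V1 Vnd rec.
have mV : bounded_moments q V.
  exact: (moment_recursion q0 ma a0 mb b0 r0 r1 ra B0 bB aU mU aV V1 rec).
split=> // q1 q2.
exact: (linear_growth_recursion q1 q2 ma a0 mb b0 r1 ra bB aU mU (gU q1 q2)
  aV mV Vnd rec).
Qed.

Lemma crossing1_controlled : controlled crossing1.
Proof.
have [//|//|e [A' [e0 A'0 A'1 hA']]] := small_multiplier (r := 3).
apply: (controlled_recursion (B := ((1 + e^-1) `^ 3 * 3 `^ 3) `^ q) _ _ _ _ A'0 A'1 hA'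
  _ _ controlled_cst nonneg_adapted1 _ crossing1_ndecr (crossing1_recursion e0)).
- by apply: measurable_funM => //; exact: measurable_powR_fun.
- by move=> x o; rewrite mulr_ge0 ?powR_ge0.
- exact: measurable_cst.
- by move=> x o; rewrite mulr_ge0 ?powR_ge0.
- exact: powR_ge0.
- by rewrite Ex_cst.
- move=> x o; rewrite /crossing1 /trunc_mom big_ord0 addr0 powR1//.
Qed.

Lemma crossing2_controlled : controlled crossing2.
Proof.
have h1 : (0 : R) < 3 / 2 by rewrite divr_gt0.
have h2 : (3 / 2 : R) <= 3 by lra.
have [e [A' [e0 A'0 A'1 hA']]] := small_multiplier h1 h2.
have c0 : 0 <= (1 + e^-1) `^ (3/2) * 2 `^ 3 by rewrite mulr_ge0 ?powR_ge0.
have [B B0 hB] := cube_moment c0.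
apply: (controlled_recursion _ _ _ _ A'0 A'1 hA' B0 _ crossing1_controlled
  nonneg_adapted2 _ crossing2_ndecr (crossing2_recursion e0)).
- by apply: measurable_funM => //; exact: measurable_powR_fun.
- by move=> x o; rewrite mulr_ge0 ?powR_ge0.
- apply: measurable_funM => //; apply: measurable_funM => //.
  by apply: measurable_powR_fun; exact: measurable_funD.
- by move=> x o; rewrite !mulr_ge0 ?powR_ge0.
- by under [X in Ex P X]funext => o do rewrite mulrA.
- by move=> x o; rewrite /crossing2 /trunc_mom big_ord0 powR0// gt_eqF.
Qed.

Lemma crossing3_controlled : controlled crossing3.
Proof.
have qp : q <= p by rewrite /q; have := p0; lra.
have [A' /andP[A'0 A'1] hA'] := odds_moment_le q0 qp A1 hA.
have c0 : 0 <= 29 :> R by [].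
have [B B0 hB] := cube_moment c0.
apply: (controlled_recursion mo o0 _ _ A'0 A'1 hA' B0 hB
  (controlledD crossing1_controlled crossing2_controlled)
  nonneg_adapted3 _ crossing3_ndecr crossing3_recursion).
- apply: measurable_funM => //.
  by apply: measurable_powR_fun; exact: measurable_funD.
- by move=> x o; rewrite mulr_ge0 ?powR_ge0.
- by move=> x o; rewrite /crossing3 /trunc_mom big_ord0.
Qed.

(* With [q = p / 3], the third moments sum to [O(n)] when [p > 3], and to
   [O(n^b)] for every [b > 3 / p] otherwise. *)
Lemma crossing3_growth (b : R) : 3 < p /\ p <= 6 /\ b = 1 \/ p <= 3 /\ 3 < b * p ->
  exists C : R, 0 < C /\ {ae P, forall o, exists n0, forall n, (n0 <= n)%N ->
    forall K, partial_sum crossing3 K n o <= C * n%:R `^ b}.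
Proof.
have [aV mV gV] := crossing3_controlled.
have V0 K x o : 0 <= crossing3 K x o by have [_] := aV K x.
have mS K n : measurable_fun setT (partial_sum crossing3 K n).
  exact: (measurable_partial_sum K n aV).
have SK K n o : partial_sum crossing3 K n o <= partial_sum crossing3 K.+1 n o.
  by apply: ler_sum => i _; exact: crossing3_ndecr.
have Sn K n o : partial_sum crossing3 K n o <= partial_sum crossing3 K n.+1 o.
  by rewrite /partial_sum big_ord_recr lerDl.
case=> [[p3 [p6 ->]]|[p3 bp]].
  have q1 : 1 < q by rewrite /q; lra.
  have q2 : q <= 2 by rewrite /q; lra.
  have [C [c [C0 c0 h]]] := gV q1 q2.
  (* A positive constant is required, whereas [C] is only nonnegative. *)
  have C1 : 0 < C + 1 by lra.
  exists ((C + 1) * 2 `^ 1); split; first by rewrite mulr_gt0 ?powR_gt0.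
  apply: (@eventually_le_powR _ (C + 1) c 1 (q - 1)) => //; first exact: ltW.
    by rewrite subr_gt0.
  move=> K n n0; rewrite opprB; apply: le_trans (h K n n0).
  apply: le_measure; rewrite ?inE; [exact: measurable_gt..|] => o /=.
  rewrite powRr1//; apply: le_lt_trans; rewrite mulrDl lerDl mul1r//.
have q1 : q <= 1 by rewrite /q; lra.
have [c c0 h] := partial_sum_tail q0 q1 aV mV.
have b0 : 0 < b by rewrite -(pmulr_lgt0 _ p0); lra.
exists (1 * 2 `^ b); split; first by rewrite mul1r powR_gt0.
(* At threshold [n ^ b] the tail is of order [n ^ (1 - b * q)], and [b * q > 1] is the assumption
   [3 < b * p]. *)
apply: (@eventually_le_powR _ 1 c b (b * q - 1)) => //; first exact: ltW.
  by rewrite subr_gt0 /q; lra.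
move=> K n n0; rewrite mul1r.
have n0' : (0 : R) < n%:R by rewrite ltr0n.
apply: le_trans (h K n _ (powR_gt0 b n0')) _.
rewrite lee_fin opprB powRD; last by rewrite (gt_eqF n0') implybT.
by rewrite powRr1 ?ler0n// powRN -powRrM mulrA.
Qed.

End moments.

Hypothesis xi_lt1 : (P [set o | xi 0 o = 1%R] < 1)%E.

(** * Almost sure linear growth of the variance *)

Section variance_growth.

Let g v : R := v * (1 - v).

Let mg : measurable_fun setT g.
Proof. by apply: measurable_funM => //; exact: measurable_funB. Qed.

Let g0 x o : 0 <= g (xi x o).
Proof. by have /andP[w0 w1] := xi01 x o; rewrite mulr_ge0 ?subr_ge0// ltW. Qed.

Let g1 x o : g (xi x o) <= 1.
Proof.
have /andP[w0 w1] := xi01 x o; rewrite -[leRHS](mulr1 1).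
by apply: ler_pM; rewrite ?subr_ge0// ?(ltW w0)// lerBlDl lerDr ltW.
Qed.

Let mgx x : measurable_fun setT (fun o => g (xi x o)).
Proof. exact: measurable_site. Qed.

(** A zero mean would make [xi 0 * (1 - xi 0)] vanish almost surely, and [xi 0 > 0] would then force
    [xi 0 = 1] almost surely. *)
Lemma mean_variance_gt0 : exists2 c : R, 0 < c & Ex P (fun o => g (xi 0 o)) = c%:E.
Proof.
have Eg0 : (0 <= Ex P (fun o => g (xi 0 o)))%E by exact: Ex_ge0.
have Eg1 : (Ex P (fun o => g (xi 0 o)) <= 1%:E)%E.
  by rewrite -(Ex_cst P 1); apply: Ex_le => //; exact: measurable_cst.
have Efin : Ex P (fun o => g (xi 0 o)) \is a fin_num.
  by rewrite ge0_fin_numE//; apply: (le_lt_trans Eg1); rewrite ltry.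
exists (fine (Ex P (fun o => g (xi 0 o)))); last by rewrite fineK.
rewrite fine_gt0// lt_neqAle Eg0 andbT eq_sym -ge0_fin_numE// Efin andbT.
apply/eqP => E0.
have mE : measurable_fun setT (fun o => (g (xi 0 o))%:E).
  by apply/measurable_EFinP.
have /(ae_eq_integral_abs P measurableT mE) ae0 : (\int[P]_o `|(g (xi 0 o))%:E| = 0)%E.
  by rewrite -[RHS]E0; apply: eq_integral => o _; rewrite gee0_abs// lee_fin.
pose N := [set o | xi 0 o = 1].
have mN : measurable N.
  rewrite (_ : N = xi 0 @^-1` [set 1])//.
  by rewrite -[X in measurable X]setTI; apply: mxi.
suff N0 : P (~` N) = 0%E.
  move: xi_lt1; rewrite -/N -[N]setCK (probability_setC P (measurableC mN)) N0.
  by rewrite sube0 ltxx.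
apply: measure_negligible; first exact: measurableC.
apply: negligibleS ae0 => o /= nN h; apply: nN; rewrite /N /=.
have := h I; rewrite /g => -[] /eqP; have /andP[w0 _] := xi01 0 o.
by rewrite mulf_eq0 gt_eqF//= subr_eq0 => /eqP.
Qed.

(* Chebyshev along powers of two. *)
Lemma variance_growth : exists2 c : R, 0 < c &
  {ae P, forall o, exists n0, forall n, (n0 <= n)%N ->
    c * n%:R <= \sum_(i < n) env o i%:Z * (1 - env o i%:Z)}.
Proof.
have [c c0 hc] := mean_variance_gt0.
pose U (n : nat) (o : Omega) : R := 1.
have aU n : adapted n%:Z (U n) by exact: measurable_cst.
have U0 n o : 0 <= U n o by [].
have U_mom n : (Ex P (fun o => (U n o `^ 2)%R) <= 1%:E)%E by rewrite /U Ex_cst powR1.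
have g_mom : (Ex P (fun o => (g (xi 0%Z o) `^ 2)%R) <= 1%:E)%E.
  rewrite -(Ex_cst P 1); apply: Ex_le; [exact: measurable_powR_fun|exact: measurable_cst| |].
    by move=> o; exact: powR_ge0.
  move=> o; have := @le_powR R 2 (g (xi 0 o)) 1.
  by rewrite powR1; apply=> //; exact: g1.
have c20 : 0 < c / 2 by rewrite divr_gt0.
have n2 : 1 < 2 :> R by rewrite ltr1n.
have tail := @centered_sum_tail 2 g c 1 1 U n2 (lexx _)
  mg g0 hc g_mom aU U0 U_mom (c / 2).
set C := 3 * _ * _ / _ in tail.
have C0 : 0 <= C.
  by rewrite divr_ge0 ?powR_ge0// mulr1 mulr_ge0// addr_ge0// powR_ge0.
have i2 : 0 <= 2^-1 :> R by [].
have i21 : 2^-1 < 1 :> R by rewrite invf_lt1.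
pose E k := [set o | c / 2 * (2 ^ k)%N%:R < `|centered_sum g c U (2 ^ k) o|].
have mS n : measurable_fun setT (centered_sum g c U n).
  apply: measurable_sum => i; apply: measurable_funM; last exact: measurable_cst.
  by apply: measurable_funB; [exact: mgx|exact: measurable_cst].
have mE k : measurable (E k).
  apply: measurable_gt; exact: (measurableT_comp (@normr_measurable _ _) (mS _)).
have PE k : (P (E k) <= (C * 2^-1 ^+ k)%:E)%E.
  have := tail (2 ^ k)%N c20; rewrite expn_gt0 => /(_ isT).
  rewrite dyadic_powR (_ : 2 `^ (1 - 2) = 2^-1 :> R)//.
  by rewrite (_ : 1 - 2 = - 1 :> R) ?powR_inv1//; ring.
(* Up to a power of two [2 ^ k <= n] the sum is at least [c / 2 * 2 ^ k], and [n <= 3 * 2 ^ k]. *)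
exists (c / 6); first by rewrite divr_gt0.
apply: filterS (borel_cantelli_geometric mE C0 i2 i21 PE) => o [k0 hk0].
exists (2 ^ k0.+1).+1 => n hn.
(* Bracketing [n./2] rather than [n] yields a power of two below [n], as a lower bound requires. *)
have n0 : (0 < n./2)%N by rewrite half_gt0; apply: leq_trans hn; rewrite expnS ltnS; have := expn_gt0 2 k0; lia.
have [k /andP[nk kn]] := dyadic_bracket n0.
have k0k : (k0 <= k)%N.
  rewrite -(leq_exp2l (m := 2))//; apply: leq_trans nk; move: hn; rewrite expnS; lia.
have kn' : (2 ^ k <= n)%N by lia.
have nk' : (n <= 3 * 2 ^ k)%N by lia.
have nE : `|centered_sum g c U (2 ^ k) o| <= c / 2 * (2 ^ k)%N%:R.
  by rewrite leNgt; apply/negP; exact: hk0.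
have cE : centered_sum g c U (2 ^ k) o = \sum_(i < 2 ^ k) g (xi i%:Z o) - c * (2 ^ k)%N%:R.
  rewrite /centered_sum; under eq_bigr do rewrite mulr1.
  by rewrite sumrB sumr_const card_ord mulr_natr.
rewrite cE ler_norml in nE; have /andP[hl _] := nE.
apply: (@le_trans _ _ (\sum_(i < 2 ^ k) g (xi i%:Z o))).
  have : c / 6 * n%:R <= c / 6 * (3 * (2 ^ k)%N%:R).
    by rewrite -natrM ler_wpM2l ?ler_nat// divr_ge0// ltW.
  lra.
rewrite -!(big_mkord xpredT (fun i => g (xi i%:Z o))) (big_cat_nat (leq0n _) kn') /=.
by rewrite lerDl; apply: sumr_ge0.
Qed.

End variance_growth.

(** * The quenched rate for an environment without zeros *)

Context (dS : measure_display) (S : measurableType dS) (X : nat -> S -> int)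
  (Q : (int -> R) -> probability S R).
Hypothesis walk : forall w, (forall y, 0 <= w y <= 1) -> quenched_walk X w 0 (Q w).

(** A bound on the sum of truncated third moments that holds for every [K] makes each of them
    converge, and the limits inherit it; the truncation disappears here. *)
Lemma quenched_rate_env (w : int -> R) n (M U y : R) : (forall x, 0 < w x <= 1) ->
  (forall i, (i < n)%N -> success w i%:Z = 1) ->
  (forall K, \sum_(i < n) trunc_mom w 3 K i%:Z <= M) ->
  0 < U -> U <= \sum_(i < n) w i%:Z * (1 - w i%:Z) ->
  `|normalized_cdf (Q w) (hitting_time R X n%:Z) y - Phi y| <=
  be_cst R * M / (U * Num.sqrt U).
Proof.
move=> w0 s1 hM U0 hU.
have w01' x : 0 <= w x <= 1 by have /andP[h ->] := w0 x; rewrite ltW.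
pose B i := limn (fun K => trunc_mom w 3 K i%:Z).
have t0 K i : 0 <= trunc_mom w 3 K i by exact: trunc_mom_ge0.
have tM i K : (i < n)%N -> trunc_mom w 3 K i%:Z <= M.
  move=> ni; apply: le_trans (hM K).
  rewrite (bigD1 (Ordinal ni)) //= lerDl; apply: sumr_ge0 => j _; exact: t0.
have p0 x k : 0 <= step_pmf w x k by exact: hit_pmf_ge0.
have Bcvg i : (i < n)%N -> (fun K => trunc_mom w 3 K i%:Z) @ \oo --> B i.
  move=> ni.
  have f0 k : 0 <= k.+1%:R ^+ 3 * step_pmf w i%:Z k by rewrite mulr_ge0 ?exprn_ge0.
  exact: (cvg_nondecreasing_bounded f0 (fun K => tM i K ni)).
have sB : \sum_(i < n) B i <= M.
  have h : (fun K => \sum_(i < n) trunc_mom w 3 K i%:Z) @ \oo --> \sum_(i < n) B i.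
    by apply: (@cvg_sumr R _ _ xpredT (fun (i : 'I_n) K => trunc_mom w 3 K i%:Z)) => i _; exact: Bcvg.
  by apply: (ler_cvg_to h (cvg_cst _)); apply: nearW => K; exact: hM.
apply: (le_trans (quenched_berry_esseen w01' (walk w01') (B := B) y _ _ U0 hU)).
- by move=> i ni; rewrite -(s1 i ni); exact: success_cvg.
- move=> i K ni; apply: (@le_trans _ _ (trunc_mom w 3 K i%:Z)).
    by apply: ler_sum => k _; rewrite ler_wpM2r// lerXn2r ?nnegrE// ler_nat.
  have nd : {homo (fun K => trunc_mom w 3 K i%:Z) : K L / (K <= L)%N >-> K <= L}.
    by move=> K' L KL; exact: trunc_mom_ndecr.
  apply: (nondecreasing_cvgn_le nd); apply/cvg_ex; exists (B i); exact: Bcvg.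
rewrite ler_wpM2r ?invr_ge0 ?mulr_ge0 ?sqrtr_ge0 ?(ltW U0)//.
by rewrite ler_wpM2l// ltW// be_cst_gt0.
Qed.

(** Third moments of order [n ^ b] are divided by the power 3/2 of a variance of order [n]. All
    exceptional sets are independent of [y], which makes the bound uniform. *)
Lemma quenched_rate (p A b : R) : 2 < p -> A < 1 ->
  (Ex P (fun o => (oddr (xi 0%Z o) `^ p)%R) <= A%:E)%E ->
  3 < p /\ p <= 6 /\ b = 1 \/ p <= 3 /\ 3 < b * p ->
  exists C : R, 0 < C /\ {ae P, forall o, exists n0, forall n, (n0 <= n)%N -> forall y : R,
    `|normalized_cdf (Q (env o)) (hitting_time R X n%:Z) y - Phi y| <=
    C * n%:R `^ (b - 3 / 2)}.
Proof.
move=> p2 A1 hA hb.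
have p0 : 0 < p by lra.
have p1 : 1 < p by lra.
have [C [C0 hC]] := crossing3_growth p0 A1 hA hb.
have [c c0 hc] := variance_growth.
have [r rE [r0 hr]] := Ex_site_fin p1 measurable_oddr oddr_ge0 hA.
have r1 : r < 1.
  have : p^-1 * A < p^-1 * 1 by rewrite ltr_pM2l ?invr_gt0.
  lra.
have hs : {ae P, forall o, forall i : nat, success (env o) i%:Z = 1}.
  by apply: ae_foralln => i; exact: (success_eq1 _ rE r1).
exists (be_cst R * C / c `^ (3 / 2)); split.
  by rewrite divr_gt0 ?powR_gt0// mulr_gt0// be_cst_gt0.
apply: filterS3 hC hc hs => o [n1 h1] [n2 h2] s1.
exists (maxn 1 (maxn n1 n2)) => n; rewrite !geq_max => /and3P[n0 nn1 nn2] y.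
have n0' : (0 : R) < n%:R by rewrite ltr0n.
have U0 : 0 < c * n%:R by rewrite mulr_gt0.
apply: le_trans (quenched_rate_env y (xi01^~ o) (fun i _ => s1 i) (h1 n nn1) U0 (h2 n nn2)) _.
have -> : c * n%:R * Num.sqrt (c * n%:R) = c `^ (3 / 2) * n%:R `^ (3 / 2).
  rewrite -powRM ?(ltW c0)// (_ : 3 / 2 = 1 + 2^-1 :> R); last by field.
  by rewrite powRD ?(gt_eqF U0) ?implybT// powRr1 ?(ltW U0)// powR12_sqrt// ltW.
rewrite powRB; last by rewrite (gt_eqF n0') implybT.
rewrite le_eqVlt; apply/orP; left; apply/eqP; field.
by rewrite !gt_eqF ?powR_gt0.
Qed.

End environment.

(** * Rate of convergence *)

Section environment_reduction.
Context (R : realType) (d : measure_display) (Omega : measurableType d)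
  (P : probability Omega R) (omega : int -> {RV P >-> R}).
Hypothesis omega01 : forall (x : int) (o : Omega), 0 <= omega x o <= 1.
Hypothesis omega_iid : iid_env omega.

(* Sites with [omega = 0], a null event once [E rho^p < oo], are reset to [1]
   so that the odds ratio is a real number everywhere. *)
Definition site_reset (a : R) : R := if a == 0 then 1 else a.
Definition reset_env x o : R := site_reset (omega x o).

Lemma measurable_eq0 : measurable_fun setT (fun a : R => a == 0).
Proof. by apply: measurable_fun_eqr; [exact: measurable_id|exact: measurable_cst]. Qed.

Lemma measurable_site_reset : measurable_fun setT site_reset.
Proof.
apply: measurable_fun_ifT; [exact: measurable_eq0|exact: measurable_cst|exact: measurable_id].
Qed.

Lemma measurable_rho x : measurable_fun setT (fun o => rho (omega x o)).
Proof.
rewrite (_ : (fun _ => _) = fun o => if omega x o == 0 then +oo%E else (oddr (omega x o))%:E).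
  apply: measurable_fun_ifT.
  - by apply: measurable_fun_eqr.
  - exact: measurable_cst.
  - apply/measurable_EFinP; exact: (measurableT_comp (@measurable_oddr R)).
apply/funext => o; rewrite /rho /oddr; case: eqP => // _.
by rewrite powR_inv1//; have /andP[] := omega01 x o.
Qed.

Lemma reset_env01 x o : 0 < reset_env x o <= 1.
Proof.
rewrite /reset_env /site_reset; have /andP[w0 w1] := omega01 x o.
by case: eqVneq => [_|wN0]; rewrite ?ltr01 ?lexx // lt_def wN0 w0 w1.
Qed.

Lemma measurable_reset_env x : measurable_fun setT (reset_env x).
Proof. by apply: measurableT_comp; [exact: measurable_site_reset|]. Qed.

Let measurable_preim (B : set R) : measurable B -> measurable (site_reset @^-1` B).
Proof. by move=> mB; rewrite -[X in measurable X]setTI; apply: measurable_site_reset. Qed.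

Lemma reset_env_indep (s : seq int) (B : int -> set R) : uniq s ->
  (forall i, measurable (B i)) ->
  P (\bigcap_(i in [set` s]) (reset_env i @^-1` B i)) =
  (\big[*%E/1%E]_(i <- s) P (reset_env i @^-1` B i))%E.
Proof.
move=> us mB.
exact: (omega_iid.1 s (fun i => site_reset @^-1` B i) us (fun i => measurable_preim (mB i))).
Qed.

Lemma reset_env_ident (i : int) (B : set R) : measurable B ->
  P (reset_env i @^-1` B) = P (reset_env 0 @^-1` B).
Proof. by move=> mB; exact: (omega_iid.2 i _ (measurable_preim mB)). Qed.

Section rho_moment.
Variable p : R.
Hypothesis p0 : 0 < p.
Hypothesis rho_moment_lt1 : (\int[P]_o (rho (omega 0%Z o) `^ p) < 1)%E.

Let mrho : measurable_fun setT (fun o => (rho (omega 0%Z o) `^ p)%E).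
Proof.
apply: (measurableT_comp (measurable_poweR p)).
exact: measurable_rho.
Qed.

Let rho0 o : (0 <= rho (omega 0%Z o) `^ p)%E.
Proof. exact: poweR_ge0. Qed.

Lemma reset_env_moment : exists2 A : R, A < 1 &
  (Ex P (fun o => (oddr (reset_env 0%Z o) `^ p)%R) <= A%:E)%E.
Proof.
have I0 : (0 <= \int[P]_o (rho (omega 0%Z o) `^ p))%E by exact: integral_ge0.
have Ifin : (\int[P]_o (rho (omega 0%Z o) `^ p))%E \is a fin_num.
  by rewrite ge0_fin_numE//; apply: lt_trans rho_moment_lt1 _; rewrite ltry.
exists (fine (\int[P]_o (rho (omega 0%Z o) `^ p))).
  by rewrite -lte_fin fineK.
rewrite fineK//; apply: ge0_le_integral => //.
- by move=> o _; rewrite lee_fin powR_ge0.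
- apply/measurable_EFinP; apply: measurable_powR_fun.
  exact: (measurableT_comp (@measurable_oddr R) (measurable_reset_env 0)).
move=> o _; rewrite /rho /reset_env /site_reset.
case: eqVneq => [_|wN0]; first by rewrite poweRyr ?gt_eqF// leey.
by rewrite poweR_EFin lee_fin /oddr powR_inv1//; have /andP[] := omega01 0 o.
Qed.

(** At such a point [rho ^ p] is infinite, whereas an integrable function is finite almost
    everywhere; the other sites follow by identity of laws. *)
Lemma omega_neq0 x : P [set o | omega x o = 0] = 0%E.
Proof.
have mP : measurable [set o | omega 0 o = 0].
  rewrite (_ : [set o | _] = omega 0 @^-1` [set 0])//.
rewrite (_ : [set o | _] = omega x @^-1` [set 0])//.
rewrite (omega_iid.2 x [set 0] (measurable_set1 0)).
have int : P.-integrable setT (fun o => (rho (omega 0%Z o) `^ p)%E).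
  apply/integrableP; split=> //.
  under eq_integral do rewrite gee0_abs//.
  by apply: lt_trans rho_moment_lt1 _; rewrite ltry.
apply: (measure_negligible mP).
apply: negligibleS (integrable_ae measurableT int) => o /= o0 /(_ I).
by rewrite /rho o0 eqxx poweRyr ?gt_eqF.
Qed.

Lemma reset_env_eq : {ae P, forall o, env reset_env o = fun x => omega x o}.
Proof.
have mP x : measurable [set o | omega x o = 0].
  rewrite (_ : [set o | _] = omega x @^-1` [set 0])//.
have ae x : {ae P, forall o, omega x o <> 0}.
  exists [set o | omega x o = 0]; split=> //; first exact: omega_neq0.
  by move=> o /= /contrapT.
(* Countably many null sets are joined, the integers being enumerated by the two constructors [Posz]
   and [Negz]. *)
have h1 : {ae P, forall o, forall n : nat, omega n%:Z o <> 0}.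
  by apply: ae_foralln => n; exact: ae.
have h2 : {ae P, forall o, forall n : nat, omega (Negz n) o <> 0}.
  by apply: ae_foralln => n; exact: ae.
apply: filterS2 h1 h2 => o n1 n2; apply/funext => x.
rewrite /env /reset_env /site_reset; case: eqP => // w0.
by case: x w0 => n w0; [case: (n1 n)|case: (n2 n)].
Qed.

(** Resetting enlarges the event that the site equals one only by the null event that it was
    zero. *)
Lemma reset_env_lt1 : (P [set o | omega 0%Z o = 1%R] < 1)%E ->
  (P [set o | reset_env 0 o = 1%R] < 1)%E.
Proof.
apply: le_lt_trans.
have mP (r : R) : measurable [set o | omega 0 o = r].
  rewrite (_ : [set o | _] = omega 0 @^-1` [set r])//.
rewrite -[leRHS](adde0) -(omega_neq0 0).
apply: le_trans (measureU2 _ (mP 1) (mP 0)).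
apply: le_measure; rewrite ?inE; last first.
- move=> o /=; rewrite /reset_env /site_reset.
  by case: eqP => [->|_]; [right|left].
- exact: measurableU.
- rewrite (_ : [set o | _] = reset_env 0 @^-1` [set 1])//.
  by rewrite -[X in measurable X]setTI; apply: measurable_reset_env.
Qed.

End rho_moment.

End environment_reduction.

Lemma limn_esup_le_eventually (R : realType) (u : nat -> \bar R) (M : \bar R) n0 :
  (forall n, (n0 <= n)%N -> (u n <= M)%E) -> (limn_esup u <= M)%E.
Proof.
move=> uM; rewrite limn_esup_lim; apply: lime_le; first exact: is_cvg_esups.
exists n0 => // n /= n0n; apply: ge_ereal_sup => _ [m /= nm <-].
by apply: uM; exact: leq_trans nm.
Qed.

Lemma eventually_powRN_le (R : realType) (C s e : R) : 0 <= C -> 0 < s -> 0 < e ->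
  exists n0, forall n, (n0 <= n)%N -> C * n%:R `^ (- s) <= e.
Proof.
move=> C0 s0 e0; exists (Num.trunc ((C / e) `^ s^-1)).+1 => n hn.
have h : (C / e) `^ s^-1 <= n%:R.
  by rewrite ltW// (lt_le_trans (truncnS_gt _))// ler_nat.
have n0 : (0 : R) < n%:R by rewrite ltr0n; apply: leq_trans hn.
rewrite powRN ler_pdivrMr ?powR_gt0// mulrC -ler_pdivrMr//.
have Ce : 0 <= C / e by rewrite divr_ge0// ltW.
have sN0 : s != 0 by rewrite gt_eqF.
have -> : C / e = ((C / e) `^ s^-1) `^ s by rewrite -powRrM mulVf// powRr1.
by apply: le_powR; [exact: ltW|exact: powR_ge0|exact: h].
Qed.

Lemma kappa_gt (R : realType) (d : measure_display) (Omega : measurableType d)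
    (P : probability Omega R) (omega : int -> {RV P >-> R}) (r : R) :
  (r%:E < kappa omega)%E -> exists p, [/\ r < p, 0 < p, (p%:E <= kappa omega)%E &
    (\int[P]_o (rho (omega 0%Z o) `^ p) < 1)%E].
Proof.
move=> rk; have [_ [p [p0 hp] <-] rp] := ereal_sup_gt rk.
exists p; split=> //; apply: ereal_sup_ubound; by exists p.
Qed.

(** * Rates in supremum norm and the two regimes of [kappa] *)

Section rate_of_convergence.
Context (R : realType) (dO : measure_display) (Omega : measurableType dO)
    (P : probability Omega R) (omega : int -> {RV P >-> R}).
Hypothesis omega01 : forall (x : int) (o : Omega), 0 <= omega x o <= 1.
Hypothesis omega_iid : iid_env omega.
Hypothesis omega_lt1 : (P [set o | omega 0%Z o = 1%R] < 1)%E.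
Context (dS : measure_display) (S : measurableType dS) (X : nat -> S -> int)
    (Pq : (int -> R) -> int -> probability S R).
Hypothesis Pq_walk : forall w : int -> R, (forall y, 0 <= w y <= 1) ->
  forall x : int, quenched_walk X w x (Pq w x).

Definition cdf_distance (n : nat) (o : Omega) : \bar R :=
  sup_norm (fun x => normalized_cdf (Pq (fun x => omega x o) 0) (hitting_time R X n%:Z) x
    - Phi x).

Lemma cdf_distance_ge0 n o : (0 <= cdf_distance n o)%E.
Proof.
apply: le_trans (ereal_sup_ubound _); last by exists 0.
by rewrite lee_fin.
Qed.

Lemma cdf_distance_rate (p b : R) : 2 < p ->
  (\int[P]_o (rho (omega 0%Z o) `^ p) < 1)%E ->
  3 < p /\ b = 1 \/ p <= 3 /\ 3 < b * p ->
  exists C : R, 0 < C /\ {ae P, forall o, exists n0, forall n, (n0 <= n)%N ->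
    (cdf_distance n o <= (C * n%:R `^ (b - 3 / 2))%:E)%E}.
Proof.
move=> p2 hp hb; have p0 : 0 < p by lra.
have xi01 := reset_env01 omega01.
have mxi := measurable_reset_env omega.
have [A A1 hA] := reset_env_moment omega01 p0 hp.
(* An exponent above 6 is lowered to 6 by interpolation, so that [p' / 3 <= 2]; nothing is lost,
   since [b = 1] for every [p > 3]. *)
have [p' [A' [p'2 A'1 hA' hb']]] : exists p' A' : R, [/\ 2 < p', A' < 1,
    (Ex P (fun o => (oddr (reset_env omega 0%Z o) `^ p')%R) <= A'%:E)%E &
    3 < p' /\ p' <= 6 /\ b = 1 \/ p' <= 3 /\ 3 < b * p'].
  have [p6|p6] := leP p 6.
    exists p, A; split=> //; case: hb => [[? ?]|]; [by left|by right].
  have h06 : 0 < 6 :> R by [].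
  have [A' /andP[_ A'1] hA'] := odds_moment_le xi01 mxi h06 (ltW p6) A1 hA.
  exists 6, A'; split=> //; first by lra.
  by case: hb => [[_ ->]|[p3 _]]; [left; split; [lra|]|lra].
have [C [C0 hC]] := quenched_rate xi01 mxi (reset_env_indep omega_iid)
  (reset_env_ident omega_iid) (reset_env_lt1 omega01 omega_iid p0 hp omega_lt1)
  (fun w hw => Pq_walk hw 0) p'2 A'1 hA' hb'.
exists C; split=> //.
apply: filterS2 hC (reset_env_eq omega01 omega_iid p0 hp) => o [n0 h] eo.
exists n0 => n n0n; apply: ge_ereal_sup => _ [y _ <-].
by rewrite lee_fin -eo; exact: h.
Qed.

End rate_of_convergence.

Theorem theorem1p3 (R : realType)
    (dO : measure_display) (Omega : measurableType dO)
    (P : probability Omega R) (omega : int -> {RV P >-> R})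
    (omega01 : forall (x : int) (o : Omega), 0 <= omega x o <= 1)
    (omega_iid : iid_env omega)
    (omega_lt1 : (P [set o | omega 0%Z o = 1%R] < 1)%E)
    (kappa_gt2 : (2%:E < kappa omega)%E)
    (dS : measure_display) (S : measurableType dS) (X : nat -> S -> int)
    (Pq : (int -> R) -> int -> probability S R)
    (Pq_walk : forall w : int -> R, (forall y, 0 <= w y <= 1) ->
       forall x : int, quenched_walk X w x (Pq w x)) :
  let Fbar (n : nat) (o : Omega) : R -> R :=
    normalized_cdf (Pq (fun x => omega x o) 0) (hitting_time R X n%:Z) in
  let dist (n : nat) (o : Omega) : \bar R :=
    sup_norm (fun x => Fbar n o x - Phi x) in
  ((3%:E < kappa omega)%E ->
     exists C : R, 0 < C /\
       {ae P, forall o,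
          (limn_esup (fun n => (Num.sqrt n%:R)%:E * dist n o) <= C%:E)%E})
  /\
  ((kappa omega <= 3%:E)%E ->
     forall eps : R, 0 < eps ->
       {ae P, forall o,
          (fun n : nat =>
             ((n%:R `^ (3 / 2 - 3 / fine (kappa omega) - eps))%:E
              * dist n o)%E) @ \oo --> 0%E}).
Proof.
move=> Fbar dist.
have dist_ge0 n o : (0 <= dist n o)%E by exact: cdf_distance_ge0.
split=> [kappa_gt3|kappa_le3 eps eps0].
  have [p [p3 p0 _ hp]] := kappa_gt kappa_gt3.
  have p2 : 2 < p by lra.
  have [C [C0 hC]] := cdf_distance_rate omega01 omega_iid omega_lt1 Pq_walk p2 hp
    (or_introl (conj p3 (erefl 1))).
  (* The constant is fixed before the environment is, hence deterministic; [b = 1] gives the rate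
     [n ^ (- 1/2)]. *)
  exists C; split=> //; apply: filterS hC => o [n0 h].
  apply: (@limn_esup_le_eventually _ _ _ n0.+1) => n n0n.
  have n0' : (0 : R) < n%:R by rewrite ltr0n; apply: leq_trans n0n.
  apply: (@le_trans _ _ ((Num.sqrt n%:R)%:E * (C * n%:R `^ (1 - 3 / 2))%:E)%E).
    by apply: lee_wpmul2l; [rewrite lee_fin|apply: h; exact: ltnW].
  rewrite -EFinM lee_fin -powR12_sqrt ?ler0n// mulrCA -powRD ?(gt_eqF n0') ?implybT//.
  by rewrite (_ : 2^-1 + (1 - 3 / 2) = 0 :> R) ?powRr0 ?mulr1//; field.
have kfin : kappa omega \is a fin_num.
  rewrite fin_numElt (lt_le_trans _ (ltW kappa_gt2)) ?ltNyr//.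
  by rewrite (le_lt_trans kappa_le3)// ltry.
set k := fine (kappa omega).
have kE : kappa omega = k%:E by rewrite fineK.
have k2 : 2 < k by rewrite -lte_fin -kE.
have k0 : 0 < k by lra.
(* Half of [eps] leaves room for an admissible [p] with [3 / b < p <= k], even if [k] itself is not
   admissible; the other half yields the final decay [n ^ (- eps / 2)]. *)
pose b := 3 / k + eps / 2.
have b0 : 0 < b by rewrite addr_gt0 ?divr_gt0.
have bk : 3 / b < k.
  have -> : k = (3 + k * (eps / 2)) / b by rewrite /b; field; rewrite ?gt_eqF// addr_gt0 ?mulr_gt0.
  by rewrite ltr_pM2r ?invr_gt0// ltrDl !mulr_gt0.
have [p [rp p0 pk hp]] : exists p, [/\ Num.max 2 (3 / b) < p, 0 < p,
    (p%:E <= kappa omega)%E & (\int[P]_o (rho (omega 0%Z o) `^ p) < 1)%E].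
  by apply: kappa_gt; rewrite kE lte_fin gt_max k2 bk.
have [p2 bp] : 2 < p /\ 3 / b < p by move: rp; rewrite gt_max => /andP[].
have p3 : p <= 3 by rewrite -lee_fin (le_trans pk).
have bp3 : 3 < b * p by rewrite mulrC -ltr_pdivrMr.
have [C [C0 hC]] := cdf_distance_rate omega01 omega_iid omega_lt1 Pq_walk p2 hp
  (or_intror (conj p3 bp3)).
apply: filterS hC => o [n0 h].
(* The sequence is nonnegative, so it converges to zero once its upper limit is at most every
   [e > 0]. *)
apply: limn_esup_le_cvg; last first.
  by move=> n; apply: mule_ge0; [rewrite lee_fin powR_ge0|exact: dist_ge0].
apply/lee_addgt0Pr => e e0; rewrite add0e.
have e20 : 0 < eps / 2 by rewrite divr_gt0.
have [n1 h1] := eventually_powRN_le (ltW C0) e20 e0.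
apply: (@limn_esup_le_eventually _ _ _ (maxn n0.+1 n1)) => n; rewrite geq_max => /andP[n0n n1n].
have n0' : (0 : R) < n%:R by rewrite ltr0n; apply: leq_trans n0n.
apply: (@le_trans _ _ ((n%:R `^ (3 / 2 - 3 / k - eps))%:E * (C * n%:R `^ (b - 3 / 2))%:E)%E).
  by apply: lee_wpmul2l; [rewrite lee_fin powR_ge0|apply: h; exact: ltnW].
rewrite -EFinM lee_fin mulrCA -powRD ?(gt_eqF n0') ?implybT//.
rewrite (_ : 3 / 2 - 3 / k - eps + (b - 3 / 2) = - (eps / 2)); first exact: h1.
by rewrite /b; field; rewrite gt_eqF.
Qed.
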